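(* Let $\alpha\ge 0$, $n\ge 2$, $k=n-1$. Then $R_\rho^{\alpha}$ is injective on $L^p(\mathbb{R}^n)$ for any fixed real $\rho>0$ and any $1\le p<n/(n-1)$.
   Context: For $1\le k\le n-1$, $V_{n,n-k}$ is the Stiefel manifold of real $n\times(n-k)$ matrices $v$ with $v^Tv=I_{n-k}$ (for $k=n-1$ this is the unit sphere $S^{n-1}$), and $v^\perp$ is the $k$-dimensional linear subspace of $\mathbb{R}^n$ orthogonal to the columns of $v$. Every $k$-dimensional affine plane in $\mathbb{R}^n$ has the form $\tau(v,t)=\{x\in\mathbb{R}^n: v^Tx=t\}$ with $v\in V_{n,n-k}$, $t\in\mathbb{R}^{n-k}$. The $k$-plane transform of $f$ is $$\varphi_v(t)\equiv (Rf)(v,t)=\int_{v^\perp}f(vt+u)\,d_vu,$$ where $d_vu$ is the Euclidean volume element on $v^\perp$. For $f\in L^p(\mathbb{R}^n)$, $1\le p<n/k$, it is finite for almost all $(v,t)$. For $\rho>0$ and $\alpha>0$, $$(R_\rho^{\alpha}f)(v,t)=\frac{\Gamma(\alpha+(n-k)/2)}{\pi^{(n-k)/2}\Gamma(\alpha)}\int_{|y|<1}(1-|y|^2)^{\alpha-1}\varphi_v(t-\rho y)\,dy,$$ the integral being over the unit ball of $\mathbb{R}^{n-k}$, and for $\alpha=0$ (the limit $\alpha\to 0$) $$(R_\rho^{0}f)(v,t)=\int_{S^{n-k-1}}\varphi_v(t-\rho\theta)\,d_*\theta,$$ where $d_*\theta$ is the normalized surface measure on the unit sphere $S^{n-k-1}\subset\mathbb{R}^{n-k}$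 (for $n-k=1$: the average over $\theta=\pm1$). Injectivity on $L^p(\mathbb{R}^n)$ means: if $f\in L^p(\mathbb{R}^n)$ and $(R_\rho^{\alpha}f)(v,t)=0$ for almost all $(v,t)\in V_{n,n-k}\times\mathbb{R}^{n-k}$, then $f=0$ a.e. *)

(* Defs.v *)
From HB Require Import structures.
From mathcomp Require Import all_boot all_order all_algebra.
From mathcomp Require Import all_classical all_reals all_analysis.
From mathcomp Require Import measurable_realfun.

Set Implicit Arguments.
Unset Strict Implicit.
Unset Printing Implicit Defensive.

Import Order.TTheory GRing.Theory Num.Theory.
Import numFieldNormedType.Exports.

Local Open Scope classical_set_scope.
Local Open Scope ring_scope.

(* Matrices over R carry the product sigma-algebra of the Borel sets of R, as
   the library's n.-tuple does. *)
Definition mx_display : measure_display.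
Proof. exact: default_measure_display. Qed.

Section mx_measurable.
Context {R : realType} {m n : nat}.

Definition mx_cylinders : set (set 'M[R]_(m, n)) :=
  [set C | exists (i : 'I_m) (j : 'I_n) (B : set R),
     measurable B /\ C = [set A : 'M[R]_(m, n) | B (A i j)]].

Let mx_set0 : <<s mx_cylinders >> set0.
Proof. exact: sigma_algebra0. Qed.

Let mx_setC A : <<s mx_cylinders >> A -> <<s mx_cylinders >> (~` A).
Proof. exact: sigma_algebraC. Qed.

Let mx_bigcup (F : _^nat) : (forall i, <<s mx_cylinders >> (F i)) ->
  <<s mx_cylinders >> (\bigcup_i F i).
Proof. exact: sigma_algebra_bigcup. Qed.

HB.instance Definition _ := @isMeasurable.Build mx_display
  'M[R]_(m, n) <<s mx_cylinders >> mx_set0 mx_setC mx_bigcup.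

Lemma measurable_mx_entry (i : 'I_m) (j : 'I_n) :
  measurable_fun [set: 'M[R]_(m, n)]
    (fun A : 'M[R]_(m, n) => A i j).
Proof.
move=> _ B mB; rewrite setTI; apply: sub_sigma_algebra.
by exists i, j, B.
Qed.

Lemma measurable_fun_mxP d (T : measurableType d) (F : T -> 'M[R]_(m, n)) :
  measurable_fun [set: T] F <->
  forall i j, measurable_fun [set: T] (fun x => F x i j).
Proof.
split=> [mF i j|mF].
  exact: (measurableT_comp (measurable_mx_entry i j) mF).
move=> _ Y mY; rewrite setTI.
pose G := [set Y : set 'M[R]_(m, n) | measurable (F @^-1` Y)].
have sG : sigma_algebra setT G.
  split; rewrite /G /=.
  - by rewrite preimage_set0; exact: measurable0.
  - by move=> A mA; rewrite setTD preimage_setC; exact: measurableC.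
  - by move=> A mA; rewrite preimage_bigcup; exact: bigcup_measurable.
apply: (mY G); split => // _ [i [j [B [mB ->]]]].
by rewrite /G /= -[X in measurable X]setTI; exact: mF.
Qed.

End mx_measurable.

Section lebesgue.
Context {R : realType}.
Local Open Scope ereal_scope.

Section step.
Context {n : nat} (mu : {sigma_finite_measure set 'cV[R]_n -> \bar R}).

Definition cons_cV (z : measurableTypeR R * 'cV[R]_n) : 'cV[R]_n.+1 :=
  col_mx (z.1)%:M z.2.

Definition lebesgue_step : set 'cV[R]_n.+1 -> \bar R :=
  pushforward (@lebesgue_measure R \x mu) cons_cV.

Let uncons_cV (x : 'cV[R]_n.+1) : measurableTypeR R * 'cV[R]_n :=
  (x ord0 ord0, @dsubmx _ 1 n 1 x).

Let cons_cVK : cancel cons_cV uncons_cV.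
Proof.
move=> [a y]; rewrite /uncons_cV /cons_cV /=; congr pair; last exact: col_mxKd.
rewrite (_ : ord0 = lshift n (ord0 : 'I_1)); last exact: val_inj.
by rewrite (@col_mxEu _ 1 n 1) mxE.
Qed.

Lemma measurable_cons_cV : measurable_fun setT cons_cV.
Proof.
apply/measurable_fun_mxP => i j; rewrite (ord1 j) /cons_cV /=.
rewrite -[i]/(i : 'I_(1 + n)); case: (splitP (i : 'I_(1 + n))) => k ik.
- rewrite (_ : i = lshift n k); last exact: val_inj.
  under eq_fun do rewrite (@col_mxEu _ 1 n 1) mxE (ord1 k) /= mulr1n.
  exact: measurable_fst.
- rewrite (_ : i = rshift 1 k); last exact: val_inj.
  under eq_fun do rewrite (@col_mxEd _ 1 n 1).
  exact: (measurableT_comp (measurable_mx_entry k ord0) measurable_snd).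
Qed.

Let measurable_uncons_cV : measurable_fun setT uncons_cV.
Proof.
apply/measurable_fun_pair => /=; first exact: measurable_mx_entry.
apply/measurable_fun_mxP => i j.
under eq_fun do rewrite mxE; exact: measurable_mx_entry.
Qed.

Let step0 : lebesgue_step set0 = 0.
Proof. by rewrite /lebesgue_step /pushforward preimage_set0 measure0. Qed.

Let step_ge0 A : 0 <= lebesgue_step A.
Proof. by rewrite /lebesgue_step /pushforward; exact: measure_ge0. Qed.

Let step_sigma_additive : semi_sigma_additive lebesgue_step.
Proof.
exact: (@measure_semi_sigma_additive _ _ _
  (measure_function_pushforward__canonical__measure_function_Measure
     (@lebesgue_measure R \x mu) measurable_cons_cV)).
Qed.

HB.instance Definition _ := isMeasure.Build _ _ _ lebesgue_step
  step0 step_ge0 step_sigma_additive.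

Let step_sigma_finite : sigma_finite setT lebesgue_step.
Proof.
have /sigma_finiteP[F [FT ndF Foo]] := sigma_finiteT (@lebesgue_measure R).
have /sigma_finiteP[G [GT ndG Goo]] := sigma_finiteT mu.
exists (fun i => uncons_cV @^-1` (F i `*` G i)).
  apply/esym; rewrite -subTset => x _.
  have [i _ Fi] : (\bigcup_i F i) (uncons_cV x).1 by rewrite -FT.
  have [j _ Gj] : (\bigcup_i G i) (uncons_cV x).2 by rewrite -GT.
  exists (maxn i j) => //; split.
  - by move: Fi; exact/subsetPset/ndF/leq_maxl.
  - by move: Gj; exact/subsetPset/ndG/leq_maxr.
move=> i; have [mF Fi] := Foo i; have [mG Gi] := Goo i; split.
  rewrite -[X in measurable X]setTI; apply: measurable_uncons_cV => //.
  exact: measurableX.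
rewrite /lebesgue_step /pushforward -comp_preimage.
rewrite (_ : uncons_cV \o cons_cV = id); last first.
  by apply/funext => z; exact: cons_cVK.
rewrite preimage_id.
by rewrite product_measure1E// lte_mul_pinfty// ge0_fin_numE.
Qed.

HB.instance Definition _ := Measure_isSigmaFinite.Build _ _ _ lebesgue_step
  step_sigma_finite.

End step.

(* n-dimensional Lebesgue measure: the n-fold product of the measure on R. *)
Fixpoint lebesgue_cV (n : nat) : {sigma_finite_measure set 'cV[R]_n -> \bar R} :=
  match n with
  | 0 => [the {sigma_finite_measure set 'cV[R]_0 -> \bar R} of \d_(0%R : 'cV[R]_0)]
  | n.+1 => [the {sigma_finite_measure set 'cV[R]_n.+1 -> \bar R}
             of lebesgue_step (lebesgue_cV n)]
  end.

End lebesgue.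

Section euclidean.
Context {R : realType}.

(* The library's norm on matrices is the sup norm. *)
Definition euclid_norm n (x : 'cV[R]_n) : R :=
  Num.sqrt (\sum_(i < n) x i ord0 ^+ 2).

Definition unit_ball n : set 'cV[R]_n := [set x | euclid_norm x < 1].

Definition direction n (x : 'cV[R]_n) : 'cV[R]_n := (euclid_norm x)^-1 *: x.

Lemma measurable_euclid_norm n :
  measurable_fun [set: 'cV[R]_n] (@euclid_norm n).
Proof.
apply: (@measurableT_comp _ _ _ _ _ _ (@Num.sqrt R)).
  apply: continuous_measurable_fun; exact: sqrt_continuous.
apply: measurable_sum => i; apply: measurable_funX.
exact: measurable_mx_entry.
Qed.

Lemma measurable_unit_ball n : measurable (@unit_ball n).
Proof.
rewrite (_ : @unit_ball n = setT `&` @euclid_norm n @^-1` `]-oo, 1[%classic).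
  exact: measurable_euclid_norm.
by rewrite setTI; apply/seteqP; split => x /=; rewrite in_itv.
Qed.

Lemma measurable_direction n : measurable_fun [set: 'cV[R]_n] (@direction n).
Proof.
apply/measurable_fun_mxP => i j; rewrite (ord1 j) {j}.
under eq_fun do rewrite mxE -powR_inv1 ?sqrtr_ge0//.
apply: measurable_funM; last exact: measurable_mx_entry.
apply: (measurableT_comp (measurable_powR _)).
exact: measurable_euclid_norm.
Qed.

Section sphere.
Context {n : nat}.
Local Open Scope ereal_scope.
Local Notation ball := (@unit_ball n).
Local Notation volume := (lebesgue_cV n).

(* Normalized surface measure on the unit sphere, as a measure on R^n: the
   part of the sphere in A gets the share of the volume of the unit ball taken
   by the cone with base A and apex 0.  For n = 1 it is the average of the
   Dirac masses at 1 and -1. *)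
Definition sphere_measure (A : set 'cV[R]_n) : \bar R :=
  ((fine (volume ball))^-1)%:E * volume (ball `&` @direction n @^-1` A).

Let sphere0 : sphere_measure set0 = 0.
Proof. by rewrite /sphere_measure preimage_set0 setI0 measure0 mule0. Qed.

Let c_ge0 : (0 <= (fine (volume ball))^-1)%R.
Proof. by rewrite invr_ge0 fine_ge0. Qed.

Let sphere_ge0 A : 0 <= sphere_measure A.
Proof. by rewrite mule_ge0// lee_fin. Qed.

Let sphere_sigma_additive : semi_sigma_additive sphere_measure.
Proof.
pose ballM : {measure set 'cV[R]_n -> \bar R} := mrestr volume (@measurable_unit_ball n).
pose coneM := measure_function_pushforward__canonical__measure_function_Measure
  ballM (@measurable_direction n).
have -> : sphere_measure = mscale (NngNum c_ge0) coneM.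
  apply/funext => A; rewrite /mscale /sphere_measure /=.
  by rewrite /pushforward /= /mrestr setIC.
exact: measure_semi_sigma_additive.
Qed.

HB.instance Definition _ := isMeasure.Build _ _ _ sphere_measure
  sphere0 sphere_ge0 sphere_sigma_additive.

End sphere.

End euclidean.

Arguments unit_ball {R} n.
Arguments sphere_measure {R} n.

Section plane_transform.
Context {R : realType} {n m : nat}.

Definition stiefel : set 'M[R]_(n, m) := [set v | v^T *m v = 1%:M].

(* An orthonormal basis of the orthogonal complement of the columns of v;
   stiefel_frame below provides one for every v in the Stiefel manifold. *)
Definition perp_frame (v : 'M[R]_(n, m)) : 'M[R]_(n, n - m) :=
  xget 0 [set q | q^T *m q = 1%:M /\ v^T *m q = 0].

(* The k-plane transform with k = n - m: the orthogonal complement of the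
   columns of v is the isometric image of R^k under its orthonormal basis, and
   its Euclidean volume is the image of Lebesgue measure. *)
Definition plane_transform (f : 'cV[R]_n -> R) (v : 'M[R]_(n, m))
    (t : 'cV[R]_m) : \bar R :=
  (\int[lebesgue_cV (n - m)]_y (f (v *m t + perp_frame v *m y))%:E)%E.

Definition Gamma (a : R) : R :=
  \int[lebesgue_measure]_(x in `]0, +oo[) (x `^ (a - 1) * expR (- x)).

Definition mean_transform (alpha rho : R) (f : 'cV[R]_n -> R)
    (v : 'M[R]_(n, m)) (t : 'cV[R]_m) : \bar R :=
  if alpha == 0 then
    (\int[sphere_measure m]_theta plane_transform f v (t - rho *: theta)%R)%E
  else
    ((Gamma (alpha + m%:R / 2) / (pi `^ (m%:R / 2) * Gamma alpha))%:E *
     \int[lebesgue_cV m]_(y in unit_ball m)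
       (((1 - euclid_norm y ^+ 2) `^ (alpha - 1))%:E *
        plane_transform f v (t - rho *: y)%R))%E.

End plane_transform.

Arguments stiefel {R} n m.

Section frame.
Context {R : realType} {n m : nat}.

Let unit_in_kernel k (A : 'M[R]_(n, k)) : (k < n)%N ->
  exists u : 'cV[R]_n, u^T *m u = 1%:M /\ A^T *m u = 0.
Proof.
move=> kn.
have kerN0 : kermx A != 0.
  rewrite -mxrank_eq0 mxrank_ker subn_eq0 -ltnNge.
  exact: leq_ltn_trans (rank_leq_col A) kn.
pose w := nz_row (kermx A).
have wN0 : w != 0 by rewrite nz_row_eq0.
have wA : w *m A = 0 by apply/sub_kermxP; exact: nz_row_sub.
pose s := (w *m w^T) ord0 ord0.
have sE : w *m w^T = s%:M by rewrite [LHS]mx11_scalar.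
have s0 : 0 < s.
  rewrite lt_def; apply/andP; split; last first.
    by rewrite /s mxE sumr_ge0// => i _; rewrite mxE -expr2 sqr_ge0.
  apply: contra wN0; rewrite /s mxE psumr_eq0.
    move=> /allP h; apply/eqP/rowP => i; rewrite mxE.
    have := h i (mem_index_enum i).
    by rewrite mxE -expr2 sqrf_eq0 => /eqP.
  by move=> i _; rewrite mxE -expr2 sqr_ge0.
exists ((Num.sqrt s)^-1 *: w^T); split.
  have -> : ((Num.sqrt s)^-1 *: w^T)^T = (Num.sqrt s)^-1 *: w.
    by apply/matrixP => i j; rewrite !mxE.
  rewrite -scalemxAl -scalemxAr scalerA sE -invfM -expr2.
  by rewrite sqr_sqrtr ?(ltW s0)// scale_scalar_mx mulVf ?gt_eqF.
by rewrite -scalemxAr -trmx_mul wA trmx0 scaler0.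
Qed.

Lemma stiefel_frame (v : 'M[R]_(n, m)) : stiefel n m v ->
  (perp_frame v)^T *m perp_frame v = 1%:M /\ v^T *m perp_frame v = 0.
Proof.
move=> vv.
suff H : forall k, (k <= n - m)%N ->
    exists q : 'M[R]_(n, k), q^T *m q = 1%:M /\ v^T *m q = 0.
  exact: (xgetPex 0 (H _ (leqnn _))).
elim=> [_|k IH kn].
  by exists 0; split; rewrite ?mulmx0//; apply/matrixP => -[].
have [q [qq vq]] := IH (ltnW kn).
have mk : (m + k < n)%N by rewrite -ltn_subRL.
have [u [uu]] := unit_in_kernel (row_mx v q) mk.
rewrite tr_row_mx mul_col_mx -[0](vsubmxK) => /eq_col_mx [].
rewrite !linear0 => vu qu.
have uq : u^T *m q = 0 by rewrite -[LHS]trmxK trmx_mul trmxK qu trmx0.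
rewrite -addn1; exists (row_mx q u); split.
  by rewrite tr_row_mx mul_col_row qq qu uq uu -scalar_mx_block.
by rewrite mul_mx_row vq vu row_mx0.
Qed.

End frame.

(* Main.v *)
Require Import Defs.
From HB Require Import structures.
From mathcomp Require Import all_boot all_order all_algebra.
From mathcomp Require Import all_classical all_reals all_analysis.
From mathcomp Require Import measurable_realfun.
From mathcomp Require Import ring lra.

Set Implicit Arguments.
Unset Strict Implicit.
Unset Printing Implicit Defensive.

Import Order.TTheory GRing.Theory Num.Theory.
Import numFieldNormedType.Exports.

Local Open Scope classical_set_scope.
Local Open Scope ring_scope.

(** Fix a unit vector v.  Up to a positive constant, the mean transform of f in
    the direction v is the convolution of the hyperplane integrals phi_v with a
    symmetric kernel supported in an interval, whose cosine transform m is real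
    analytic and m(0) > 0.  Hence m has finitely many zeros in each bounded
    interval, and a compactly supported F of bounded variation, cut off near
    these zeros and divided by m, can be deconvolved: if the mean transform
    vanishes, then phi_v, and so f, integrates to 0 against the cosine transform
    of F at v.x - b.  Such transforms decay only like 1/(1 + |t|); this is enough,
    because p < n/(n-1) makes f integrable against (1 + |x|)^-s for some s < 1,
    and the average of (1 + |w.x|)^-s over w in the unit ball is at most a multiple of
    (1 + |x|)^-s, so the pairing converges for almost every direction.

    With F_w(r) = theta(r) G(r w), G a product of tents, integration over w and
    the substitution z = r w turn the transforms of the F_w into a multiple of
    the transform of G, a product of Fejer kernels of scale beta.  So f
    integrates to 0 against all translates of these kernels.  Integrating the
    translate over a box and letting beta tend to infinity, f integrates to 0
    over every box, hence f = 0 almost everywhere. *)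

(** * Changes of variables and Lebesgue measure on column vectors *)

(** For p > 1 neither f nor phi_v need be integrable, so phi_v has no classical Fourier transform
    that could be divided by m; the division is made on the side of the test functions. The obstacle
    is then uniformity: when the cut-offs shrink to the zeros of m, the transforms must keep a
    common dominating function. A jump costs at most twice the sup norm in total variation, whatever
    the width of the cut-off, while the derivatives of smooth cut-offs would blow up. This is why
    the test class is bounded variation and why a decay like 1/(1 + |t|) has to suffice.

    The exponent s is squeezed from two sides: in dimension n, s > n(p-1)/p makes the weight
    integrable to the conjugate power, and s < 1 makes |t|^(-s) integrable at 0, which bounds the
    average over directions.

    Polar coordinates never occur. The surface measure is the cone measure of the ball, so almost
    every unit vector can be replaced by almost every w in the ball, and each integral over
    directions becomes a volume integral to which Fubini and scaling apply. *)

Section transport.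
Context {R : realType} d1 d2 (X : measurableType d1) (Y : measurableType d2).
Variables (mu : {measure set X -> \bar R}) (nu : {measure set Y -> \bar R}).
Local Open Scope ereal_scope.

(** The image of [mu] under [T] is [c] times [nu], so [c] is the reciprocal of the Jacobian of [T].
    Testing on nonnegative functions is the form that Tonelli carries from one coordinate to the
    next. *)
Definition transports (T : X -> Y) (c : R) :=
  [/\ measurable_fun setT T, (0 <= c)%R & forall F : Y -> \bar R,
    measurable_fun setT F -> (forall y, 0 <= F y) ->
    \int[mu]_x F (T x) = c%:E * \int[nu]_y F y].

Lemma transports_integrable T c (F : Y -> \bar R) : transports T c ->
  nu.-integrable setT F -> mu.-integrable setT (F \o T).
Proof.
move=> [mT c0 TF] /integrableP[mF Foo]; apply/integrableP; split.
  exact: measurableT_comp.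
rewrite /= (TF (fun y => `|F y|))//; last exact: measurableT_comp.
by rewrite lte_mul_pinfty.
Qed.

Lemma transports_integral T c (F : Y -> \bar R) : transports T c ->
  nu.-integrable setT F -> \int[mu]_x F (T x) = c%:E * \int[nu]_y F y.
Proof.
move=> tT iF; have [mT c0 TF] := tT.
have mF := measurable_int nu iF.
rewrite [in LHS]integralE [in RHS]integralE.
rewrite muleBr//; last exact: integrable_add_def.
have := TF _ (measurable_funepos mF) (funepos_ge0 F) => /= <-.
have := TF _ (measurable_funeneg mF) (funeneg_ge0 F) => /= <-.
congr (_ - _); apply: eq_integral => x _.
  by rewrite -[LHS]/((F \o T)^\+ x) funepos_comp.
by rewrite -[LHS]/((F \o T)^\- x) funeneg_comp.
Qed.

(** With factor 1 the positive and negative parts are preserved separately and nothing has to be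
    distributed over their difference, so the equality persists even when both parts are
    infinite. *)
Lemma transports1_integral T (F : Y -> \bar R) : transports T 1 ->
  measurable_fun setT F -> \int[mu]_x F (T x) = \int[nu]_y F y.
Proof.
move=> [mT c0 TF] mF; rewrite [in LHS]integralE [in RHS]integralE.
have := TF _ (measurable_funepos mF) (funepos_ge0 F) => /=; rewrite mul1e => <-.
have := TF _ (measurable_funeneg mF) (funeneg_ge0 F) => /=; rewrite mul1e => <-.
congr (_ - _); apply: eq_integral => x _.
  by rewrite -[LHS]/((F \o T)^\+ x) funepos_comp.
by rewrite -[LHS]/((F \o T)^\- x) funeneg_comp.
Qed.

End transport.

Section line.
Context {R : realType}.
Local Open Scope ereal_scope.
Local Notation leb := (@lebesgue_measure R).

Lemma preimage_shift_itvoc (c a b : R) :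
  (fun x : R => (x + c)%R) @^-1` `]a, b] = `](a - c)%R, (b - c)%R]%classic.
Proof.
by apply/seteqP; split => x /=; rewrite !in_itv/= ltrBlDr lerBrDr.
Qed.

Lemma preimage_scale_itvoc (c a b : R) : (0 < c)%R ->
  (fun x : R => (c * x)%R) @^-1` `]a, b] = `](c^-1 * a)%R, (c^-1 * b)%R]%classic.
Proof.
move=> c0; apply/seteqP; split => x /=;
  by rewrite !in_itv/= ler_pdivlMl// ltr_pdivrMl.
Qed.

(** A measure that gives half-open intervals their length is Lebesgue measure, so computing the
    preimages of []a, b]] is enough. Scaling is treated in the same way. *)
Lemma transports_shift_line (c : R) :
  transports leb leb (fun x : R => (x + c)%R) 1.
Proof.
have mT : measurable_fun [set: measurableTypeR R]
    ((fun x => (x + c)%R) : measurableTypeR R -> measurableTypeR R).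
  exact: measurable_funD.
split => // F mF F0; rewrite mul1e.
pose nu := measure_function_pushforward__canonical__measure_function_Measure leb mT.
have nuE A : measurable A -> leb A = nu A.
  apply: lebesgue_measure_unique => _ [[a b]] _ <-.
  rewrite /nu /= /pushforward preimage_shift_itvoc.
  rewrite !lebesgue_measure_itv/= !lte_fin ltrD2r.
  by case: ifP => // _; rewrite -!EFinD; congr _%:E; ring.
rewrite [in RHS](eq_measure_integral nu); last by move=> A mA _; exact: nuE.
by rewrite ge0_integral_pushforward.
Qed.

Lemma transports_scale_line_pos (c : R) : (0 < c)%R ->
  transports leb leb (fun x : R => (c * x)%R) c^-1.
Proof.
move=> c0.
have mT : measurable_fun [set: measurableTypeR R]
    ((fun x => (c * x)%R) : measurableTypeR R -> measurableTypeR R).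
  exact: measurable_funM.
have c0' : (0 <= c)%R by exact: ltW.
split => //; first by rewrite invr_ge0.
move=> F mF F0.
pose nu := mscale (NngNum c0')
  (measure_function_pushforward__canonical__measure_function_Measure leb mT).
have nuE A : measurable A -> leb A = nu A.
  apply: lebesgue_measure_unique => _ [[a b]] _ <-.
  transitivity (c%:E * leb `](c^-1 * a)%R, (c^-1 * b)%R]%classic); last first.
    by rewrite -(preimage_scale_itvoc a b c0).
  rewrite /=.
  rewrite !lebesgue_measure_itv/= !lte_fin ltr_pM2l ?invr_gt0//.
  case: ifP => // _; last by rewrite mule0.
  by rewrite -!EFinD -EFinM mulrBr !mulrA divff ?gt_eqF// !mul1r.
rewrite [in RHS](eq_measure_integral nu); last by move=> A mA _; exact: nuE.
rewrite ge0_integral_mscale//= muleA -EFinM mulVf ?gt_eqF// mul1e.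
by rewrite ge0_integral_pushforward.
Qed.

Lemma transports_opp_line : transports leb leb (fun x : R => (- x)%R) 1.
Proof.
have mT : measurable_fun [set: measurableTypeR R]
    ((fun x => (- x)%R) : measurableTypeR R -> measurableTypeR R).
  exact: measurable_funN.
split => // F mF F0; rewrite mul1e.
transitivity (\int[pushforward leb
    ((fun x => (- x)%R) : measurableTypeR R -> measurableTypeR R)]_y F y).
  by rewrite ge0_integral_pushforward.
apply: eq_measure_integral => /= A mA _.
exact: lebesgue_measureN.
Qed.

Lemma transports_scale_line (c : R) : c != 0%R ->
  transports leb leb (fun x : R => (c * x)%R) `|c|^-1.
Proof.
move=> c0; have [cp|cn|/eqP] := ltgtP c 0%R; last by rewrite (negbTE c0).
- rewrite ltr0_norm//.
  have [mN _ N] := transports_opp_line.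
  have cN : (0 < - c)%R by rewrite oppr_gt0.
  have [m1 i0 S] := transports_scale_line_pos cN.
  split => //; first exact: measurable_funM.
  move=> F mF F0; rewrite -S//.
  rewrite -[RHS]mul1e -(N (fun x => F (- c * x)%R))//; last first.
    by apply: measurableT_comp => //; exact: measurable_funM.
  by apply: eq_integral => x _; rewrite mulrN mulNr opprK.
- by rewrite gtr0_norm//; exact: transports_scale_line_pos.
Qed.

End line.

Section matrix_measurability.
Context {R : realType} d (T : measurableType d).

Lemma measurable_addmx m n (f g : T -> 'M[R]_(m, n)) :
  measurable_fun setT f -> measurable_fun setT g ->
  measurable_fun setT (fun x => f x + g x).
Proof.
move=> /measurable_fun_mxP mf /measurable_fun_mxP mg.
apply/measurable_fun_mxP => i j; under eq_fun do rewrite mxE.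
exact: measurable_funD.
Qed.

Lemma measurable_scalemx m n (a : T -> R) (f : T -> 'M[R]_(m, n)) :
  measurable_fun setT a -> measurable_fun setT f ->
  measurable_fun setT (fun x => a x *: f x).
Proof.
move=> ma /measurable_fun_mxP mf.
apply/measurable_fun_mxP => i j; under eq_fun do rewrite mxE.
exact: measurable_funM.
Qed.

Lemma measurable_oppmx m n (f : T -> 'M[R]_(m, n)) :
  measurable_fun setT f -> measurable_fun setT (fun x => - f x).
Proof.
move=> mf; under eq_fun do rewrite -scaleN1r.
exact: measurable_scalemx.
Qed.

Lemma measurable_subrmx m n (f g : T -> 'M[R]_(m, n)) :
  measurable_fun setT f -> measurable_fun setT g ->
  measurable_fun setT (fun x => f x - g x).
Proof. by move=> mf mg; apply: measurable_addmx => //; exact: measurable_oppmx. Qed.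

Lemma measurable_mulmx m n p (f : T -> 'M[R]_(m, n)) (g : T -> 'M[R]_(n, p)) :
  measurable_fun setT f -> measurable_fun setT g ->
  measurable_fun setT (fun x => f x *m g x).
Proof.
move=> /measurable_fun_mxP mf /measurable_fun_mxP mg.
apply/measurable_fun_mxP => i j; under eq_fun do rewrite mxE.
by apply: measurable_sum => k; exact: measurable_funM.
Qed.

Lemma measurable_trmx m n (f : T -> 'M[R]_(m, n)) :
  measurable_fun setT f -> measurable_fun setT (fun x => (f x)^T).
Proof.
move=> /measurable_fun_mxP mf.
apply/measurable_fun_mxP => i j; under eq_fun do rewrite mxE.
exact: mf.
Qed.

Lemma measurable_entrymx m n (f : T -> 'M[R]_(m, n)) i j :
  measurable_fun setT f -> measurable_fun setT (fun x => f x i j).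
Proof. by move=> /measurable_fun_mxP. Qed.

Lemma measurable_consmx n (a : T -> R) (f : T -> 'cV[R]_n) :
  measurable_fun setT a -> measurable_fun setT f ->
  measurable_fun setT (fun x => cons_cV (a x, f x)).
Proof.
move=> ma mf; apply: measurableT_comp; first exact: measurable_cons_cV.
by apply/measurable_fun_pair.
Qed.

End matrix_measurability.

Section cV_integration.
Context {R : realType}.
Local Notation leb := (@lebesgue_measure R).
Local Notation vol := (@lebesgue_cV R).
Local Open Scope ereal_scope.

Lemma cons_cV_eta n (x : 'cV[R]_n.+1) :
  cons_cV (x ord0 ord0, @dsubmx _ 1 n 1 x) = x.
Proof.
rewrite /cons_cV /=; apply: (etrans _ (@vsubmxK _ 1 n 1 x)).
congr (@col_mx _ 1 n 1 _ _); apply/matrixP => i j; rewrite !ord1 !mxE eqxx mulr1n.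
by congr (x _ _); exact: val_inj.
Qed.

Lemma cons_cV0 n (a : R) (y : 'cV[R]_n) : cons_cV (a, y) ord0 ord0 = a.
Proof.
rewrite /cons_cV /= (_ : ord0 = lshift n (ord0 : 'I_1)); last exact: val_inj.
by rewrite (@col_mxEu _ 1 n 1) mxE.
Qed.

Lemma cons_cVS n (a : R) (y : 'cV[R]_n) (i : 'I_n) :
  cons_cV (a, y) (lift ord0 i) ord0 = y i ord0.
Proof.
rewrite /cons_cV /= (_ : lift ord0 i = rshift 1 i); last exact: val_inj.
by rewrite (@col_mxEd _ 1 n 1).
Qed.

Lemma cons_cVD n (a b : R) (y z : 'cV[R]_n) :
  (cons_cV (a, y) + cons_cV (b, z))%R = cons_cV ((a + b)%R, (y + z)%R).
Proof. by rewrite /cons_cV /= (@add_col_mx _ 1 n 1) raddfD. Qed.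

Lemma cons_cVZ n (c a : R) (y : 'cV[R]_n) :
  (c *: cons_cV (a, y))%R = cons_cV ((c * a)%R, (c *: y)%R).
Proof. by rewrite /cons_cV /= (@scale_col_mx _ 1 n 1) scale_scalar_mx. Qed.

Lemma ge0_integral_cVS n (F : 'cV[R]_n.+1 -> \bar R) :
  measurable_fun setT F -> (forall x, 0 <= F x) ->
  \int[vol n.+1]_x F x = \int[leb]_a \int[vol n]_y F (cons_cV (a, y)).
Proof.
move=> mF F0.
rewrite -(fubini_tonelli1 (fun z => F (cons_cV z)))//; last first.
  exact: measurableT_comp (measurable_cons_cV (n := n)).
exact: (ge0_integral_pushforward (measurable_cons_cV (n := n)) (leb \x vol n)%E
  measurableT mF (fun y _ => F0 y)).
Qed.

Lemma transports_cons n :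
  transports (leb \x vol n) (vol n.+1) (@cons_cV R n) 1.
Proof.
split=> //; first exact: measurable_cons_cV.
move=> F mF F0; rewrite mul1e ge0_integral_cVS//.
rewrite (fubini_tonelli1 (fun z => F (cons_cV z)))//.
exact: measurableT_comp (measurable_cons_cV (n := n)).
Qed.

Lemma measurable_cons1 n (F : 'cV[R]_n.+1 -> \bar R) a :
  measurable_fun setT F -> measurable_fun setT (fun y => F (cons_cV (a, y))).
Proof.
move=> mF; apply: measurableT_comp => //.
exact: (@measurable_consmx _ _ _ _ (fun=> a) id).
Qed.

Lemma measurable_integral_cons n (F : 'cV[R]_n.+1 -> \bar R) :
  measurable_fun setT F -> (forall x, 0 <= F x) ->
  measurable_fun setT (fun a : measurableTypeR R => \int[vol n]_y F (cons_cV (a, y))).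
Proof.
move=> mF F0.
apply: (measurable_fun_fubini_tonelli_F (fun z => F (cons_cV z))) => //.
exact: measurableT_comp (measurable_cons_cV (n := n)).
Qed.

Lemma ge0_integral_cV0 (F : 'cV[R]_0 -> \bar R) :
  measurable_fun setT F -> \int[vol 0]_x F x = F 0%R.
Proof. by move=> mF; rewrite /= integral_dirac// diracT mul1e. Qed.

Lemma transports_shift n (c : 'cV[R]_n) :
  transports (vol n) (vol n) (fun x => (x + c)%R) 1.
Proof.
have mT m (c' : 'cV[R]_m) : measurable_fun setT (fun x : 'cV[R]_m => (x + c')%R).
  by apply: measurable_addmx => //; exact: measurable_id.
split=> [||F mF F0]; [exact: mT|by []|rewrite mul1e].
elim: n => [|n IH] in c F mF F0 *.
  by apply: eq_integral => x _; rewrite [x in LHS]flatmx0 [c]flatmx0 addr0 [x]flatmx0.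
have mFc : measurable_fun setT (fun x : 'cV[R]_n.+1 => F (x + c)%R).
  exact: (measurableT_comp mF (mT _ _)).
rewrite (ge0_integral_cVS mF F0) (ge0_integral_cVS mFc (fun=> F0 _)).
have [_ _ T] := transports_shift_line (c ord0 ord0).
pose G (a : R) := \int[vol n]_y F (cons_cV (a, y)).
have mG : measurable_fun setT G by exact: measurable_integral_cons.
have G0 a : 0 <= G a by exact: integral_ge0.
rewrite -[RHS]mul1e -(T G mG G0); apply: eq_integral => a _; rewrite /G.
rewrite -(IH (@dsubmx _ 1 n 1 c) (fun y => F (cons_cV ((a + c ord0 ord0)%R, y))))//; last first.
  exact: measurable_cons1.
by apply: eq_integral => y _; rewrite -[c in LHS]cons_cV_eta cons_cVD.
Qed.

Lemma transports_scale n (c : R) : c != 0%R ->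
  transports (vol n) (vol n) (fun x => (c *: x)%R) (`|c| ^- n)%R.
Proof.
move=> c0.
have mT m : measurable_fun setT (fun x : 'cV[R]_m => (c *: x)%R).
  by apply: (measurable_scalemx (f := id)) => //; exact: measurable_id.
have cn0 m : (0 <= `|c| ^- m)%R by rewrite invr_ge0 exprn_ge0.
split=> [||F mF F0]; [exact: mT|exact: cn0|].
elim: n => [|n IH] in F mF F0 *.
  rewrite expr0 invr1 mul1e.
  by apply: eq_integral => x _; rewrite [x in LHS]flatmx0 [x]flatmx0 scaler0.
have mFc : measurable_fun setT (fun x : 'cV[R]_n.+1 => F (c *: x)%R).
  exact: (measurableT_comp mF (mT _)).
rewrite (ge0_integral_cVS mF F0) (ge0_integral_cVS mFc (fun=> F0 _)).
have [mS _ T] := transports_scale_line c0.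
pose G (a : R) := \int[vol n]_y F (cons_cV (a, y)).
have mG : measurable_fun setT G by exact: measurable_integral_cons.
have G0 a : 0 <= G a by exact: integral_ge0.
rewrite exprS invfM mulrC EFinM -muleA -(T G mG G0).
have mGc : measurable_fun setT (fun a : R => G (c * a)%R).
  exact: (measurableT_comp mG mS).
rewrite -ge0_integralZl//.
apply: eq_integral => a _; rewrite /G.
rewrite -(IH (fun y => F (cons_cV ((c * a)%R, y))))//; last first.
  exact: measurable_cons1.
by apply: eq_integral => y _; rewrite cons_cVZ.
Qed.

Lemma transports_opp n : transports (vol n) (vol n) (fun x => (- x)%R) 1.
Proof.
have := @transports_scale n (-1)%R; rewrite oppr_eq0 oner_eq0.
move=> /(_ isT); rewrite normrN1 expr1n invr1.
by congr transports; apply/funext => x; rewrite scaleN1r.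
Qed.

End cV_integration.

Lemma measurable_abse_comp {R : realType} d (T : measurableType d) (f : T -> \bar R) :
  measurable_fun setT f -> measurable_fun setT (fun x => `|f x|%E).
Proof. by move=> mf; exact: measurableT_comp. Qed.

Section euclidean_geometry.
Context {R : realType}.

Definition dot n (x y : 'cV[R]_n) : R := (x^T *m y) ord0 ord0.

Lemma dotE n (x y : 'cV[R]_n) : dot x y = \sum_(i < n) x i ord0 * y i ord0.
Proof. by rewrite /dot mxE; apply: eq_bigr => i _; rewrite mxE. Qed.

Lemma dotC n (x y : 'cV[R]_n) : dot x y = dot y x.
Proof. by rewrite !dotE; apply: eq_bigr => i _; rewrite mulrC. Qed.

Lemma dotBr n (x y z : 'cV[R]_n) : dot x (y - z) = dot x y - dot x z.
Proof. by rewrite /dot mulmxBr !mxE. Qed.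

Lemma dotZr n c (x y : 'cV[R]_n) : dot x (c *: y) = c * dot x y.
Proof. by rewrite /dot -scalemxAr mxE. Qed.

Lemma dotZl n c (x y : 'cV[R]_n) : dot (c *: x) y = c * dot x y.
Proof. by rewrite dotC dotZr dotC. Qed.

Lemma dotBl n (x y z : 'cV[R]_n) : dot (x - y) z = dot x z - dot y z.
Proof. by rewrite dotC dotBr dotC (dotC z y). Qed.

Lemma dot_ge0 n (x : 'cV[R]_n) : 0 <= dot x x.
Proof. by rewrite dotE sumr_ge0// => i _; rewrite -expr2 sqr_ge0. Qed.

Lemma euclid_normE n (x : 'cV[R]_n) : euclid_norm x = Num.sqrt (dot x x).
Proof.
by rewrite /euclid_norm dotE; congr Num.sqrt; apply: eq_bigr => i _; rewrite expr2.
Qed.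

Lemma euclid_norm_ge0 n (x : 'cV[R]_n) : 0 <= euclid_norm x.
Proof. exact: sqrtr_ge0. Qed.

Lemma sqr_euclid_norm n (x : 'cV[R]_n) : euclid_norm x ^+ 2 = dot x x.
Proof. by rewrite euclid_normE sqr_sqrtr// dot_ge0. Qed.

Lemma euclid_normZ n c (x : 'cV[R]_n) :
  euclid_norm (c *: x) = `|c| * euclid_norm x.
Proof.
by rewrite !euclid_normE dotZl dotZr mulrA -expr2 sqrtrM ?sqr_ge0// sqrtr_sqr.
Qed.

Lemma euclid_normN n (x : 'cV[R]_n) : euclid_norm (- x) = euclid_norm x.
Proof. by rewrite -scaleN1r euclid_normZ normrN1 mul1r. Qed.

Lemma dot_mulmx_orthogonal m n (O : 'M[R]_(m, n)) (x y : 'cV[R]_n) :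
  O^T *m O = 1%:M -> dot (O *m x) (O *m y) = dot x y.
Proof. by move=> OO; rewrite /dot trmx_mul mulmxA -(mulmxA x^T) OO mulmx1. Qed.

Lemma euclid_norm_orthogonal m n (O : 'M[R]_(m, n)) (x : 'cV[R]_n) :
  O^T *m O = 1%:M -> euclid_norm (O *m x) = euclid_norm x.
Proof. by move=> OO; rewrite !euclid_normE dot_mulmx_orthogonal. Qed.

Lemma dot_le_norm n (x y : 'cV[R]_n) :
  `|dot x y| <= euclid_norm x * euclid_norm y.
Proof.
rewrite -(@ler_pXn2r _ 2)// ?nnegrE ?mulr_ge0 ?euclid_norm_ge0//.
rewrite -normrX ger0_norm ?sqr_ge0// exprMn !sqr_euclid_norm.
have [y0|y0] := eqVneq (dot y y) 0.
  suff -> : dot x y = 0 by rewrite expr0n/= mulr_ge0 ?dot_ge0.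
  move: y0; rewrite dotE => /eqP; rewrite psumr_eq0; last first.
    by move=> i _; rewrite -expr2 sqr_ge0.
  move=> /allP y0; rewrite dotE big1// => i _.
  have := y0 i (mem_index_enum i).
  by rewrite /= -expr2 sqrf_eq0 => /eqP ->; rewrite mulr0.
have yp : 0 < dot y y by rewrite lt_def y0 dot_ge0.
have := dot_ge0 (dot y y *: x - dot x y *: y).
rewrite dotBr !dotBl !dotZr !dotZl (dotC y x).
set a := dot x x; set b := dot y y; set c := dot x y => H.
have {}H : 0 <= b * (a * b - c ^+ 2) by nra.
by rewrite -subr_ge0 -(pmulr_rge0 _ yp).
Qed.

Lemma entry_le_norm n (x : 'cV[R]_n) i : `|x i ord0| <= euclid_norm x.
Proof.
rewrite -sqrtr_sqr ler_wsqrtr// (bigD1 i)//= lerDl sumr_ge0// => j _.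
exact: sqr_ge0.
Qed.

Lemma norm_le_sum n (x : 'cV[R]_n) :
  euclid_norm x <= \sum_(i < n) `|x i ord0|.
Proof.
rewrite -(@ler_pXn2r _ 2)// ?nnegrE ?euclid_norm_ge0 ?sumr_ge0//.
rewrite sqr_euclid_norm dotE expr2 mulr_suml ler_sum// => i _.
rewrite (le_trans (ler_norm _))// normrM ler_wpM2l//.
by rewrite (bigD1 i)//= lerDl sumr_ge0.
Qed.

Lemma norm_le_prod n (x : 'cV[R]_n) :
  1 + euclid_norm x <= \prod_(i < n) (1 + `|x i ord0|).
Proof.
apply: (@le_trans _ _ (1 + \sum_(i < n) `|x i ord0|)).
  by rewrite lerD2l norm_le_sum.
elim: (index_enum _) => [|i s IH]; first by rewrite !big_nil addr0.
rewrite !big_cons mulrDl mul1r addrCA addrC lerD//.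
by rewrite ler_peMr// (le_trans _ IH)// lerDl sumr_ge0.
Qed.

End euclidean_geometry.

Section cV_fubini.
Context {R : realType}.
Local Notation leb := (@lebesgue_measure R).
Local Notation vol := (@lebesgue_cV R).
Local Open Scope ereal_scope.

Lemma integrable_cVS n (F : 'cV[R]_n.+1 -> \bar R) :
  (vol n.+1).-integrable setT F ->
  (leb \x vol n).-integrable setT (F \o @cons_cV R n).
Proof. exact: transports_integrable (transports_cons n). Qed.

Lemma integral_cVS n (F : 'cV[R]_n.+1 -> \bar R) :
  (vol n.+1).-integrable setT F ->
  \int[vol n.+1]_x F x = \int[leb]_a \int[vol n]_y F (cons_cV (a, y)).
Proof.
move=> iF; have := transports_integral (transports_cons n) iF; rewrite mul1e => <-.
by have := integral12_prod_meas1 (integrable_cVS iF).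
Qed.

Lemma integral_prod_cV n (g : 'I_n -> R -> R) :
  (forall i, leb.-integrable setT (EFin \o g i)) ->
  let F := fun x : 'cV[R]_n => (\prod_(i < n) g i (x i ord0))%R in
  (vol n).-integrable setT (EFin \o F) /\
  \int[vol n]_x (F x)%:E = (\prod_(i < n) \int[leb]_t g i t)%R%:E.
Proof.
elim: n => [|n IH] in g *.
  move=> _ F.
  have FE : F = cst 1%R by apply/funext => x; rewrite /F big_ord0.
  have mF : measurable_fun setT (EFin \o F) by apply/measurable_EFinP; rewrite FE; exact: measurable_cst.
  split; last by rewrite (ge0_integral_cV0 mF) FE big_ord0.
  apply/integrableP; split; first exact: mF.
  by rewrite (ge0_integral_cV0 (measurable_abse_comp mF)) FE ltry.
move=> ig F.
have [iP EP] := IH (fun i => g (lift ord0 i)) (fun i => ig _).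
set P := (fun x : 'cV[R]_n => _) in iP EP.
have FE a y : F (cons_cV (a, y)) = (g ord0 a * P y)%R.
  rewrite /F /P big_ord_recl cons_cV0; congr (_ * _)%R.
  by apply: eq_bigr => i _; rewrite cons_cVS.
have mg i : measurable_fun setT (g i).
  by apply/measurable_EFinP; exact: measurable_int (ig i).
have mF : measurable_fun setT F.
  apply: measurable_prod => i _; apply: measurableT_comp (mg i) _.
  exact: measurable_mx_entry.
have mP : measurable_fun setT P.
  by apply/measurable_EFinP; exact: measurable_int iP.
have iF : (vol n.+1).-integrable setT (EFin \o F).
  apply/integrableP; split; first exact/measurable_EFinP.
  rewrite (ge0_integral_cVS (F := fun x => `|(EFin \o F) x|))//; last first.
    by apply: measurable_abse_comp; exact/measurable_EFinP.
  rewrite (eq_integral (fun a : measurableTypeR R => `|(g ord0 a)%:E| * \int[vol n]_y `|(P y)%:E|)).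
    rewrite ge0_integralZr//; last 2 first.
    - exact: measurable_abse_comp (measurable_int _ (ig ord0)).
    - exact: integral_ge0.
    have /integrableP[_ i1] := ig ord0; have /integrableP[_ i2] := iP.
    by rewrite lte_mul_pinfty// ?integral_ge0// ge0_fin_numE// integral_ge0.
  move=> a _; rewrite -ge0_integralZl//; last first.
    exact: measurable_abse_comp (measurable_int _ iP).
  by apply: eq_integral => y _; rewrite /= FE normrM EFinM.
split=> //; rewrite (integral_cVS (F := EFin \o F))//.
rewrite (eq_integral (fun a : measurableTypeR R => (g ord0 a)%:E * \int[vol n]_y (P y)%:E)); last first.
  move=> a _; rewrite -integralZl//.
  by apply: eq_integral => y _; rewrite /= FE EFinM.
rewrite EP integralZr//; last exact: ig.
rewrite big_ord_recl EFinM; congr (_ * _).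
by rewrite /Rintegral fineK// integrable_fin_num//; exact: ig.
Qed.

Lemma integral_itv_indic (a b : R) : (a <= b)%R ->
  (\int[leb]_t (\1_(`]a, b[) t : R))%R = (b - a)%R.
Proof.
move=> ab; rewrite /Rintegral integral_indic//= setIT lebesgue_measure_itv/= lte_fin.
by case: ltP => //= ba; apply/esym/eqP; rewrite subr_eq0 eq_le ab ba.
Qed.

(** Stand-in for the ball: its indicator is a product over the coordinates, so integrals over it
    factor. *)
Definition cube n (c : R) : set 'cV[R]_n := [set x | forall i, `|x i ord0| < c]%R.
Arguments cube : clear implicits.

Lemma cubeE n (c : R) (x : 'cV[R]_n) :
  \1_(cube n c) x = (\prod_(i < n) \1_(`](- c)%R, c[) (x i ord0))%R :> R.
Proof.
rewrite indicE; have [xc|xc] := pselect (cube n c x).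
  rewrite mem_set//; apply/esym/big1 => i _.
  by rewrite indicE mem_set//= in_itv/= -ltr_norml.
rewrite memNset//; apply/esym/eqP/prodf_eq0.
move/existsNP : xc => [i /negP xi]; exists i => //.
by rewrite indicE memNset//= in_itv/= -ltr_norml; exact/negP.
Qed.

Lemma measurable_cube n c : measurable (cube n c).
Proof.
apply/(measurable_indicP R).
have -> : (\1_(cube n c) : 'cV[R]_n -> R) = fun x =>
    (\prod_(i < n) \1_(`](- c)%R, c[) (x i ord0))%R.
  by apply/funext => x; exact: cubeE.
apply: measurable_prod => i _; apply: measurableT_comp; last exact: measurable_mx_entry.
exact: measurable_indic.
Qed.

Lemma vol_cube n (c : R) : (0 <= c)%R -> vol n (cube n c) = ((c *+ 2) ^+ n)%R%:E.
Proof.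
move=> c0.
have := @integral_prod_cV n (fun=> \1_(`](- c)%R, c[)) (fun=> integrable_indic_itv _ _ _ _).
move=> -[_]; under eq_integral do rewrite -cubeE.
rewrite integral_indic//; last exact: measurable_cube.
rewrite setIT => ->; rewrite integral_itv_indic; last lra.
by rewrite prodr_const card_ord opprK mulr2n.
Qed.

End cV_fubini.

Arguments cube {R} n c.

Section rotation.
Context {R : realType}.
Local Notation leb := (@lebesgue_measure R).
Local Notation vol := (@lebesgue_cV R).
Local Open Scope ereal_scope.

Lemma unit_ball_cube n : unit_ball n `<=` @cube R n 1.
Proof. by move=> x xb i; exact: le_lt_trans (entry_le_norm _ _) xb. Qed.

Lemma vol_ball_lty n : vol n (unit_ball n) < +oo.
Proof.
apply: (@le_lt_trans _ _ (vol n (@cube R n 1))); last by rewrite vol_cube ?ltry.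
apply: le_measure; rewrite ?inE; [exact: measurable_unit_ball|exact: measurable_cube|].
exact: unit_ball_cube.
Qed.

Lemma vol_ball_gt0 n : 0 < vol n (unit_ball n).
Proof.
(* Half-width 1/(n+1) keeps the sum of the n absolute entries below 1, also when n = 0. *)
apply: (@lt_le_trans _ _ (vol n (@cube R n n.+1%:R^-1))).
  by rewrite vol_cube// lte_fin exprn_gt0// pmulrn_lgt0// invr_gt0.
apply: le_measure; rewrite ?inE; [exact: measurable_cube|exact: measurable_unit_ball|].
move=> x xc; apply: le_lt_trans (norm_le_sum _) _.
apply: (@le_lt_trans _ _ (\sum_(i < n) n.+1%:R^-1)%R).
  by apply: ler_sum => i _; exact: ltW.
by rewrite sumr_const card_ord -[ltLHS]mulr_natl ltr_pdivrMr// mul1r ltr_nat.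
Qed.

Lemma ge0_integral_reflect n (z : 'cV[R]_n) (F : 'cV[R]_n -> \bar R) :
  measurable_fun setT F -> (forall x, 0 <= F x) ->
  \int[vol n]_y F (z - y)%R = \int[vol n]_y F y.
Proof.
move=> mF F0.
have [mS _ S] := transports_shift z; have [_ _ N] := @transports_opp R n.
have := S _ mF F0; rewrite mul1e => <-.
have := N (fun x => F (x + z)%R) (measurableT_comp mF mS) (fun=> F0 _).
by rewrite mul1e => <-; apply: eq_integral => y _; rewrite addrC.
Qed.

(* Integrating F(O x) b(O x + y) over x and y, with b the indicator of the unit
   ball, in both orders gives |B| times both sides. *)
Lemma transports_orthogonal n (O : 'M[R]_n) : (O^T *m O = 1%:M)%R ->
  transports (vol n) (vol n) (mulmx O) 1.
Proof.
move=> OO.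
have OO' : (O *m O^T = 1%:M)%R by exact: mulmx1C.
have mO : measurable_fun setT (mulmx O : 'cV[R]_n -> 'cV[R]_n).
  by apply: measurable_mulmx; [exact: measurable_cst|exact: measurable_id].
split=> // F mF F0; rewrite mul1e.
pose b (x : 'cV[R]_n) : \bar R := (\1_(unit_ball n) x)%:E.
have mb : measurable_fun setT b.
  by apply/measurable_EFinP; apply: measurable_indic; exact: measurable_unit_ball.
have b0 x : 0 <= b x by rewrite /b lee_fin.
have ib : \int[vol n]_y b y = vol n (unit_ball n).
  by rewrite integral_indic//; [rewrite setIT|exact: measurable_unit_ball].
have bO x : b (O *m x)%R = b x.
  rewrite /b !indicE (_ : (O *m x \in unit_ball n)%R = (x \in unit_ball n))//.
  by apply/idP/idP; rewrite !inE /unit_ball /= euclid_norm_orthogonal.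
pose H (z : 'cV[R]_n * 'cV[R]_n) := F (O *m z.1)%R * b (z.2 + O *m z.1)%R.
have mH : measurable_fun setT H.
  apply: emeasurable_funM; first exact: (measurableT_comp mF (measurableT_comp mO measurable_fst)).
  apply: (measurableT_comp mb); apply: measurable_addmx; first exact: measurable_snd.
  exact: (measurableT_comp mO measurable_fst).
have H0 z : 0 <= H z by rewrite mule_ge0.
have mFO : measurable_fun setT (fun x => F (O *m x)%R) by exact: measurableT_comp.
pose K (z : 'cV[R]_n * 'cV[R]_n) := F (O *m z.2 - z.1)%R * b z.2.
have mK : measurable_fun setT K.
  apply: emeasurable_funM; last exact: (measurableT_comp mb measurable_snd).
  apply: (measurableT_comp mF); apply: measurable_subrmx; last exact: measurable_fst.
  exact: (measurableT_comp mO measurable_snd).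
have K0 z : 0 <= K z by rewrite mule_ge0.
have E1 : \int[vol n]_x \int[vol n]_y H (x, y) =
    vol n (unit_ball n) * \int[vol n]_x F (O *m x)%R.
  rewrite -ge0_integralZl//; apply: eq_integral => x _ /=.
  rewrite /H /= ge0_integralZl//; last first.
    by apply: (measurableT_comp mb); apply: measurable_addmx;
      [exact: measurable_id|exact: measurable_cst].
  rewrite muleC; congr (_ * _).
  have [_ _ S] := transports_shift (O *m x)%R.
  by rewrite (S b mb b0) mul1e.
have E2 : \int[vol n]_y \int[vol n]_x K (y, x) =
    vol n (unit_ball n) * \int[vol n]_x F x.
  rewrite (fubini_tonelli (m1 := vol n) (m2 := vol n) K mK K0).
  rewrite -ib -ge0_integralZr ?integral_ge0//; apply: eq_integral => x _.
  rewrite /K /= ge0_integralZr//; last first.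
    by apply: (measurableT_comp mF); apply: measurable_subrmx;
      [exact: measurable_cst|exact: measurable_id].
  by rewrite muleC ge0_integral_reflect.
suff E : \int[vol n]_x \int[vol n]_y H (x, y) = \int[vol n]_y \int[vol n]_x K (y, x).
  move: E; rewrite E1 E2.
  have := vol_ball_gt0 n; have := vol_ball_lty n.
  case: (vol n (unit_ball n)) => // r _; rewrite lte_fin => r0 E.
  rewrite -[LHS]mul1e -[RHS]mul1e (_ : 1 = r^-1%:E * r%:E).
    by rewrite -!muleA E.
  by rewrite -EFinM mulVf// gt_eqF.
rewrite (fubini_tonelli (m1 := vol n) (m2 := vol n) H mH H0); apply: eq_integral => y _.
(* Replacing x by x - O^T y turns O x into O x - y and y + O x into O x; the ball is invariant under
   O, so [H] becomes [K]. *)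
have [_ _ S] := transports_shift (- (O^T *m y))%R.
have := S (fun x => H (x, y)) (measurableT_comp mH (measurable_pair2 y)) (fun=> H0 _).
rewrite mul1e => <-; apply: eq_integral => x _; rewrite /H /K /=.
by rewrite mulmxBr mulmxA OO' mul1mx (addrC y) subrK bO.
Qed.

(** [v] and [q] side by side form an orthogonal matrix; rotation invariance then gives Tonelli along
    the family of hyperplanes orthogonal to [v]. *)
Lemma transports_frame k (v : 'cV[R]_k.+1) (q : 'M[R]_(k.+1, k)) :
  (v^T *m v = 1%:M)%R -> (q^T *m q = 1%:M)%R -> (v^T *m q = 0)%R ->
  transports (vol 1 \x vol k) (vol k.+1)
    (fun z : 'cV[R]_1 * 'cV[R]_k => v *m z.1 + q *m z.2)%R 1.
Proof.
move=> vv qq vq; pose O : 'M[R]_k.+1 := @row_mx _ k.+1 1 k v q.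
have OO : (O^T *m O = 1%:M)%R.
  rewrite /O (@tr_row_mx _ k.+1 1 k); apply: (etrans (mul_col_row v^T q^T v q)); rewrite vv qq vq.
  rewrite (_ : (q^T *m v = 0)%R) -?(scalar_mx_block 1 k 1)//.
  by rewrite -[LHS]trmxK trmx_mul trmxK vq trmx0.
have [mO _ TO] := transports_orthogonal OO.
have mT : measurable_fun setT
    (fun z : 'cV[R]_1 * 'cV[R]_k => v *m z.1 + q *m z.2)%R.
  apply: measurable_addmx; apply: measurable_mulmx; try exact: measurable_cst.
    exact: measurable_fst.
  exact: measurable_snd.
split=> // F mF F0; rewrite mul1e.
have mFT := measurableT_comp mF mT.
rewrite (fubini_tonelli1 (fun z => F (v *m z.1 + q *m z.2)%R))//.
rewrite /fubini_F /= (ge0_integral_cVS (n := 0)); last 2 first.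
- exact: (measurable_fun_fubini_tonelli_F (fun z => F (v *m z.1 + q *m z.2)%R)).
- by move=> x; exact: integral_ge0.
have := TO F mF F0; rewrite mul1e => <-.
have mFO : measurable_fun setT (F \o mulmx O) by exact: measurableT_comp.
rewrite (ge0_integral_cVS mFO); last by move=> x; exact: F0.
apply: eq_integral => a _.
rewrite ge0_integral_cV0; last first.
  apply: (measurable_cons1 (n := 0) (F := fun t => \int[vol k]_y F (v *m t + q *m y)%R)).
  exact: (measurable_fun_fubini_tonelli_F (fun z => F (v *m z.1 + q *m z.2)%R)).
apply: eq_integral => y _ /=; congr F.
rewrite /O /cons_cV /= (@mul_row_col _ k.+1 1 k 1); congr (v *m _ + _)%R.
by apply/matrixP => i j; rewrite !ord1 cons_cV0 mxE eqxx mulr1n.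
Qed.

End rotation.

(** * Polynomial weights *)

Section power_integrals.
Context {R : realType}.
Local Notation leb := (@lebesgue_measure R).
Local Open Scope ereal_scope.

Lemma derivable_powR_scaled (c x : R) : (0 < x)%R ->
  derivable (fun t : R => ((c + 1)^-1 * t `^ (c + 1))%R) x 1.
Proof.
move=> x0; apply: derivableM; first exact: derivable_cst.
by apply: derivable_powR; rewrite in_itv/= andbT.
Qed.

Lemma continuous_powR_at (c x : R) : (0 < x)%R ->
  {for x, continuous (fun t : R => (t `^ c)%R)}.
Proof.
move=> x0; apply: differentiable_continuous; apply/derivable1_diffP.
by apply: derivable_powR; rewrite in_itv/= andbT.
Qed.

Lemma integral_powR_itv (c x y : R) : (0 < x)%R -> (x < y)%R -> (c + 1 != 0)%R ->
  \int[leb]_(t in `[x, y]) (t `^ c)%:E =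
    ((c + 1)^-1 * y `^ (c + 1) - (c + 1)^-1 * x `^ (c + 1))%:E.
Proof.
move=> x0 xy c1.
have pos z : (z \in `[x, y] -> 0 < z)%R by rewrite in_itv/= => /andP[/(lt_le_trans x0)].
rewrite (@continuous_FTC2 _ (fun t => t `^ c)%R
  (fun t => (c + 1)^-1 * t `^ (c + 1))%R)//.
- apply: continuous_in_subspaceT => z /set_mem /= zxy.
  exact/continuous_powR_at/pos.
- have cF z : (0 < z)%R ->
      {for z, continuous (fun t : R => ((c + 1)^-1 * t `^ (c + 1))%R)}.
    move=> z0; apply: differentiable_continuous; apply/derivable1_diffP.
    exact: derivable_powR_scaled.
  split.
  + by move=> z; rewrite in_itv/= => /andP[/(lt_trans x0) z0 _]; exact: derivable_powR_scaled.
  + by apply: cvg_at_right_filter; exact: cF.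
  + by apply: cvg_at_left_filter; apply: cF; exact: lt_trans xy.
- move=> z; rewrite in_itv/= => /andP[/(lt_trans x0) z0 _].
  rewrite derive1E deriveM; [|exact: derivable_cst|by apply: derivable_powR; rewrite in_itv/= andbT].
  rewrite derive_cst scaler0 addr0 -derive1E powR_derive1 ?in_itv/= ?andbT//.
  by rewrite addrK /GRing.scale /= mulrA mulVf// mul1r.
Qed.

Lemma integral_powR01_lty (c : R) : (-1 < c)%R ->
  \int[leb]_(t in `[0%R, 1%R]) (t `^ c)%:E < +oo.
Proof.
move=> c1; have c10 : (0 < c + 1)%R by rewrite -ltrBlDr sub0r.
rewrite -integral_itv_obnd_cbnd; last first.
  by apply/measurable_EFinP/measurable_funTS; exact: measurable_powR.
(* Starting at 1/2 keeps every interval nondegenerate, as [integral_powR_itv] requires; the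
   integrals stay below 1/(c+1). *)
pose F (n : nat) := `[(n.+2%:R^-1 : R)%R, 1%R]%classic.
have UF : `]0%R, 1%R]%classic = \bigcup_n F n.
  apply/seteqP; split=> [t /=|t [n _]]; rewrite /F /= !in_itv/=.
    move=> /andP[t0 t1]; exists (Num.truncn t^-1) => //=; rewrite in_itv/= t1 andbT.
    rewrite invf_ple ?posrE// (le_trans (ltW (truncnS_gt _)))// ler_nat//.
  by move=> /andP[nt ->]; rewrite andbT (lt_le_trans _ nt)// invr_gt0.
have ndF : nondecreasing_seq F.
  move=> m n mn; apply/subsetPset => t; rewrite /F /= !in_itv/= => /andP[mt ->].
  by rewrite andbT (le_trans _ mt)// lef_pV2 ?posrE// ler_nat.
have mc D : measurable_fun D (fun t : R => (t `^ c)%:E).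
  by apply/measurable_EFinP/measurable_funTS; exact: measurable_powR.
have cvgF := @ge0_nondecreasing_set_cvg_integral _ (measurableTypeR R) R F
  (fun t : R => (t `^ c)%:E) leb
  ndF (fun=> measurable_itv _) (fun=> mc _) (fun _ t _ => powR_ge0 t c).
rewrite UF -(cvg_lim _ cvgF)//.
apply: (@le_lt_trans _ _ (c + 1)^-1%:E); last exact: ltry.
apply: lime_le; first by apply/cvg_ex; eexists; exact: cvgF.
apply: nearW => n; rewrite integral_powR_itv ?gt_eqF ?invr_gt0//; last first.
  by rewrite invf_lt1 ?ltr0n// ltr1n.
rewrite lee_fin powR1 mulr1 gerBl// mulr_ge0 ?powR_ge0// invr_ge0 ltW//.
Qed.

Lemma integral_powR1y_lty (c : R) : (c < -1)%R ->
  \int[leb]_(t in `[1%R, +oo[) (t `^ c)%:E < +oo.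
Proof.
move=> c1; have c10 : (c + 1 < 0)%R by rewrite -ltrBrDr sub0r.
pose F (n : nat) := `[1%R, (n.+2%:R : R)%R]%classic.
have UF : `[1%R, +oo[%classic = \bigcup_n F n.
  apply/seteqP; split=> [t /=|t [n _]]; rewrite /F /= !in_itv/=.
    rewrite andbT => t1; exists (Num.truncn t) => //=; rewrite in_itv/= t1/=.
    by rewrite (le_trans (ltW (truncnS_gt _)))// ler_nat.
  by move=> /andP[-> _].
have ndF : nondecreasing_seq F.
  move=> m n mn; apply/subsetPset => t; rewrite /F /= !in_itv/= => /andP[-> mt].
  by rewrite (le_trans mt)// ler_nat.
have mc D : measurable_fun D (fun t : R => (t `^ c)%:E).
  by apply/measurable_EFinP/measurable_funTS; exact: measurable_powR.
have cvgF := @ge0_nondecreasing_set_cvg_integral _ (measurableTypeR R) R F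
  (fun t : R => (t `^ c)%:E) leb
  ndF (fun=> measurable_itv _) (fun=> mc _) (fun _ t _ => powR_ge0 t c).
rewrite UF -(cvg_lim _ cvgF)//.
apply: (@le_lt_trans _ _ (- (c + 1)^-1)%:E); last exact: ltry.
apply: lime_le; first by apply/cvg_ex; eexists; exact: cvgF.
apply: nearW => n; rewrite integral_powR_itv ?lt_eqF ?ltr1n//.
rewrite lee_fin powR1 mulr1 gerDr nmulr_rle0 ?powR_ge0//.
by rewrite invr_lt0.
Qed.

End power_integrals.

Section weights.
Context {R : realType}.
Local Notation leb := (@lebesgue_measure R).
Local Notation vol := (@lebesgue_cV R).

Definition weight (s t : R) : R := (1 + `|t|) `^ (- s).

Lemma weight_gt0 s t : 0 < weight s t.
Proof. by rewrite powR_gt0// ltr_pwDl. Qed.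

Lemma weight_ge0 s t : 0 <= weight s t.
Proof. exact/ltW/weight_gt0. Qed.

Lemma weight_anti s t u : 0 <= s -> `|t| <= `|u| -> weight s u <= weight s t.
Proof.
move=> s0 tu; rewrite /weight !powRN lef_pV2 ?posrE ?powR_gt0 ?ltr_pwDl//.
by apply: ge0_ler_powR; rewrite ?nnegrE ?addr_ge0// lerD2l.
Qed.

Lemma weight_le1 s t : 0 <= s -> weight s t <= 1.
Proof.
move=> s0; apply: (@le_trans _ _ (weight s 0)).
  by apply: weight_anti; rewrite // normr0.
by rewrite /weight normr0 addr0 powR1.
Qed.

Lemma measurable_weight s : measurable_fun setT (weight s).
Proof.
apply: (measurableT_comp (measurable_powR _)).
by apply: measurable_funD => //; exact: measurableT_comp.
Qed.

Lemma integrable_ge1_powR (a : R) : 1 < a ->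
  leb.-integrable setT (fun t => ((t `^ (- a)) * \1_(`[1, +oo[) t)%:E).
Proof.
move=> a1; apply/integrableP; split.
  apply/measurable_EFinP/measurable_funM; first exact: measurable_powR.
  exact: measurable_indic.
rewrite (eq_integral ((fun t : R => (t `^ (- a))%:E) \_ `[1, +oo[ : measurableTypeR R -> \bar R)).
  rewrite -integral_mkcond; by apply: integral_powR1y_lty; rewrite ltrN2.
move=> t _; rewrite patchE indicE; case: ifP => _; last by rewrite mulr0 abse0.
by rewrite mulr1 gee0_abs// lee_fin powR_ge0.
Qed.

Lemma integrable_weight (a : R) : 1 < a -> leb.-integrable setT (EFin \o weight a).
Proof.
move=> a1; have i0 := integrable_ge1_powR a1.
have ip := transports_integrable (transports_shift_line (1 : R)) i0.
have im := transports_integrable (@transports_opp_line R) ip.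
apply: le_integrable (integrableD measurableT ip im) => //.
  by apply/measurable_EFinP; exact: measurable_weight.
move=> t _ /=; rewrite lee_fin ger0_norm ?weight_ge0//.
rewrite (le_trans _ (ler_norm _))// /weight !indicE.
have [t0|t0] := leP 0 t.
  rewrite ger0_norm// mem_set/=; last by rewrite in_itv/= lerDr t0.
  by rewrite mulr1 (addrC 1) lerDl mulr_ge0// powR_ge0.
rewrite ltr0_norm// (addrC 1).
rewrite (_ : (- t + 1 \in `[1, +oo[%classic) = true); last first.
  by rewrite mem_set//= in_itv/= lerDr oppr_ge0 ltW.
by rewrite (mulr1 (_ `^ _)) lerDr mulr_ge0// powR_ge0.
Qed.

Lemma integrable_le1_powR (c : R) : -1 < c ->
  leb.-integrable setT (fun t => ((t `^ c) * \1_(`[0, 1]) t)%:E).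
Proof.
move=> c1; apply/integrableP; split.
  apply/measurable_EFinP/measurable_funM; first exact: measurable_powR.
  exact: measurable_indic.
rewrite (eq_integral ((fun t : R => (t `^ c)%:E) \_ `[0, 1] : measurableTypeR R -> \bar R)).
  rewrite -integral_mkcond; exact: integral_powR01_lty.
move=> t _; rewrite patchE indicE; case: ifP => _; last by rewrite mulr0 abse0.
by rewrite mulr1 gee0_abs// lee_fin powR_ge0.
Qed.

Lemma integrable_norm_powR (c : R) : -1 < c ->
  leb.-integrable setT (fun t => ((`|t| `^ c) * \1_(`]-1, 1[) t)%:E).
Proof.
move=> c1; have i0 := integrable_le1_powR c1.
have im := transports_integrable (@transports_opp_line R) i0.
apply: le_integrable (integrableD measurableT i0 im) => //.
  apply/measurable_EFinP/measurable_funM; last exact: measurable_indic.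
  exact: (measurableT_comp (measurable_powR _) (@normr_measurable R setT)).
move=> t _ /=; rewrite lee_fin ger0_norm ?mulr_ge0 ?powR_ge0//.
rewrite (le_trans _ (ler_norm _))// !indicE.
have [|_] := boolP (t \in `]-1, 1[%classic); last first.
  by rewrite mulr0 addr_ge0// mulr_ge0// powR_ge0.
rewrite inE/= in_itv/= mulr1 => /andP[t1 t2].
have [t0|t0] := leP 0 t.
  rewrite ger0_norm// mem_set/=; last by rewrite in_itv/= t0 ltW.
  by rewrite mulr1 lerDl mulr_ge0// powR_ge0.
rewrite ltr0_norm//.
rewrite (_ : (- t \in `[0, 1]%classic) = true); last first.
  by rewrite mem_set//= in_itv/= oppr_ge0 (ltW t0)/= lerNl ltW.
by rewrite (mulr1 (_ `^ _)) lerDr mulr_ge0// powR_ge0.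
Qed.

Lemma measurable_weight_norm n q :
  measurable_fun setT (fun x : 'cV[R]_n => weight q (euclid_norm x)).
Proof.
by apply: (measurableT_comp (measurable_weight _)); exact: measurable_euclid_norm.
Qed.

(** Each 1 + |x_i| is at most 1 + |x|, so the weight is at most the product over i of (1 +
    |x_i|)^(-a) with a = q/(n+1) > 1, and this product is integrated one coordinate at a time. *)
Lemma integrable_weight_cV n (q : R) : n.+1%:R < q ->
  (vol n.+1).-integrable setT (fun x => (weight q (euclid_norm x))%:E).
Proof.
move=> nq; pose a := q / n.+1%:R.
have a1 : 1 < a by rewrite /a ltr_pdivlMr// mul1r.
have [iP _] := @integral_prod_cV R n.+1 (fun=> weight a) (fun=> integrable_weight a1).
apply: le_integrable iP => //.
  by apply/measurable_EFinP; exact: measurable_weight_norm.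
move=> x _ /=; rewrite lee_fin !ger0_norm ?weight_ge0//; last first.
  by apply: prodr_ge0 => i _; exact: weight_ge0.
apply: (@le_trans _ _ (\prod_(i < n.+1) weight a (euclid_norm x))).
  rewrite prodr_const card_ord /weight -powR_mulrn ?powR_ge0// -powRrM.
  by rewrite mulNr /a divfK.
apply: ler_prod => i _; rewrite weight_ge0/= weight_anti//.
  by rewrite ltW// (lt_trans _ a1).
by rewrite (le_trans (entry_le_norm _ _))// ler_norm.
Qed.

End weights.

Section weighted_integrability.
Context {R : realType}.
Local Notation leb := (@lebesgue_measure R).
Local Notation vol := (@lebesgue_cV R).

(* Young: |f| w <= |f|^p / p + w^q / q, and w^q is integrable as s q > n.+1. *)
Lemma Lfun_weight n (p s : R) (f : 'cV[R]_n.+1 -> R) :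
  1 <= p -> 0 <= s -> n.+1%:R * (p - 1) < s * p ->
  f \in Lfun (vol n.+1) p%:E ->
  (vol n.+1).-integrable setT (fun x => (f x * weight s (euclid_norm x))%:E).
Proof.
move=> p1 s0 nsp fp.
have mf : measurable_fun setT f by move: fp; rewrite inE => /andP[/[!inE]].
have mfw : measurable_fun setT (fun x => (f x * weight s (euclid_norm x))%:E).
  by apply/measurable_EFinP/measurable_funM => //; exact: measurable_weight_norm.
(* There is no finite conjugate exponent for p = 1; in that case the bound 1 on the weight is
   enough. *)
have [p1'|p1'] := eqVneq p 1.
  rewrite p1' in fp; have /Lfun1_integrable fi := fp.
  apply: le_integrable fi => // x _; rewrite lee_fin normrM ler_piMr//.
  by rewrite ger0_norm ?weight_ge0// weight_le1.
have {p1'}p1 : 1 < p by rewrite lt_def p1' p1.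
have p0 : 0 < p by rewrite (lt_trans _ p1).
have p10 : 0 < p - 1 by rewrite subr_gt0.
pose q := p / (p - 1).
have q0 : 0 < q by rewrite divr_gt0.
have pq : p^-1 + q^-1 = 1.
  by rewrite /q invf_div -{1}[p^-1]mul1r -mulrDl addrC subrK divff// gt_eqF.
have i1 : (vol n.+1).-integrable setT (fun x => (weight (s * q) (euclid_norm x))%:E).
  by apply: integrable_weight_cV; rewrite /q mulrA ltr_pdivlMr.
have i2 := Lfun_integrable (ltW p1) fp.
have i3 := integrableD measurableT (integrableZl measurableT p^-1 i2)
  (integrableZl measurableT q^-1 i1).
apply: le_integrable i3 => // x _; rewrite /= lee_fin.
rewrite normrM (ger0_norm (weight_ge0 _ _)) (le_trans _ (ler_norm _))//.
rewrite (le_trans (conjugate_powR _ _ p0 q0 pq)) ?weight_ge0//.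
rewrite ![_^-1 * _]mulrC lerD2l /weight -powRrM mulNr.
by rewrite mulrC.
Qed.

(** The first column of [O] is the direction of x and the others are a frame of its orthogonal
    complement; for x = 0 the identity serves. *)
Lemma exists_rotation n (x : 'cV[R]_n.+1) : exists O : 'M[R]_n.+1,
  O^T *m O = 1%:M /\ forall u, dot (O *m u) x = euclid_norm x * u ord0 ord0.
Proof.
have [x0|x0] := eqVneq (euclid_norm x) 0.
  exists 1%:M; split; first by rewrite trmx1 mulmx1.
  move=> u; rewrite x0 mul0r; apply/eqP.
  rewrite -normr_le0 (le_trans (dot_le_norm _ _))//.
  by rewrite x0 mulr0.
pose v := direction x.
have vv : v^T *m v = 1%:M.
  rewrite [LHS]mx11_scalar; congr (_%:M); rewrite -/(dot v v).
  by rewrite /v /direction dotZl dotZr mulrA -sqr_euclid_norm expr2 mulrACA mulVf// mul1r.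
have [qq vq] := stiefel_frame (m := 1) vv.
set q := perp_frame v in qq vq.
have n1 : (n.+1 - 1 = n)%N by rewrite subn1.
move: q qq vq; rewrite n1 => q qq vq.
pose O : 'M[R]_n.+1 := @row_mx _ n.+1 1 n v q.
exists O; split.
  rewrite /O (@tr_row_mx _ n.+1 1 n); apply: (etrans (mul_col_row v^T q^T v q)).
  rewrite vv qq vq (_ : (q^T *m v = 0)%R) -?(scalar_mx_block 1 n 1)//.
  by rewrite -[LHS]trmxK trmx_mul trmxK vq trmx0.
move=> u; rewrite dotC /dot mulmxA /O.
have -> : x = euclid_norm x *: v by rewrite /v /direction scalerA divff// scale1r.
rewrite -[u in LHS]cons_cV_eta /cons_cV /=.
rewrite -mulmxA (@mul_row_col _ n.+1 1 n 1) linearZ/= -scalemxAl mulmxDr !mulmxA vv vq.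
rewrite mul1mx mul0mx addr0 !mxE eqxx mulr1n.
congr (_ * _).
have : dot v v = 1 by rewrite /dot vv mxE eqxx.
rewrite euclid_normZ ger0_norm ?euclid_norm_ge0// (euclid_normE v) => ->.
by rewrite sqrtr1 mulr1.
Qed.

(** For |t| < 1 one has (1 + a)|t| <= 1 + a|t|, hence (1 + a|t|)^(-s) <= |t|^(-s) (1 + a)^(-s) when
    t is nonzero. The condition s < 1 makes |t|^(-s) integrable at 0. *)
Lemma integral_weight_itv (s a : R) : 0 < s < 1 -> 0 <= a ->
  \int[leb]_t (weight s (a * t) * \1_(`]-1, 1[) t) <=
  weight s a * \int[leb]_t (`|t| `^ (- s) * \1_(`]-1, 1[) t).
Proof.
move=> /andP[s0 s1] a0.
have i1 : leb.-integrable setT (fun t => (`|t| `^ (- s) * \1_(`]-1, 1[) t)%:E).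
  by apply: integrable_norm_powR; rewrite ltrN2.
have mw : measurable_fun setT (fun t : R => weight s (a * t)).
  by apply: (measurableT_comp (measurable_weight s)); exact: measurable_funM.
have i2 : leb.-integrable setT (fun t => (weight s (a * t) * \1_(`]-1, 1[) t)%:E).
  apply: le_integrable (integrable_indic_itv (-1) 1 false true) => //.
    by apply/measurable_EFinP/measurable_funM => //; exact: measurable_indic.
  move=> t _ /=; rewrite lee_fin normrM ler_piMl// ger0_norm ?weight_ge0//.
  by apply: weight_le1; exact: ltW.
rewrite -RintegralZl//; rewrite -lee_fin /Rintegral !fineK; last 2 first.
- exact: (integrable_fin_num measurableT (integrableZl measurableT (weight s a) i1)).
- exact: integrable_fin_num.
apply: ae_ge0_le_integral => //.
- by move=> t _; rewrite lee_fin mulr_ge0// weight_ge0.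
- exact: measurable_int i2.
- by move=> t _; rewrite lee_fin mulr_ge0 ?weight_ge0// mulr_ge0// powR_ge0.
- exact: measurable_int (integrableZl measurableT (weight s a) i1).
(* The pointwise bound fails at t = 0, since a nonzero power of 0 has the value 0 under [powR]. *)
exists [set 0]; split => //; first exact: lebesgue_measure_set1.
move=> t /= /not_implyP[_]; apply: contra_notP => t0.
rewrite lee_fin indicE.
have [|_] := boolP (t \in `]-1, 1[%classic); last by rewrite !mulr0.
rewrite inE/= in_itv/= -ltr_norml => t1; rewrite !mulr1.
have t0' : 0 < `|t| by rewrite normr_gt0; exact/eqP.
rewrite /weight -powRM// !powRN lef_pV2 ?posrE ?powR_gt0 ?ltr_pwDl//; last first.
  by rewrite mulr_gt0// ltr_pwDl.
apply: ge0_ler_powR; rewrite ?nnegrE ?mulr_ge0 ?addr_ge0// ?(ltW s0)//.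
by rewrite mulrDl mul1r normrM lerD// ltW.
Qed.

End weighted_integrability.

Section weight_average.
Context {R : realType}.
Local Notation leb := (@lebesgue_measure R).
Local Notation vol := (@lebesgue_cV R).

Lemma measurable_dot n d (T : measurableType d) (f g : T -> 'cV[R]_n) :
  measurable_fun setT f -> measurable_fun setT g ->
  measurable_fun setT (fun x => dot (f x) (g x)).
Proof.
move=> mf mg; apply: measurable_entrymx; apply: measurable_mulmx => //.
exact: measurable_trmx.
Qed.

(** A rotation makes [dot w x] depend on the first coordinate of [w] only, and enlarging the ball to
    the cube turns the integral into a product: one weighted factor and [n] factors equal to 2. *)
Lemma weight_average n (s : R) : 0 < s < 1 -> exists2 C : R, 0 <= C &
  forall x : 'cV[R]_n.+1, (\int[vol n.+1]_w
    (\1_(unit_ball n.+1) w * weight s (dot w x))%:E <=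
    (C * weight s (euclid_norm x))%:E)%E.
Proof.
move=> /[dup] s01 /andP[s0 s1].
pose K := \int[leb]_t (`|t| `^ (- s) * \1_(`]-1, 1[) t).
have K0 : 0 <= K by apply: Rintegral_ge0 => t _; rewrite mulr_ge0// powR_ge0.
exists (K * 2 ^+ n) => [|x]; first by rewrite mulr_ge0// exprn_ge0.
have [B [OO Ox]] := exists_rotation x.
have mF : measurable_fun setT (fun w : 'cV[R]_n.+1 =>
    (\1_(unit_ball n.+1) w * weight s (dot w x))%:E).
  apply/measurable_EFinP/measurable_funM.
    by apply: measurable_indic; exact: measurable_unit_ball.
  apply: (measurableT_comp (measurable_weight s)); apply: measurable_dot.
    exact: measurable_id.
  exact: measurable_cst.
have [mO _ TO] := transports_orthogonal OO.
have := TO _ mF (fun w => _); rewrite mul1e => <-; last first.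
  by move=> w; rewrite lee_fin mulr_ge0 ?weight_ge0.
pose g (i : 'I_n.+1) (t : R) :=
  if i == ord0 then weight s (euclid_norm x * t) * \1_(`]-1, 1[) t
  else \1_(`]-1, 1[) t.
have ig i : leb.-integrable setT (EFin \o g i).
  rewrite /g; case: (i == ord0); last exact: integrable_indic_itv.
  apply: le_integrable (integrable_indic_itv (-1) 1 false true) => //.
    apply/measurable_EFinP/measurable_funM; last exact: measurable_indic.
    by apply: (measurableT_comp (measurable_weight s)); exact: measurable_funM.
  move=> t _ /=; rewrite lee_fin normrM ler_piMl// ger0_norm ?weight_ge0//.
  by apply: weight_le1; exact: ltW.
have [iP EP] := integral_prod_cV ig.
apply: (@le_trans _ _ (\int[vol n.+1]_u (\prod_(i < n.+1) g i (u i ord0))%:E)%E).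
  apply: ge0_le_integral => //.
  - by move=> w _; rewrite lee_fin mulr_ge0 ?weight_ge0.
  - exact: (measurableT_comp mF mO).
  - exact: measurable_int iP.
  move=> u _; rewrite lee_fin Ox.
  apply: (@le_trans _ _ (weight s (euclid_norm x * u ord0 ord0) * \1_(cube n.+1 1) u)).
    rewrite mulrC ler_wpM2l ?weight_ge0// !indicE ler_nat.
    have [uO|] := boolP (B *m u \in _) => //.
    rewrite mem_set//; apply: unit_ball_cube; move: uO; rewrite inE /unit_ball /=.
    by rewrite euclid_norm_orthogonal.
  rewrite cubeE !big_ord_recl /g eqxx mulrA ler_wpM2l//.
  by rewrite mulr_ge0 ?weight_ge0.
rewrite EP lee_fin big_ord_recl {1}/g eqxx.
rewrite (eq_bigr (fun=> 2)) => [|i _]; last first.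
  rewrite /g (_ : (lift ord0 i == ord0) = false); last exact/negbTE.
  by rewrite integral_itv_indic ?opprK//; lra.
rewrite prodr_const card_ord mulrAC ler_wpM2r ?exprn_ge0//.
by rewrite mulrC integral_weight_itv ?euclid_norm_ge0.
Qed.

(** Integrating over [w] first, the averaged weight is absorbed by the hypothesis on [f].
    Consequently [f] is integrable against [weight s (dot w x)] for almost every [w] in the ball,
    and this same function later dominates the pairing of [f] with the probes. *)
Lemma weighted_integrable_prod n (s : R) (f : 'cV[R]_n.+1 -> R) : 0 < s < 1 ->
  measurable_fun setT f ->
  (vol n.+1).-integrable setT (fun x => (f x * weight s (euclid_norm x))%:E) ->
  (vol n.+1 \x vol n.+1)%E.-integrable setT
    (fun z => (\1_(unit_ball n.+1) z.1 * (f z.2 * weight s (dot z.1 z.2)))%:E).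
Proof.
move=> s01 mf fi; have [C C0 HC] := weight_average n s01.
have mH : measurable_fun setT (fun z : 'cV[R]_n.+1 * 'cV[R]_n.+1 =>
    (\1_(unit_ball n.+1) z.1 * (f z.2 * weight s (dot z.1 z.2)))%:E).
  apply/measurable_EFinP/measurable_funM.
    have mI : measurable_fun setT (\1_(unit_ball n.+1) : 'cV[R]_n.+1 -> R).
      by apply: measurable_indic; exact: measurable_unit_ball.
    exact: (measurableT_comp mI measurable_fst).
  apply: measurable_funM; first exact: (measurableT_comp mf measurable_snd).
  apply: (measurableT_comp (measurable_weight s)); apply: measurable_dot.
    exact: measurable_fst.
  exact: measurable_snd.
apply/(integrable21ltyP _ _ mH) => /=.
have iC := integrableZl measurableT C fi.
have /integrableP[_] := iC; apply: le_lt_trans.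
apply: ge0_le_integral => //.
- by move=> x _; exact: integral_ge0.
- exact: (measurable_fun_fubini_tonelli_G _ (measurable_abse_comp mH)).
- exact: measurable_abse_comp (measurable_int _ iC).
move=> x _.
rewrite (eq_integral (fun w => `|f x|%:E *
    (\1_(unit_ball n.+1) w * weight s (dot w x))%:E)%E); last first.
  move=> w _; rewrite -EFinM !normrM (ger0_norm (weight_ge0 _ _)).
  by rewrite ger0_norm// mulrCA.
rewrite ge0_integralZl//; last 2 first.
- apply/measurable_EFinP/measurable_funM.
    by apply: measurable_indic; exact: measurable_unit_ball.
  apply: (measurableT_comp (measurable_weight s)); apply: measurable_dot.
    exact: measurable_id.
  exact: measurable_cst.
- by move=> w _; rewrite lee_fin mulr_ge0 ?weight_ge0.
rewrite /= !normrM (ger0_norm (weight_ge0 _ _)) (ger0_norm C0) mulrCA EFinM.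
by rewrite lee_wpmul2l// HC.
Qed.

End weight_average.

(** * Cosine transforms of functions of bounded variation *)

Section parametric_measurability.
Context {R : realType} d1 d2 (T1 : measurableType d1) (T2 : measurableType d2).
Variables (nu : {sigma_finite_measure set T2 -> \bar R}).
Local Open Scope ereal_scope.

(** Positive and negative parts go through Tonelli separately. This form suits hyperplane integrals
    of [f], which have no sign and may diverge on some hyperplanes. *)
Lemma measurable_integral_param (H : T1 * T2 -> \bar R) :
  measurable_fun setT H -> measurable_fun setT (fun x => \int[nu]_y H (x, y)).
Proof.
move=> mH.
have -> : (fun x => \int[nu]_y H (x, y)) =
    (fun x => \int[nu]_y H^\+ (x, y)) \- (fun x => \int[nu]_y H^\- (x, y)).
  apply/funext => x; rewrite integralE; congr (_ - _); apply: eq_integral => y _.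
    by rewrite -[LHS]/((H \o pair x)^\+ y) funepos_comp.
  by rewrite -[LHS]/((H \o pair x)^\- y) funeneg_comp.
by apply: emeasurable_funB; apply: measurable_fun_fubini_tonelli_F => //;
  [exact: measurable_funepos|exact: measurable_funeneg].
Qed.

Lemma measurable_Rintegral_param (H : T1 * T2 -> R) :
  measurable_fun setT H ->
  measurable_fun setT (fun x => (\int[nu]_y H (x, y))%R).
Proof.
move=> mH; apply: (measurableT_comp (@fine_measurable R setT measurableT)).
by apply: (@measurable_integral_param (EFin \o H)); exact/measurable_EFinP.
Qed.

End parametric_measurability.

(** * Zeros of a function whose derivatives grow at most geometrically *)

Section analytic_zeros.
Context {R : realType}.
Variables (m : nat -> R -> R) (W A : R).
Hypothesis dm : forall i (x : R), is_derive x 1 (m i) (m i.+1 x).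
Hypothesis mb : forall i x, `|m i x| <= W * A ^+ i.
Hypothesis A0 : 0 < A.

Lemma jet_continuous i : continuous (m i).
Proof.
by move=> x; apply: differentiable_continuous; apply/derivable1_diffP; have [] := dm i x.
Qed.

Lemma jet_rolle i a b : a < b -> m i a = 0 -> m i b = 0 ->
  exists2 c, a < c < b & m i.+1 c = 0.
Proof.
move=> ab ma mb0.
have [|||c cab dc] := @Rolle R (m i) a b ab.
- by move=> x _; have [] := dm i x.
- by apply: continuous_subspaceT; exact: jet_continuous.
- by rewrite ma mb0.
by exists c; [move: cab; rewrite in_itv|have [_ <-] := dm i c; have [_ ->] := dc].
Qed.

Lemma jet_limit_point i c :
  limit_point [set r | m i r = 0] c -> m i c = 0.
Proof.
move=> lc; apply/eqP/negPn/negP => mc.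
have : \forall x \near c, m i x != 0.
  have /cvgr_neq0 := @jet_continuous i c; exact.
by move=> /lc [y [_ /= my]]; rewrite my eqxx.
Qed.

(** By continuity c is itself a zero, so Rolle's theorem puts a zero of the next derivative strictly
    between c and each zero near it. *)
Lemma jet_limit_pointS i c :
  limit_point [set r | m i r = 0] c -> limit_point [set r | m i.+1 r = 0] c.
Proof.
move=> lc; have mc := jet_limit_point lc; move=> U /nbhs_ballP[e /= e0 eU].
have [y [yc /= my yU]] := lc _ (nbhsx_ballx c _ e0).
move: yc; rewrite neq_lt => /orP[yc|cy].
  have [z /andP[yz zc] mz] := jet_rolle yc my mc.
  exists z; split => //=; first by rewrite lt_eqF.
  apply: eU; move: yU; rewrite /ball /= !gtr0_norm ?subr_gt0//.
  by apply: le_lt_trans; rewrite lerD2l lerN2 ltW.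
have [z /andP[cz zy] mz] := jet_rolle cy mc my.
exists z; split => //=; first by rewrite gt_eqF.
apply: eU; move: yU; rewrite /ball /= !ltr0_norm ?subr_lt0// !opprB.
by apply: le_lt_trans; rewrite lerD2r ltW.
Qed.

(* The bounds W A^i carry no factorial, so iterating the mean value theorem K
   times away from a common zero c of all m i gains a factor (d A)^K. *)
Lemma jet_bound c d : (forall i, m i c = 0) -> 0 <= d ->
  forall K i z, `|z - c| <= d -> `|m i z| <= W * A ^+ i * (d * A) ^+ K.
Proof.
move=> mc d0; elim=> [i z _|K IH i z zc]; first by rewrite mulr1 mb.
have W0 : 0 <= W * A ^+ i * (d * A) ^+ K.+1.
  by rewrite mulr_ge0 ?exprn_ge0 ?(le_trans _ (mb i 0))// mulr_ge0// ltW.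
have key x y : x < y -> `|x - c| <= d -> `|y - c| <= d -> y - x <= d ->
    `|m i y - m i x| <= W * A ^+ i * (d * A) ^+ K.+1.
  move=> xy xc yc yxd.
  have [u uxy ->] := MVT xy (fun u _ => dm i u)
    (continuous_subspaceT (@jet_continuous i)).
  have uc : `|u - c| <= d.
    move: uxy; rewrite in_itv/= => /andP[xu uy].
    move: xc yc; rewrite !ler_norml => /andP[? ?] /andP[? ?]; lra.
  rewrite normrM (gtr0_norm (_ : 0 < y - x)) ?subr_gt0//.
  apply: le_trans (ler_pM _ _ (IH i.+1 u uc) yxd) _ => //.
    by rewrite subr_ge0 ltW.
  by rewrite !exprS le_eqVlt; apply/orP; left; apply/eqP; ring.
have [zc'|zc'|->] := ltgtP z c; last by rewrite mc normr0.
  have := key z c zc'; rewrite mc sub0r normrN; apply => //.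
    by rewrite subrr normr0.
  by move: zc; rewrite ltr0_norm ?subr_lt0// opprB.
have := key c z zc'; rewrite mc subr0; apply => //.
  by rewrite subrr normr0.
by move: zc; rewrite gtr0_norm ?subr_gt0.
Qed.

(** At distance at most 1/(2A) the bound of [jet_bound] is a fixed multiple of 2^(-K), for every K.
    The radius does not depend on c, which lets [jet_global] reach any point in finitely many
    steps. *)
Lemma jet_local c : (forall i, m i c = 0) ->
  forall z, `|z - c| <= (A *+ 2)^-1 -> forall i, m i z = 0.
Proof.
move=> mc z zc i; apply/eqP; rewrite -normr_le0.
have d0 : 0 <= (A *+ 2)^-1 by rewrite invr_ge0 mulrn_wge0// ltW.
have b K := jet_bound mc d0 K i zc.
have dA : (A *+ 2)^-1 * A = 2^-1.
  by field; rewrite gt_eqF.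
have lim : W * A ^+ i * (2^-1 : R) ^+ K @[K --> \oo] --> W * A ^+ i * 0.
  by apply: cvgMr; apply: cvg_expr; rewrite ger0_norm// invf_lt1// ltr1n.
rewrite mulr0 in lim; rewrite -(cvg_lim _ lim)//.
apply: limr_ge; first by apply/cvg_ex; eexists; exact: lim.
by apply: nearW => K; rewrite -dA; exact: b.
Qed.

Lemma jet_global c : (forall i, m i c = 0) -> forall z i, m i z = 0.
Proof.
move=> mc z; set d := (A *+ 2)^-1.
have d0 : 0 < d by rewrite invr_gt0 mulrn_wgt0.
pose N := (Num.truncn (`|z - c| / d)).+1.
have Nd : `|(z - c) / N%:R| <= d.
  rewrite normrM normfV normr_nat ler_pdivrMr ?ltr0n// mulrC -ler_pdivrMr//.
  by rewrite ltW// truncnS_gt.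
suff H k : (k <= N)%N -> forall i, m i (c + k%:R * ((z - c) / N%:R)) = 0.
  move=> i; have := H N (leqnn _) i.
  by rewrite mulrC divfK ?pnatr_eq0// addrC subrK.
elim: k => [_|k IH kN]; first by rewrite mul0r addr0.
apply: jet_local (IH (ltnW kN)) _ _.
by rewrite opprD addrACA subrr add0r -mulrBl -natrB// subSnn mul1r.
Qed.

(** Infinitely many bounded zeros would accumulate somewhere, by Bolzano-Weierstrass; all
    derivatives vanish at such a point, and then [m 0] vanishes everywhere. *)
Lemma jet_finite_zeros B x0 : m 0 x0 != 0 ->
  finite_set [set r | `|r| <= B /\ m 0 r = 0].
Proof.
move=> mx0; apply: contrapT => /infinite_bounded_limit_point_nonempty.
case=> [|c lc].
  by exists B; split; [exact: num_real|move=> M BM r /= [rB _]; rewrite (le_trans rB)// ltW].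
have H i : limit_point [set r | m i r = 0] c.
  elim: i => [U /lc [y [yc /= [_ my] yU]]|i]; first by exists y; split.
  exact: jet_limit_pointS.
have := @jet_global c (fun i => jet_limit_point (H i)) x0 0.
by move/eqP; rewrite (negbTE mx0).
Qed.

End analytic_zeros.

Section cosine_transform.
Context {R : realType}.
Local Notation leb := (@lebesgue_measure R).

(* V plays the role of the total variation of F. *)
Definition L1_variation (F : R -> R) (S B V : R) :=
  [/\ measurable_fun setT F, forall r, `|F r| <= S,
    forall r, B < `|r| -> F r = 0 &
    forall d, 0 < d <= 1 ->
      (\int[leb]_r (`|F (r + d) - F r|)%:E <= (V * d)%:E)%E].

Definition cos_transform (F : R -> R) (t : R) : R :=
  \int[leb]_r (F r * cos (r * t)).

Lemma lebesgue_itvcc (B : R) : 0 <= B -> leb `[- B, B] = (B *+ 2)%:E.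
Proof.
move=> B0; rewrite lebesgue_measure_itv/= lte_fin; case: ltP => [_|B0'].
  by rewrite -EFinB opprK mulr2n.
have -> : B = 0 by lra.
by rewrite mul0rn.
Qed.

Lemma integral_indic_itvcc (B c : R) : 0 <= B -> 0 <= c ->
  (\int[leb]_r (c * \1_(`[- B, B]) r)%:E = (c * (B *+ 2))%:E)%E.
Proof.
move=> B0 c0; under eq_integral do rewrite EFinM.
rewrite ge0_integralZl//; last first.
  by apply/measurable_EFinP; exact: measurable_indic.
by rewrite integral_indic//= setIT lebesgue_itvcc.
Qed.

Lemma integrable_indic_itvcc (B c : R) :
  leb.-integrable setT (fun r => (c * \1_(`[- B, B]) r)%:E).
Proof. exact: (integrableZl measurableT c (integrable_indic_itv (- B) B true false)). Qed.

Lemma measurable_shift (F : R -> R) (d : R) :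
  measurable_fun setT F -> measurable_fun setT (fun r : R => F (r + d)).
Proof. by move=> mF; apply: (measurableT_comp mF); exact: measurable_funD. Qed.

Lemma measurable_cos_mul t : measurable_fun setT (fun r : R => cos (r * t)).
Proof.
apply: (measurableT_comp (continuous_measurable_fun (@continuous_cos R))).
exact: measurable_funM.
Qed.

Section transform.
Variables (F : R -> R) (S B V : R).
Hypothesis B0 : 0 <= B.
Hypothesis bF : L1_variation F S B V.

Lemma bv_sup_ge0 : 0 <= S.
Proof. by have [_ h _ _] := bF; exact: le_trans (h 0). Qed.

Lemma bv_le_indic r : `|F r| <= S * \1_(`[- B, B]) r.
Proof.
have [_ FS F0 _] := bF; have [rB|rB] := leP `|r| B.
  by rewrite indicE mem_set ?mulr1//= in_itv/= -ler_norml.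
by rewrite F0// normr0 mulr_ge0// bv_sup_ge0.
Qed.

Lemma bv_integrable : leb.-integrable setT (EFin \o F).
Proof.
have [mF _ _ _] := bF.
apply: le_integrable (integrable_indic_itvcc B S) => //.
  exact/measurable_EFinP.
by move=> r _; rewrite lee_fin (le_trans (bv_le_indic r))// ler_norm.
Qed.

Lemma bv_integrable_cos t : leb.-integrable setT (fun r => (F r * cos (r * t))%:E).
Proof.
have [mF _ _ _] := bF.
apply: le_integrable bv_integrable => //.
  by apply/measurable_EFinP/measurable_funM => //; exact: measurable_cos_mul.
by move=> r _; rewrite lee_fin normrM ler_piMr// cos_max.
Qed.

Lemma cos_transform_sup t : `|cos_transform F t| <= S * (B *+ 2).
Proof.
have iF := bv_integrable_cos t.
apply: le_trans (le_normr_Rintegral measurableT iF) _.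
rewrite -lee_fin -integral_indic_itvcc ?bv_sup_ge0//.
have iN := integrable_norm iF.
rewrite /Rintegral fineK ?(integrable_fin_num measurableT iN)//.
apply: ge0_le_integral => //; first exact: measurable_int iN.
- exact: measurable_int (integrable_indic_itvcc B S).
move=> r _; rewrite lee_fin normrM (le_trans _ (bv_le_indic r))//.
by rewrite ler_piMr// cos_max.
Qed.

Lemma cos_transformN t : cos_transform F (- t) = cos_transform F t.
Proof. by apply: eq_Rintegral => r _; rewrite mulrN cosN. Qed.

(* Translating r by d = pi / t changes the sign of cos (r t), so the transform
   is half the transform of F - F(. + d). *)
Lemma cos_transform_shift t : 0 < t -> pi / t <= 1 ->
  `|cos_transform F t| *+ 2 <= V * (pi / t).
Proof.
move=> t0 t1; have [mF FS F0 FV] := bF; set d := pi / t in t1 *.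
have d0 : 0 < d by rewrite divr_gt0 ?pi_gt0.
have iF := bv_integrable_cos t.
have E : cos_transform F t = - \int[leb]_r (F (r + d) * cos (r * t)).
  have iS := transports_integrable (transports_shift_line d) iF.
  have := transports_integral (transports_shift_line d) iF; rewrite mul1e => E.
  rewrite /cos_transform {1}/Rintegral -E -mulN1r -RintegralZl//.
    congr fine; apply: eq_integral => r _; congr EFin => /=.
    by rewrite mulrDl /d divfK ?gt_eqF// cosDpi mulrN mulN1r.
  apply: eq_integrable (integrableZl measurableT (-1) iS) => // r _ /=.
  rewrite -EFinM; congr EFin.
  by rewrite mulrDl /d divfK ?gt_eqF// cosDpi !mulrN mulN1r opprK.
have iS : leb.-integrable setT (fun r => (F (r + d) * cos (r * t))%:E).
  have := transports_integrable (transports_shift_line d) iF.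
  move=> /(integrableZl measurableT (-1)).
  apply: eq_integrable => // r _ /=; rewrite -EFinM; congr EFin.
  by rewrite mulrDl /d divfK ?gt_eqF// cosDpi !mulrN mulN1r opprK.
have E2 : cos_transform F t *+ 2 =
    \int[leb]_r (F r * cos (r * t) - F (r + d) * cos (r * t)).
  by rewrite RintegralB// mulr2n {2}E.
rewrite -normrMn E2.
have iB : leb.-integrable setT (EFin \o (fun r =>
    F r * cos (r * t) - F (r + d) * cos (r * t))).
  exact: (integrableB measurableT iF iS).
apply: le_trans (le_normr_Rintegral measurableT iB) _.
have iN := integrable_norm iB.
have d01 : 0 < d <= 1 by rewrite d0 t1.
rewrite -lee_fin (le_trans _ (FV d d01))//.
rewrite /Rintegral fineK ?(integrable_fin_num measurableT iN)//.
apply: ge0_le_integral => //; first exact: measurable_int iN.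
  apply/measurable_EFinP; apply: (measurableT_comp (@normr_measurable R setT)).
  by apply: measurable_funB => //; exact: measurable_shift.
move=> r _; rewrite lee_fin -mulrBl normrM distrC ler_piMr//.
exact: cos_max.
Qed.

(** For |t| <= 4 the bound 2BS is multiplied by 1 + |t| <= 5. For |t| > 4 >= pi the half-period
    pi/|t| is at most 1, as [L1_variation] requires, so 2|t| times the transform is at most pi V <=
    4V, and 1 + |t| <= 2|t|. *)
Lemma cos_transform_decay t :
  `|cos_transform F t| <= (10 * B * S + 4 * V) * weight 1 t.
Proof.
wlog t0 : t / 0 <= t => [H|].
  have [/H//|t0] := leP 0 t.
  have := H (- t); rewrite oppr_ge0 ltW// => /(_ isT).
  by rewrite cos_transformN /weight normrN.
have S0 := bv_sup_ge0.
have V0 : 0 <= V.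
  have [_ _ _ /(_ 1)] := bF; rewrite ltr01 lexx => /(_ isT).
  by rewrite mulr1 -lee_fin; apply: le_trans; exact: integral_ge0.
rewrite /weight (ger0_norm t0) powR_inv1 ?addr_ge0// ler_pdivlMr; last lra.
have pi4 : pi <= 4 :> R by have := @pihalf_lt2 R; lra.
have [t4|t4] := leP t 4.
  have h := cos_transform_sup t.
  have BS : 0 <= S * B by rewrite mulr_ge0.
  have : `|cos_transform F t| * (1 + t) <= S * (B *+ 2) * 5.
    by apply: ler_pM => //; lra.
  by rewrite mulr2n; nra.
have t0' : 0 < t by lra.
have := @cos_transform_shift t t0'.
rewrite ler_pdivrMr// mul1r => /(_ (le_trans pi4 (ltW t4))).
rewrite mulrA ler_pdivlMr// mulr2n => h.
have Vpi : V * pi <= V * 4 by rewrite ler_wpM2l.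
have c0 := normr_ge0 (cos_transform F t).
have BS : 0 <= B * S by rewrite mulr_ge0.
by nra.
Qed.

End transform.

End cosine_transform.

Section variation.
Context {R : realType}.
Local Notation leb := (@lebesgue_measure R).

(** The increment over d is at most L d, and it vanishes for |r| > B + 1 because d <= 1. *)
Lemma bv_lipschitz (F : R -> R) (S B L : R) : 0 <= B -> 0 <= L ->
  measurable_fun setT F -> (forall r, `|F r| <= S) ->
  (forall r, B < `|r| -> F r = 0) ->
  (forall r u, `|F r - F u| <= L * `|r - u|) ->
  L1_variation F S B (L * (B + 1) *+ 2).
Proof.
move=> B0 L0 mF FS F0 FL; split => // d /andP[d0 d1].
rewrite (_ : L * (B + 1) *+ 2 * d = L * d * ((B + 1) *+ 2)); last first.
  by rewrite -!mulrnAr mulrAC.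
rewrite -integral_indic_itvcc ?addr_ge0//; last by rewrite mulr_ge0// ltW.
apply: ge0_le_integral => //.
- apply/measurable_EFinP; apply: (measurableT_comp (@normr_measurable R setT)).
  by apply: measurable_funB => //; exact: measurable_shift.
- exact: measurable_int (integrable_indic_itvcc _ _).
move=> r _; rewrite lee_fin; have [rB|rB] := leP `|r| (B + 1).
  rewrite indicE mem_set ?mulr1//=; last by rewrite in_itv/= -ler_norml.
  by rewrite (le_trans (FL _ _))// addrAC subrr add0r gtr0_norm.
rewrite !F0 ?subrr ?normr0; [|lra|].
  by rewrite !mulr_ge0// ltW.
move: rB; rewrite !lter_normr; lra.
Qed.

(** A jump rather than a smooth cut-off: its increments over d have integral at most 2d for every
    [e], so the variation bounds survive the limit e -> 0. *)
Definition off_interval (c e : R) (r : R) : R := 1 - \1_(`]c - e, c + e[) r.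

Lemma off_interval_le1 c e r : `|off_interval c e r| <= 1.
Proof.
by rewrite /off_interval indicE; case: (_ \in _); rewrite ?subrr ?subr0 ?normr0 ?normr1.
Qed.

Lemma measurable_off_interval c e : measurable_fun setT (off_interval c e).
Proof. by apply: measurable_funB => //; exact: measurable_indic. Qed.

Lemma off_interval_shift c e d r : 0 <= d ->
  `|off_interval c e (r + d) - off_interval c e r| <=
  \1_(`[c - e - d, c - e]) r + \1_(`[c + e - d, c + e]) r.
Proof.
move=> d0; rewrite /off_interval opprD opprK addrACA subrr add0r addrC.
rewrite !indicE !mem_setE !in_itv/=.
have [h1|h1] := ltP (c - e) r; have [h2|h2] := ltP r (c + e); rewrite /=;
 have [h3|h3] := ltP (c - e) (r + d); rewrite /=;
 have [h4|h4] := ltP (r + d) (c + e);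
 rewrite /= ?subrr ?normr0 ?addr_ge0// ?subr0 ?sub0r ?normrN ?normr1.
1-4: by rewrite (_ : (c + e - d <= r <= c + e) = true) ?lerDr//; apply/andP; split; lra.
all: by rewrite (_ : (c - e - d <= r) = true) ?lerDl//; lra.
Qed.

Lemma integral_off_interval c e d : 0 < d ->
  (\int[leb]_r (`|off_interval c e (r + d) - off_interval c e r|)%:E <=
   (d *+ 2)%:E)%E.
Proof.
move=> d0.
have mI (a b : R) : measurable_fun setT (fun r : R => (\1_(`[a, b]) r : R)%:E).
  by apply/measurable_EFinP; exact: measurable_indic.
apply: (@le_trans _ _ (\int[leb]_r
   ((\1_(`[c - e - d, c - e]) r)%:E + (\1_(`[c + e - d, c + e]) r)%:E))%E).
  apply: ge0_le_integral => //.
  - apply/measurable_EFinP; apply: (measurableT_comp (@normr_measurable R setT)).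
    apply: measurable_funB; last exact: measurable_off_interval.
    by apply: measurable_shift; exact: measurable_off_interval.
  - by apply: emeasurable_funD; exact: mI.
  by move=> r _; rewrite -EFinD lee_fin off_interval_shift// ltW.
rewrite ge0_integralD//; [|exact: mI|exact: mI].
rewrite !integral_indic//= !setIT !lebesgue_measure_itv/= !lte_fin.
rewrite !gtrBl d0 -!EFinD lee_fin mulr2n; lra.
Qed.

Lemma bv_off_interval (F : R -> R) (S B V c e : R) : 0 <= B ->
  L1_variation F S B V ->
  L1_variation (fun r => F r * off_interval c e r) S B (V + S *+ 2).
Proof.
move=> B0 bF; have S0 := bv_sup_ge0 bF; have [mF FS F0 FV] := bF.
have mo := measurable_off_interval c e.
split.
- exact: measurable_funM.
- by move=> r; rewrite normrM -[S]mulr1 ler_pM// off_interval_le1.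
- by move=> r rB; rewrite F0 ?mul0r.
move=> d /[dup] d01 /andP[d0 d1].
have mD : measurable_fun setT (fun r : R => `|F (r + d) - F r|%:E).
  apply/measurable_EFinP; apply: (measurableT_comp (@normr_measurable R setT)).
  by apply: measurable_funB => //; exact: measurable_shift.
have mDo : measurable_fun setT (fun r : R =>
    `|off_interval c e (r + d) - off_interval c e r|%:E).
  apply/measurable_EFinP; apply: (measurableT_comp (@normr_measurable R setT)).
  by apply: measurable_funB => //; exact: measurable_shift.
have mSDo : measurable_fun setT (fun r : R =>
    (S%:E * `|off_interval c e (r + d) - off_interval c e r|%:E)%E).
  exact: measurable_funeM.
apply: (@le_trans _ _ (\int[leb]_r (`|F (r + d) - F r|%:E +
    S%:E * `|off_interval c e (r + d) - off_interval c e r|%:E))%E).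
  apply: ge0_le_integral => //.
  - apply/measurable_EFinP; apply: (measurableT_comp (@normr_measurable R setT)).
    apply: measurable_funB; last exact: measurable_funM.
    by apply: measurable_funM; exact: measurable_shift.
  - exact: emeasurable_funD.
  move=> r _; rewrite -EFinM -EFinD lee_fin.
  rewrite (_ : _ - _ = (F (r + d) - F r) * off_interval c e (r + d) +
    F r * (off_interval c e (r + d) - off_interval c e r)); last by ring.
  rewrite (le_trans (ler_normD _ _))// lerD// normrM.
    by rewrite ler_piMr// off_interval_le1.
  by rewrite ler_wpM2r.
rewrite ge0_integralD//; last by move=> r _; rewrite mule_ge0.
rewrite ge0_integralZl//.
rewrite mulrDl EFinD leeD ?FV//.
rewrite mulrnAl -mulrnAr EFinM lee_wpmul2l//.
exact: integral_off_interval.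
Qed.

(** Where both values of [F] are nonzero this is the quotient rule for increments. Where one of them
    vanishes nothing is known about [m] at that point, but the increment reduces to a single
    quotient, bounded by |F|/c. *)
Lemma bv_div (F m : R -> R) (S B V L c : R) : 0 <= B -> 0 < c -> 0 <= L ->
  measurable_fun setT m ->
  (forall r u, `|m r - m u| <= L * `|r - u|) ->
  (forall r, F r != 0 -> c <= `|m r|) ->
  L1_variation F S B V ->
  L1_variation (fun r => F r / m r) (S / c) B
    (V / c + S * L / c ^+ 2 * (B *+ 2)).
Proof.
move=> B0 c0 L0 mm mL mc bF; have S0 := bv_sup_ge0 bF; have [mF FS F0 FV] := bF.
have mV : measurable_fun setT (fun r => (m r)^-1).
  (* Squaring gives [powR] a nonnegative base; where m r = 0 both sides are 0. *)
  rewrite (_ : (fun _ => _) = fun r => m r * (m r ^+ 2) `^ (-1)).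
    apply: measurable_funM => //; apply: (measurableT_comp (measurable_powR _)).
    exact: measurable_funX.
  apply/funext => r; rewrite powR_inv1 ?sqr_ge0//.
  have [->|m0] := eqVneq (m r) 0; first by rewrite invr0 mul0r.
  by rewrite expr2 invfM mulrA divff// mul1r.
have mQ : measurable_fun setT (fun r => F r / m r) by exact: measurable_funM.
have Fm r : `|F r / m r| <= `|F r| / c.
  have [->|Fr] := eqVneq (F r) 0; first by rewrite mul0r normr0 mul0r.
  have mr0 := mc _ Fr.
  rewrite normrM normfV ler_wpM2l// lef_pV2 ?posrE//.
  exact: lt_le_trans mr0.
split => //.
- by move=> r; rewrite (le_trans (Fm r))// ler_wpM2r// invr_ge0 ltW.
- by move=> r rB; rewrite F0 ?mul0r.
move=> d /[dup] d01 /andP[d0 d1].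
have mD : measurable_fun setT (fun r : R => `|F (r + d) - F r|%:E).
  apply/measurable_EFinP; apply: (measurableT_comp (@normr_measurable R setT)).
  by apply: measurable_funB => //; exact: measurable_shift.
have c'0 : 0 <= c^-1 by rewrite invr_ge0 ltW.
have k0 : 0 <= S * L * d / c ^+ 2.
  by rewrite !mulr_ge0// ?invr_ge0 ?exprn_ge0// ltW.
apply: (@le_trans _ _ (\int[leb]_r ((c^-1)%:E * `|F (r + d) - F r|%:E +
    (S * L * d / c ^+ 2 * \1_(`[- B, B]) r)%:E))%E).
  apply: ge0_le_integral => //.
  - apply/measurable_EFinP; apply: (measurableT_comp (@normr_measurable R setT)).
    by apply: measurable_funB => //; exact: (measurable_shift d mQ).
  - apply: emeasurable_funD; first exact: measurable_funeM.
    exact: measurable_int (integrable_indic_itvcc _ _).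
  move=> r _; rewrite -EFinM -EFinD lee_fin.
  have pos : 0 <= S * L * d / c ^+ 2 * \1_(`[- B, B]) r by rewrite mulr_ge0.
  have [F1|F1] := eqVneq (F (r + d)) 0.
    rewrite F1 mul0r !sub0r !normrN (le_trans (Fm r))// mulrC lerDl//.
  have [F2|F2] := eqVneq (F r) 0.
    by rewrite F2 mul0r !subr0 (le_trans (Fm _))// mulrC lerDl.
  have m1 := mc _ F1; have m2 := mc _ F2.
  have m1' : m (r + d) != 0 by rewrite -normr_gt0 (lt_le_trans c0).
  have m2' : m r != 0 by rewrite -normr_gt0 (lt_le_trans c0).
  rewrite (_ : _ - _ = (F (r + d) - F r) / m (r + d) +
    F r * (m r - m (r + d)) / (m r * m (r + d))); last by field; rewrite m1' m2'.
  rewrite (le_trans (ler_normD _ _))// lerD//.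
    rewrite normrM mulrC normfV ler_wpM2r// lef_pV2 ?posrE//.
    exact: lt_le_trans m1.
  have rB : `|r| <= B by rewrite leNgt; apply/negP => /F0/eqP; rewrite (negbTE F2).
  rewrite indicE mem_set ?mulr1//=; last by rewrite in_itv/= -ler_norml.
  rewrite !normrM normfV normrM ler_pM//.
  - rewrite -mulrA ler_pM// (le_trans (mL _ _))//.
    by rewrite opprD addrA subrr sub0r normrN gtr0_norm.
  - rewrite lef_pV2 ?posrE ?exprn_gt0//; last by rewrite mulr_gt0// normr_gt0.
    by rewrite expr2 ler_pM// ltW.
rewrite ge0_integralD//; first last.
- exact: measurable_int (integrable_indic_itvcc _ _).
- by move=> r _; rewrite lee_fin; apply: mulr_ge0.
- exact: measurable_funeM.
- by move=> r _; rewrite mule_ge0.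
rewrite ge0_integralZl//.
rewrite integral_indic_itvcc// mulrDl EFinD leeD//.
  by rewrite mulrAC [V * d / c]mulrC EFinM lee_wpmul2l ?FV.
rewrite lee_fin le_eqVlt; apply/orP; left; apply/eqP; field.
by rewrite gt_eqF.
Qed.

End variation.

(** * Deconvolution on the line *)

Section kernel_transform.
Context {R : realType} d (Y : measurableType d).
Variables (nu : {sigma_finite_measure set Y -> \bar R}) (om c : Y -> R) (A : R).
Hypothesis om0 : forall y, 0 <= om y.
Hypothesis iom : nu.-integrable setT (EFin \o om).
Hypothesis mc : measurable_fun setT c.
Hypothesis cA : forall y, om y != 0 -> `|c y| <= A.
Hypothesis A0 : 0 < A.
Local Notation leb := (@lebesgue_measure R).

Definition mass : R := \int[nu]_y om y.

(** The i-th derivative in r of [om y * cos (r * c y)]: each differentiation adds pi/2 to the phase,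
    which avoids a case distinction modulo 4. *)
Let jet_integrand (i : nat) (r : R) (y : Y) :=
  om y * c y ^+ i * cos (r * c y + i%:R * (pi / 2)).

Definition kernel_jet (i : nat) (r : R) : R := \int[nu]_y jet_integrand i r y.

Definition kernel_transform (r : R) : R := \int[nu]_y (om y * cos (r * c y)).

Let mom : measurable_fun setT om.
Proof. by apply/measurable_EFinP; exact: measurable_int iom. Qed.

Let measurable_jet_integrand i r : measurable_fun setT (jet_integrand i r).
Proof.
apply: measurable_funM.
  by apply: measurable_funM => //; exact: measurable_funX.
apply: (measurableT_comp (continuous_measurable_fun (@continuous_cos R))).
by apply: measurable_funD => //; exact: measurable_funM.
Qed.

Let jet_integrand_le i r y : `|jet_integrand i r y| <= om y * A ^+ i.
Proof.
rewrite /jet_integrand !normrM (ger0_norm (om0 y)) -mulrA.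
have [->|omy] := eqVneq (om y) 0; first by rewrite !mul0r.
rewrite ler_wpM2l// -[leRHS]mulr1 ler_pM// ?cos_max//.
by rewrite normrX lerXn2r// ?nnegrE// ?(ltW A0)// cA.
Qed.

Let integrable_jet_integrand i r : nu.-integrable setT (EFin \o jet_integrand i r).
Proof.
apply: le_integrable (integrableZr measurableT (A ^+ i) iom) => //.
  exact/measurable_EFinP.
move=> y _ /=; rewrite lee_fin (le_trans (jet_integrand_le i r y))//.
exact: ler_norm.
Qed.

Lemma kernel_jet_bound i r : `|kernel_jet i r| <= mass * A ^+ i.
Proof.
apply: le_trans (le_normr_Rintegral measurableT (integrable_jet_integrand i r)) _.
rewrite /mass -RintegralZr//; apply: le_Rintegral => //.
- exact: integrable_norm (integrable_jet_integrand i r).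
- exact: (integrableZr measurableT (A ^+ i) iom).
Qed.

Let is_derive_jet_integrand i (r : R) y :
  is_derive r 1 ((jet_integrand i) ^~ y) (jet_integrand i.+1 r y).
Proof.
rewrite /jet_integrand; apply: is_derive_eq.
rewrite /GRing.scale /=.
rewrite (_ : r * c y + i.+1%:R * (pi / 2) = (r * c y + i%:R * (pi / 2)) + pi / 2); last first.
  by rewrite -natr1; ring.
rewrite cosDpihalf exprS; ring.
Qed.

Lemma kernel_jet_derive i (r : R) : is_derive r 1 (kernel_jet i) (kernel_jet i.+1 r).
Proof.
have rI : `]r - 1, r + 1[%classic r by rewrite /= in_itv/=; apply/andP; split; lra.
have h1 x : `]r - 1, r + 1[%classic x -> nu.-integrable setT (EFin \o jet_integrand i x).
  by move=> _; exact: integrable_jet_integrand.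
have h2 x y : `]r - 1, r + 1[%classic x -> setT y -> derivable ((jet_integrand i) ^~ y) x 1.
  by move=> _ _; have [] := is_derive_jet_integrand i x y.
have h3 y : 0 <= om y * A ^+ i.+1 by rewrite mulr_ge0// exprn_ge0// ltW.
have h4 : nu.-integrable setT (EFin \o (fun y => om y * A ^+ i.+1)).
  exact: (integrableZr measurableT (A ^+ i.+1) iom).
have h5 x y : `]r - 1, r + 1[%classic x -> setT y ->
    `|partial1of2 (jet_integrand i) x y| <= om y * A ^+ i.+1.
  move=> _ _; rewrite partial1of2E.
  by have [_ ->] := is_derive_jet_integrand i x y; exact: jet_integrand_le.
split; first exact: (derivable_under_integral measurableT rI h1 h2 h3 h4 h5).
rewrite -derive1E (differentiation_under_integral measurableT rI h1 h2 h3 h4 h5).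
apply: eq_Rintegral => y _; rewrite partial1of2E.
by have [_ ->] := is_derive_jet_integrand i r y.
Qed.

Lemma kernel_jet0 : kernel_jet 0 = kernel_transform.
Proof.
apply/funext => r; apply: eq_Rintegral => y _.
by rewrite /jet_integrand expr0 mulr1 mul0r addr0.
Qed.

Lemma kernel_transform0 : kernel_transform 0 = mass.
Proof. by apply: eq_Rintegral => y _; rewrite mul0r cos0 mulr1. Qed.

Lemma kernel_transform_zeros B : 0 < mass ->
  finite_set [set r | `|r| <= B /\ kernel_transform r = 0].
Proof.
move=> W0; rewrite -kernel_jet0.
apply: (@jet_finite_zeros _ kernel_jet mass A _ _ _ _ 0) => //.
- exact: kernel_jet_derive.
- exact: kernel_jet_bound.
- by rewrite kernel_jet0 kernel_transform0 gt_eqF.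
Qed.

Lemma kernel_transform_continuous : continuous kernel_transform.
Proof. by rewrite -kernel_jet0; exact: (jet_continuous kernel_jet_derive). Qed.

Lemma kernel_transform_lipschitz r u :
  `|kernel_transform r - kernel_transform u| <= mass * A * `|r - u|.
Proof.
rewrite -kernel_jet0.
have key x y : x < y ->
    `|kernel_jet 0 y - kernel_jet 0 x| <= mass * A * `|y - x|.
  move=> xy; have [z _ ->] := MVT xy (fun z _ => kernel_jet_derive 0 z)
    (continuous_subspaceT (jet_continuous kernel_jet_derive (i := 0))).
  by rewrite normrM ler_wpM2r// -[A]expr1 kernel_jet_bound.
have [ru|ur|->] := ltgtP r u; last by rewrite !subrr normr0 mulr0.
- by rewrite distrC (distrC r); exact: key.
- exact: key.
Qed.

(** The convolution theorem in cosine form: expanding cos (r (t + c)) leaves a sine term, which the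
    symmetry hypothesis on the kernel removes. *)
Lemma cos_transform_average (F : R -> R) (S B V : R) t : 0 <= B ->
  L1_variation F S B V ->
  (forall a, \int[nu]_y (om y * sin (a * c y)) = 0) ->
  \int[nu]_y (om y * cos_transform F (t + c y)) =
  cos_transform (fun r => F r * kernel_transform r) t.
Proof.
move=> B0 bF sin0; have iF := bv_integrable bF; have [mF _ _ _] := bF.
pose G (z : Y * measurableTypeR R) := (om z.1 * (F z.2 * cos (z.2 * (t + c z.1))))%:E.
have mG : measurable_fun setT G.
  apply/measurable_EFinP/measurable_funM; first exact: (measurableT_comp mom measurable_fst).
  apply: measurable_funM; first exact: (measurableT_comp mF measurable_snd).
  apply: (measurableT_comp (continuous_measurable_fun (@continuous_cos R))).
  apply: measurable_funM; first exact: measurable_snd.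
  by apply: measurable_funD => //; exact: (measurableT_comp mc measurable_fst).
have iG : (nu \x leb)%E.-integrable setT G.
  apply/(integrable12ltyP _ _ mG).
  have /integrableP[_ h1] := integrable_norm iF.
  have /integrableP[_ h2] := integrableZr measurableT (\int[leb]_r `|F r|) iom.
  apply: le_lt_trans h2; apply: ge0_le_integral => //.
  - by move=> y _; exact: integral_ge0.
  - exact: (measurable_fun_fubini_tonelli_F _ (measurable_abse_comp mG)).
  - apply: measurable_abse_comp.
    exact: measurable_int (integrableZr measurableT (\int[leb]_r `|F r|) iom).
  move=> y _; apply: (@le_trans _ _ ((om y)%:E * \int[leb]_r `|F r|%:E)%E); last first.
    rewrite /= normrM (ger0_norm (om0 y)) (ger0_norm (Rintegral_ge0 _ _))//.
    by rewrite EFinM /Rintegral fineK ?(integrable_fin_num measurableT (integrable_norm iF)).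
  rewrite -ge0_integralZl//; last 2 first.
  - exact: measurable_int (integrable_norm iF).
  - by rewrite lee_fin.
  apply: ge0_le_integral => //.
  - apply: measurable_abse_comp; exact: (measurableT_comp mG (measurable_pair1 y)).
  - apply: measurable_funeM; exact: measurable_int (integrable_norm iF).
  move=> r _; rewrite /G /= -EFinM lee_fin !normrM (ger0_norm (om0 y)).
  by rewrite ler_wpM2l// ler_piMr// cos_max.
have := Fubini iG => E.
transitivity (fine (\int[nu]_y \int[leb]_r G (y, r))).
  congr fine; apply: eq_integral => y _.
  have iFc := bv_integrable_cos bF (t + c y).
  rewrite EFinM /cos_transform /Rintegral fineK ?(integrable_fin_num measurableT iFc)//.
  by rewrite -integralZl.
rewrite E; congr fine; apply: eq_integral => r _.
have i1 a : nu.-integrable setT (fun y => (om y * cos (a * c y))%:E).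
  apply: le_integrable iom => //.
    apply/measurable_EFinP/measurable_funM => //.
    apply: (measurableT_comp (continuous_measurable_fun (@continuous_cos R))).
    exact: measurable_funM.
  by move=> y _; rewrite lee_fin normrM ler_piMr// cos_max.
have i2 a : nu.-integrable setT (fun y => (om y * sin (a * c y))%:E).
  apply: le_integrable iom => //.
    apply/measurable_EFinP/measurable_funM => //.
    apply: (measurableT_comp (continuous_measurable_fun (@continuous_sin R))).
    exact: measurable_funM.
  by move=> y _; rewrite lee_fin normrM ler_piMr// sin_max.
transitivity (\int[nu]_y ((F r * cos (r * t))%:E * (om y * cos (r * c y))%:E -
    (F r * sin (r * t))%:E * (om y * sin (r * c y))%:E))%E.
  apply: eq_integral => y _; rewrite /G -!EFinM -EFinB; congr EFin.
  by rewrite /= mulrDr cosD; ring.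
rewrite integralB//; [|exact: integrableZl|exact: integrableZl].
rewrite !integralZl//.
have -> : (\int[nu]_y (om y * sin (r * c y))%:E = 0)%E.
  by rewrite -[LHS]fineK ?(integrable_fin_num measurableT (i2 r))// -/(Rintegral _ _ _) sin0.
rewrite mule0 sube0 /kernel_transform -[X in (_ * X)%E]fineK; last first.
  exact: (integrable_fin_num measurableT (i1 r)).
by rewrite -EFinM; congr EFin; rewrite mulrAC.
Qed.

End kernel_transform.

Section convolution.
Context {R : realType}.
Local Notation leb := (@lebesgue_measure R).
Local Notation vol := (@lebesgue_cV R).

Lemma weight1E (t : R) : weight 1 t = (1 + `|t|)^-1.
Proof. by rewrite /weight powR_inv1 ?addr_ge0. Qed.

Lemma weight1_shift (t s : R) : weight 1 (t + s) <= (1 + `|s|) * weight 1 t.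
Proof.
rewrite !weight1E ler_pdivlMr ?ltr_pwDl// mulrC ler_pdivrMr ?ltr_pwDl//.
have : `|t| <= `|t + s| + `|s| by rewrite -{1}(addrK s t) ler_normB.
have := normr_ge0 (t + s); have := normr_ge0 s; nra.
Qed.

Variables (nu : {sigma_finite_measure set 'cV[R]_1 -> \bar R}) (om : 'cV[R]_1 -> R).
Variable rho : R.
Hypothesis om0 : forall y, 0 <= om y.
Hypothesis iom : nu.-integrable setT (EFin \o om).
Hypothesis om1 : forall y, om y != 0 -> `|y ord0 ord0| <= 1.
Hypothesis rho0 : 0 < rho.

Variable phi : 'cV[R]_1 -> \bar R.
Hypothesis mphi : measurable_fun setT phi.
Hypothesis iphi : (vol 1).-integrable setT
  (fun t => phi t * (weight 1 (t ord0 ord0))%:E)%E.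
Hypothesis conv0 : {ae vol 1, forall t,
  (\int[nu]_y ((om y)%:E * phi (t - rho *: y)%R) = 0)%E}.

Let mom : measurable_fun setT om.
Proof. by apply/measurable_EFinP; exact: measurable_int iom. Qed.

Let mentry (x : 'cV[R]_1) : R := x ord0 ord0.

Let mmentry : measurable_fun setT mentry.
Proof. exact: measurable_mx_entry. Qed.

(* phi is only integrable against weight 1, so the test function psi must decay
   like 1 / (1 + |t|). *)
Lemma convolution_annihilates (psi M : R -> R) (C : R) :
  measurable_fun setT psi -> (forall t, `|psi t| <= C * weight 1 t) ->
  measurable_fun setT M ->
  (forall a, \int[nu]_y (om y * psi (a + rho * y ord0 ord0)) = M a) ->
  (\int[vol 1]_t (phi t * (M (t ord0 ord0))%:E) = 0)%E.
Proof.
move=> mpsi psiC mM ME.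
have C0 : 0 <= C.
  have := psiC 0; rewrite weight1E normr0 addr0 invr1 mulr1.
  exact: le_trans.
pose K1 (z : 'cV[R]_1 * 'cV[R]_1) : \bar R :=
  ((om z.2 * psi (mentry z.1 + rho * mentry z.2))%:E * phi z.1)%E.
pose K (z : 'cV[R]_1 * 'cV[R]_1) : \bar R :=
  ((om z.2 * psi (mentry z.1))%:E * phi (z.1 - rho *: z.2)%R)%E.
have mK1 : measurable_fun setT K1.
  apply: emeasurable_funM; last exact: (measurableT_comp mphi measurable_fst).
  apply/measurable_EFinP/measurable_funM; first exact: (measurableT_comp mom measurable_snd).
  apply: (measurableT_comp mpsi); apply: measurable_funD.
    exact: (measurableT_comp mmentry measurable_fst).
  by apply: measurable_funM => //; exact: (measurableT_comp mmentry measurable_snd).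
have mK : measurable_fun setT K.
  apply: emeasurable_funM; last first.
    apply: (measurableT_comp mphi); apply: measurable_subrmx; first exact: measurable_fst.
    apply: measurable_scalemx; first exact: measurable_cst.
    exact: measurable_snd.
  apply/measurable_EFinP/measurable_funM; first exact: (measurableT_comp mom measurable_snd).
  exact: (measurableT_comp mpsi (measurableT_comp mmentry measurable_fst)).
(* Translation by rho y, for a general [h]: the absolute value transfers integrability from [K1] to
   [K], and the identity transfers the integral. *)
have KK1 y (h : \bar R -> \bar R) : measurable_fun setT h ->
    (\int[vol 1]_t h (K (t, y)) = \int[vol 1]_t h (K1 (t, y)))%E.
  move=> mh; rewrite -(transports1_integral (transports_shift (rho *: y))
    (F := fun t => h (K (t, y)))); last first.
    exact: (measurableT_comp mh (measurableT_comp mK (measurable_pair2 y))).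
  apply: eq_integral => t _; rewrite /K /K1 /= addrK.
  by rewrite /mentry !mxE.
have iK1 : (\int[nu]_y \int[vol 1]_t `|K1 (t, y)| < +oo)%E.
  pose I := (\int[vol 1]_t `|phi t * (weight 1 (t ord0 ord0))%:E|)%E.
  have Ioo : (I < +oo)%E by have /integrableP[] := iphi.
  have I0 : (0 <= I)%E by exact: integral_ge0.
  have Ifin : I \is a fin_num by rewrite ge0_fin_numE.
  have /integrableP[_ h2] := integrableZr measurableT (C * (1 + rho) * fine I) iom.
  apply: le_lt_trans h2; apply: ge0_le_integral => //.
  - by move=> y _; exact: integral_ge0.
  - exact: (measurable_fun_fubini_tonelli_G _ (measurable_abse_comp mK1)).
  - apply: measurable_abse_comp.
    exact: measurable_int (integrableZr measurableT (C * (1 + rho) * fine I) iom).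
  move=> y _; apply: (@le_trans _ _ ((om y * (C * (1 + rho)))%:E * I)%E); last first.
    rewrite -{1}(fineK Ifin) -EFinM -(mulrA (om y)); apply: le_trans (lee_abs _).
    exact: lexx.
  have c0 : 0 <= om y * (C * (1 + rho)) by rewrite !mulr_ge0// addr_ge0// ltW.
  rewrite -ge0_integralZl//; last exact: measurable_abse_comp (measurable_int _ iphi).
  apply: ge0_le_integral => //.
  - exact: measurable_abse_comp (measurableT_comp mK1 (measurable_pair2 y)).
  - apply: measurable_funeM; exact: measurable_abse_comp (measurable_int _ iphi).
  move=> t _; rewrite /K1 /= !abseM [X in (_ <= _ * X)%E]muleC muleA.
  rewrite lee_wpmul2r// -EFinM lee_fin normrM (ger0_norm (om0 y)).
  rewrite (ger0_norm (weight_ge0 _ _)).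
  have [->|omy] := eqVneq (om y) 0; first by rewrite !mul0r.
  rewrite -!mulrA ler_wpM2l// (le_trans (psiC _))// ler_wpM2l//.
  rewrite (le_trans (weight1_shift _ _))// ler_wpM2r ?weight_ge0// lerD2l.
  by rewrite normrM gtr0_norm// ler_piMr ?(ltW rho0)// om1.
have iK1p : (vol 1 \x nu)%E.-integrable setT K1 by apply/(integrable21ltyP _ _ mK1).
have iKp : (vol 1 \x nu)%E.-integrable setT K.
  apply/(integrable21ltyP _ _ mK); rewrite (eq_integral _ _ (fun y _ => KK1 y abse _))//.
have E0 : (\int[vol 1]_t \int[nu]_y K (t, y) = 0)%E.
  rewrite (ae_eq_integral (cst 0%E)) ?integral0//.
    exact: measurable_fubini_F iKp.
  have h1 := ae_integrable1 iKp.
  apply: filterS2 h1 conv0 => t it ct _.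
  (* The factor psi t may leave the integral over y only if the rest is integrable, which is
     obtained by dividing by psi t. *)
  have [p0|p0] := eqVneq (psi (mentry t)) 0.
    by rewrite integral0_eq// => y _; rewrite /K /= p0 mulr0 mul0e.
  have it' : nu.-integrable setT (fun y => ((om y)%:E * phi (t - rho *: y)%R)%E).
    apply: eq_integrable (integrableZl measurableT (psi (mentry t))^-1 it) => // y _.
    by rewrite /K /= muleA -EFinM mulrCA mulVf// mulr1.
  rewrite (eq_integral (fun y => (psi (mentry t))%:E * ((om y)%:E * phi (t - rho *: y)%R))%E).
    by rewrite integralZl// ct mule0.
  by move=> y _; rewrite /K /= muleA -EFinM mulrC.
have E1 : (\int[vol 1]_t \int[nu]_y K1 (t, y) = 0)%E.
  rewrite (Fubini iK1p) -E0 (Fubini iKp).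
  by apply: eq_integral => y _; rewrite -(KK1 y id).
rewrite -[RHS]E1; apply: ae_eq_integral => //.
- apply: emeasurable_funM => //; apply/measurable_EFinP.
  exact: (measurableT_comp mM mmentry).
- exact: measurable_fubini_F iK1p.
have fin := integrable_ae measurableT iphi.
apply: filterS fin => t /(_ I) fint _.
(* A positive weight cannot make an infinite value finite, so [phi] is finite wherever the weighted
   function is. *)
have pf : phi t \is a fin_num.
  have w0 : 0 < weight 1 (t ord0 ord0) by exact: weight_gt0.
  move: fint; case: (phi t) => [r| |] //=.
    by rewrite gt0_mulye.
  by rewrite gt0_mulNye.
have iop : nu.-integrable setT
    (fun y => (om y * psi (mentry t + rho * mentry y))%:E).
  apply: le_integrable (integrableZr measurableT C iom) => //.
    apply/measurable_EFinP/measurable_funM => //; apply: (measurableT_comp mpsi).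
    by apply: measurable_funD => //; exact: measurable_funM.
  move=> y _; rewrite lee_fin !normrM (ger0_norm C0) ler_wpM2l//.
  by rewrite (le_trans (psiC _))// ler_piMr// weight_le1.
rewrite -ME /Rintegral fineK ?(integrable_fin_num measurableT iop)//.
rewrite -[phi t in LHS]fineK// muleC -integralZr//.
by apply: eq_integral => y _; rewrite /K1 /= fineK.
Qed.

End convolution.

Section cutoff.
Context {R : realType}.
Local Notation leb := (@lebesgue_measure R).

Lemma measurable_cos_transform (F : R -> R) (S B V : R) :
  L1_variation F S B V -> measurable_fun setT (cos_transform F).
Proof.
move=> [mF _ _ _].
pose G (z : measurableTypeR R * measurableTypeR R) : R := F z.2 * cos (z.2 * z.1).
apply: (@measurable_Rintegral_param R _ _ _ _ leb G).
apply: measurable_funM; first exact: (measurableT_comp mF measurable_snd).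
apply: (measurableT_comp (continuous_measurable_fun (@continuous_cos R))).
by apply: measurable_funM; [exact: measurable_snd|exact: measurable_fst].
Qed.

Definition cutoff (s : seq R) (e : R) (F : R -> R) : R -> R :=
  foldr (fun z G r => G r * off_interval z e r) F s.

Lemma bv_cutoff (F : R -> R) (S B V : R) s e : 0 <= B -> L1_variation F S B V ->
  L1_variation (cutoff s e F) S B (V + S *+ 2 *+ size s).
Proof.
move=> B0 bF; elim: s => [|z s IH] /=; first by rewrite addr0.
by rewrite mulrSr addrA; exact: bv_off_interval.
Qed.

Lemma cutoff_neq0 (F : R -> R) s e r : cutoff s e F r != 0 ->
  F r != 0 /\ forall z, z \in s -> e <= `|r - z|.
Proof.
elim: s => [|z s IH] /=; first by move=> F0; split.
rewrite mulf_eq0 => /norP[/IH[F0 Hs] ro]; split=> // y.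
rewrite in_cons => /predU1P[->|/Hs//].
rewrite leNgt; apply: contra ro; rewrite ltr_norml => /andP[h1 h2].
rewrite /off_interval indicE mem_set ?subrr//= in_itv/=.
by apply/andP; split; lra.
Qed.

Lemma cutoff_cvg (F : R -> R) s r : r \notin s ->
  cutoff s n.+1%:R^-1 F r @[n --> \oo] --> F r.
Proof.
elim: s => [|z s IH] /=; first by move=> _; exact: cvg_cst.
rewrite in_cons => /norP[rz /IH h]; rewrite -[X in _ --> X]mulr1.
apply: cvgM; first exact: h.
have d0 : 0 < `|z - r| by rewrite normr_gt0 subr_eq0 eq_sym.
apply: cvg_near_cst.
have := near_infty_natSinv_lt (PosNum d0).
apply: filterS => n /= nd.
rewrite /off_interval indicE memNset ?subr0//= in_itv/= => /andP[h1 h2].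
suff : `|z - r| < n.+1%:R^-1 by rewrite ltNge (ltW nd).
move: (n.+1%:R^-1 : R) h1 h2 => e h1 h2.
by rewrite ltr_norml; apply/andP; split; lra.
Qed.

Lemma ae_notin (s : seq R) : {ae leb, forall r, r \notin s}.
Proof.
have : leb.-negligible [set` s].
  elim: s => [|z s IH].
    by rewrite set_nil; exact: negligible_set0.
  rewrite (_ : [set` z :: s] = [set z] `|` [set` s]); last first.
    by apply/seteqP; split=> x /=; rewrite in_cons; [move/predU1P|move=> h; apply/predU1P].
  apply: negligibleU => //.
  by exists [set z]; split => //; exact: lebesgue_measure_set1.
by apply: negligibleS => r /= /negP/negPn.
Qed.

Lemma cutoff_transform_cvg (F : R -> R) (S B V : R) s t : 0 <= B ->
  L1_variation F S B V ->
  cos_transform (cutoff s n.+1%:R^-1 F) t @[n --> \oo] --> cos_transform F t.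
Proof.
move=> B0 bF.
have bC n := bv_cutoff s n.+1%:R^-1 B0 bF.
have iC n := bv_integrable_cos (bC n) t.
have iF := bv_integrable_cos bF t.
have /fine_cvgP[_] // : (\int[leb]_r (cutoff s n.+1%:R^-1 F r * cos (r * t))%:E)%E
    @[n --> \oo] --> (cos_transform F t)%:E.
rewrite /cos_transform /Rintegral fineK ?(integrable_fin_num measurableT iF)//.
have [] := @dominated_convergence _ (measurableTypeR R) R leb setT measurableT
  (fun n r => (cutoff s n.+1%:R^-1 F r * cos (r * t))%:E)
  (fun r => (F r * cos (r * t))%:E) (fun r => (S * \1_(`[- B, B]) r)%:E) => //.
- by move=> n; exact: measurable_int (iC n).
- exact: measurable_int iF.
- apply: (@filterS _ _ (ae_filter_ringOfSetsType leb) _ _ _ (ae_notin s)) => r rs _.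
  apply: cvg_EFin; first exact: nearW.
  by apply: cvgMl; exact: cutoff_cvg.
- exact: integrable_indic_itvcc.
apply: aeW => r n _; rewrite lee_fin normrM.
by rewrite (le_trans _ (bv_le_indic (bC n) r))// ler_piMr// cos_max.
Qed.

End cutoff.

Section deconvolution.
Context {R : realType}.
Local Notation leb := (@lebesgue_measure R).
Local Notation vol := (@lebesgue_cV R).
Variables (nu : {sigma_finite_measure set 'cV[R]_1 -> \bar R}) (om : 'cV[R]_1 -> R).
Variable rho : R.
Hypothesis om0 : forall y, 0 <= om y.
Hypothesis iom : nu.-integrable setT (EFin \o om).
Hypothesis om1 : forall y, om y != 0 -> `|y ord0 ord0| <= 1.
Hypothesis mass_gt0 : 0 < mass nu om.
Hypothesis sin0 : forall a, \int[nu]_y (om y * sin (a * (rho * y ord0 ord0))) = 0.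
Hypothesis rho0 : 0 < rho.

Variable phi : 'cV[R]_1 -> \bar R.
Hypothesis mphi : measurable_fun setT phi.
Hypothesis iphi : (vol 1).-integrable setT
  (fun t => phi t * (weight 1 (t ord0 ord0))%:E)%E.
Hypothesis conv0 : {ae vol 1, forall t,
  (\int[nu]_y ((om y)%:E * phi (t - rho *: y)%R) = 0)%E}.

Let c (y : 'cV[R]_1) : R := rho * y ord0 ord0.
Let m := kernel_transform nu om c.

Let mc : measurable_fun setT c.
Proof. by apply: measurable_funM => //; exact: measurable_mx_entry. Qed.

Let cA y : om y != 0 -> `|c y| <= rho.
Proof. by move=> /om1 y1; rewrite normrM gtr0_norm// ler_piMr// ltW. Qed.

Lemma transform_shift_bound (F : R -> R) (S B V b t : R) : 0 <= B ->
  L1_variation F S B V ->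
  `|cos_transform F (t - b)| <=
    (10 * B * S + 4 * V) * (1 + `|b|) * weight 1 t.
Proof.
move=> B0 bF; have C0 : 0 <= 10 * B * S + 4 * V.
  have := cos_transform_decay B0 bF 0; rewrite weight1E normr0 addr0 invr1 mulr1.
  exact: le_trans.
rewrite (le_trans (cos_transform_decay B0 bF _))// -[leRHS]mulrA ler_wpM2l//.
by rewrite -(normrN b) weight1_shift.
Qed.

(** The kernel average of the transform of F is the transform of F m; hence [phi] is annihilated by
    the transform of every profile that can be divided by [m] within bounded variation. *)
Lemma annihilates_filtered (F : R -> R) (S B V S' V' b : R) : 0 <= B ->
  L1_variation (fun r => F r * m r) S B V -> L1_variation F S' B V' ->
  (\int[vol 1]_t (phi t *
    (cos_transform (fun r => F r * m r) (t ord0 ord0 - b))%:E) = 0)%E.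
Proof.
move=> B0 bFm bF.
apply: (@convolution_annihilates R nu om rho om0 iom om1 rho0 phi mphi iphi conv0
  (fun t => cos_transform F (t - b))
  (fun t => cos_transform (fun r => F r * m r) (t - b))).
- apply: (measurableT_comp (measurable_cos_transform bF)).
  by apply: measurable_funB.
- by move=> t; exact: (transform_shift_bound b t B0 bF).
- apply: (measurableT_comp (measurable_cos_transform bFm)).
  by apply: measurable_funB.
move=> a; rewrite -(cos_transform_average om0 iom mc (a - b) B0 bF sin0).
by apply: eq_Rintegral => y _; rewrite /c addrAC.
Qed.

(** Off the e-neighbourhoods of the zeros, |m| is continuous and positive on a compact set and
    attains its minimum; if that set is empty any constant serves. *)
Lemma lower_bound_off_zeros (s : seq R) (B e : R) :
  [set r | `|r| <= B /\ m r = 0] = [set` s] -> 0 < e ->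
  exists2 k, 0 < k & forall r, `|r| <= B -> (forall z, z \in s -> e <= `|r - z|) ->
    k <= `|m r|.
Proof.
move=> sE e0.
pose K := `[- B, B]%classic `&` [set r : R | forall z, z \in s -> e <= `|r - z|].
have [K0|/set0P K0] := eqVneq K set0.
  exists 1 => // r rB rs; suff : K r by rewrite K0.
  by split => //=; rewrite in_itv/= -ler_norml.
have cm : continuous m by exact: (kernel_transform_continuous om0 iom mc cA rho0).
have cK : compact K.
  apply: compact_closedI; first exact: segment_compact.
  rewrite (_ : [set r | _] = \bigcap_(z in [set` s]) [set r : R | e <= `|r - z|]); last first.
    by apply/seteqP; split.
  apply: closed_bigI => z _.
  apply: (@closed_comp _ _ (fun r : R => `|r - z|) [set x | e <= x]); last exact: closed_ge.
  by move=> r _; exact: (cvg_norm (cvgB cvg_id (cvg_cst z))).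
have cnm : {within K, continuous (fun r => `|m r|)}.
  by apply: continuous_subspaceT => r; exact: (cvg_norm (cm r)).
have [r0 /set_mem [/= r0B r0s] r0min] := compact_EVT_min K0 cK cnm.
exists `|m r0|.
  rewrite normr_gt0; apply/eqP => mr0.
  have /r0s : r0 \in s.
    have : [set` s] r0 by rewrite -sE /=; split=> //; move: r0B; rewrite in_itv/= -ler_norml.
    by [].
  by rewrite subrr normr0 leNgt e0.
move=> r rB rs; apply: r0min; rewrite inE; split => //=.
by rewrite in_itv/= -ler_norml.
Qed.

(* F is cut off near the finitely many zeros of m, so that it can be divided by
   m; the cut-offs are uniformly of bounded variation, hence can be removed by
   dominated convergence. *)
Lemma deconvolution (F : R -> R) (S B V b : R) : 0 <= B ->
  L1_variation F S B V ->
  (\int[vol 1]_t (phi t * (cos_transform F (t ord0 ord0 - b))%:E) = 0)%E.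
Proof.
move=> B0 bF.
have /finite_seqP[s sE] := kernel_transform_zeros om0 iom mc cA rho0 B mass_gt0.
pose Fn n := cutoff s n.+1%:R^-1 F.
have bFn n : L1_variation (Fn n) S B (V + S *+ 2 *+ size s) by exact: bv_cutoff.
have zero n : (\int[vol 1]_t (phi t * (cos_transform (Fn n) (t ord0 ord0 - b))%:E) = 0)%E.
  have e0 : 0 < n.+1%:R^-1 :> R by rewrite invr_gt0.
  have [k k0 kH] := lower_bound_off_zeros sE e0.
  have nz r : Fn n r != 0 -> k <= `|m r|.
    move=> Fnr; have [_ Hs] := cutoff_neq0 Fnr.
    apply: kH => //; rewrite leNgt; apply/negP => rB.
    by have [_ _ /(_ r rB) F0 _] := bFn n; rewrite F0 eqxx in Fnr.
  have E : (fun r => Fn n r / m r * m r) = Fn n.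
    apply/funext => r; have [->|/nz kr] := eqVneq (Fn n r) 0; first by rewrite !mul0r.
    by rewrite divfK// -normr_gt0 (lt_le_trans k0).
  have mL := kernel_transform_lipschitz om0 iom mc cA rho0.
  have mm : measurable_fun setT m.
    by apply: continuous_measurable_fun; exact: (kernel_transform_continuous om0 iom mc cA rho0).
  have L0 : 0 <= mass nu om * rho by rewrite mulr_ge0// ltW.
  (* These constants depend on k, hence on n, without a uniform bound; they only license the
     division. The domination below uses the constants of [bFn], which are uniform in n. *)
  have bD := bv_div B0 k0 L0 mm mL nz (bFn n).
  by have := annihilates_filtered b B0 _ bD; rewrite E => /(_ _ _ (bFn n)).
set C := (10 * B * S + 4 * (V + S *+ 2 *+ size s)) * (1 + `|b|).
have mFn n : measurable_fun setT (fun t : 'cV[R]_1 => phi t * (cos_transform (Fn n) (t ord0 ord0 - b))%:E)%E.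
  apply: emeasurable_funM => //; apply/measurable_EFinP.
  apply: (measurableT_comp (measurable_cos_transform (bFn n))).
  by apply: measurable_funB => //; exact: measurable_mx_entry.
have mFF : measurable_fun setT (fun t : 'cV[R]_1 => phi t * (cos_transform F (t ord0 ord0 - b))%:E)%E.
  apply: emeasurable_funM => //; apply/measurable_EFinP.
  apply: (measurableT_comp (measurable_cos_transform bF)).
  by apply: measurable_funB => //; exact: measurable_mx_entry.
have iabs := integrable_abse iphi.
have fin := integrable_ae measurableT iphi.
have [] := @dominated_convergence _ _ R (vol 1) setT measurableT _ _
  (fun t => C%:E * `|phi t * (weight 1 (t ord0 ord0))%:E|)%E mFn mFF => //.
- apply: filterS fin => t /(_ I) fint _; apply: cvgeZl.
    have w0 : 0 < weight 1 (t ord0 ord0) by exact: weight_gt0.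
    move: fint; case: (phi t) => [r| |] //=.
      by rewrite gt0_mulye.
    by rewrite gt0_mulNye.
  apply: cvg_EFin; first exact: nearW.
  exact: cutoff_transform_cvg bF.
- exact: integrableZl.
- apply: aeW => t n _; rewrite !abseM muleCA lee_wpmul2l//.
  rewrite -EFinM lee_fin (ger0_norm (weight_ge0 _ _)).
  exact: (transform_shift_bound b _ B0 (bFn n)).
move=> _ _ h.
have h0 : ((fun n => \int[vol 1]_t (phi t * (cos_transform (Fn n) (t ord0 ord0 - b))%:E)) @ \oo --> 0)%E.
  by under eq_fun do rewrite zero; exact: cvg_cst.
exact: (cvg_unique _ h h0).
Qed.

End deconvolution.

(** * Hyperplane integrals and spherical means *)

Section plane_fubini.
Context {R : realType} (k : nat).
Variables (v : 'cV[R]_k.+1) (q : 'M[R]_(k.+1, k)).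
Hypothesis vv : (v^T *m v = 1%:M)%R.
Hypothesis qq : (q^T *m q = 1%:M)%R.
Hypothesis vq : (v^T *m q = 0)%R.
Variable f : 'cV[R]_k.+1 -> R.
Hypothesis mf : measurable_fun setT f.
Local Notation vol := (@lebesgue_cV R).
Hypothesis fi : (vol k.+1).-integrable setT (fun x => (f x * weight 1 (dot v x))%:E).
Local Open Scope ereal_scope.

Let T (z : 'cV[R]_1 * 'cV[R]_k) : 'cV[R]_k.+1 := (v *m z.1 + q *m z.2)%R.

Let tT : transports (vol 1 \x vol k) (vol k.+1) T 1.
Proof. exact: transports_frame. Qed.

Let mT : measurable_fun setT T. Proof. by have [] := tT. Qed.

Let dotT z : dot v (T z) = z.1 ord0 ord0.
Proof.
by rewrite /T /dot mulmxDr !mulmxA vv vq mul1mx mul0mx addr0.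
Qed.

Definition plane_integral (t : 'cV[R]_1) : \bar R :=
  \int[vol k]_y (f (v *m t + q *m y)%R)%:E.

Lemma measurable_plane_integral : measurable_fun setT plane_integral.
Proof.
apply: (@measurable_integral_param _ _ _ _ _ (vol k) (fun z => (f (T z))%:E)).
by apply/measurable_EFinP; exact: measurableT_comp.
Qed.

Let integrable_slice (psi : R -> R) (C : R) : measurable_fun setT psi ->
  (forall t, `|psi t| <= C * weight 1 t)%R ->
  (vol k.+1).-integrable setT (fun x => (f x * psi (dot v x))%:E).
Proof.
move=> mpsi psiC; have C0 : (0 <= C)%R.
  by have := psiC 0%R; rewrite weight1E normr0 addr0 invr1 mulr1; exact: le_trans.
apply: le_integrable (integrableZl measurableT C fi) => //.
  apply/measurable_EFinP/measurable_funM => //; apply: (measurableT_comp mpsi).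
  by apply: measurable_dot; [exact: measurable_cst|exact: measurable_id].
move=> x _; rewrite -EFinM lee_fin !normrM (ger0_norm C0) mulrCA ler_wpM2l//.
by rewrite (ger0_norm (weight_ge0 _ _)) psiC.
Qed.

(** Fubini in the coordinates (t, y) of the frame: [psi] depends on t alone and leaves the inner
    integral. The factoring holds for almost every t, namely where the inner function is
    integrable. *)
Lemma plane_integral_pairing (psi : R -> R) (C : R) : measurable_fun setT psi ->
  (forall t, `|psi t| <= C * weight 1 t)%R ->
  (vol 1).-integrable setT (fun t => plane_integral t * (psi (t ord0 ord0))%:E) /\
  \int[vol 1]_t (plane_integral t * (psi (t ord0 ord0))%:E) =
  \int[vol k.+1]_x (f x * psi (dot v x))%:E.
Proof.
move=> mpsi psiC; have iF := integrable_slice mpsi psiC.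
have iFT := transports_integrable tT iF.
have EF : {ae vol 1, forall t, plane_integral t * (psi (t ord0 ord0))%:E =
    fubini_F (vol k) ((fun x => (f x * psi (dot v x))%:E) \o T) t}.
  apply: filterS (ae_integrable1 iFT) => t it.
  rewrite /fubini_F /=; under eq_integral do rewrite dotT /=.
  have [p0|p0] := eqVneq (psi (t ord0 ord0)) 0%R.
    by rewrite p0 mule0 integral0_eq// => y _; rewrite mulr0.
  under eq_integral do rewrite EFinM.
  rewrite integralZr//.
  apply: eq_integrable (integrableZr measurableT (psi (t ord0 ord0))^-1 it) => // y _.
  by rewrite /= dotT -EFinM mulfK.
have mL : measurable_fun setT
    (fun t : 'cV[R]_1 => plane_integral t * (psi (t ord0 ord0))%:E).
  apply: emeasurable_funM; first exact: measurable_plane_integral.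
  by apply/measurable_EFinP; apply: (measurableT_comp mpsi); exact: measurable_mx_entry.
have mR := measurable_fubini_F iFT.
have EF' : ae_eq (vol 1) setT
    (fun t : 'cV[R]_1 => plane_integral t * (psi (t ord0 ord0))%:E)
    (fubini_F (vol k) ((fun x => (f x * psi (dot v x))%:E) \o T)).
  by apply: filterS EF => t ->.
split.
  apply/integrableP; split => //.
  have /integrableP[_] := integrable_fubini_F iFT; congr (_ < _).
  apply: ae_eq_integral => //; try exact: measurable_abse_comp.
  by apply: filterS EF => t ->.
rewrite (ae_eq_integral _ _ measurableT mL mR EF').
rewrite (integral12_prod_meas1 iFT).
by have := transports_integral tT iF; rewrite mul1e => <-.
Qed.

Lemma integrable_plane_integral : (vol 1).-integrable setT
  (fun t => plane_integral t * (weight 1 (t ord0 ord0))%:E).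
Proof.
apply: (proj1 (@plane_integral_pairing (weight 1) 1 _ _)).
  exact: measurable_weight.
by move=> t; rewrite mul1r ger0_norm ?weight_ge0.
Qed.

End plane_fubini.

Section sphere.
Context {R : realType}.
Local Notation leb := (@lebesgue_measure R).
Local Notation vol := (@lebesgue_cV R).
Local Open Scope ereal_scope.

Lemma sphere_measureT n : sphere_measure n [set: 'cV[R]_n] = 1.
Proof.
rewrite /sphere_measure preimage_setT setIT.
have := vol_ball_gt0 (R := R) n; have := vol_ball_lty (R := R) n.
case: (vol n _) => // r _; rewrite lte_fin => r0 /=.
by rewrite -EFinM mulVf// gt_eqF.
Qed.

Lemma sphere_measure_fin n : fin_num_fun (@sphere_measure R n).
Proof.
move=> A mA; rewrite ge0_fin_numE//.
apply: (@le_lt_trans _ _ (sphere_measure n [set: 'cV[R]_n])).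
  by apply: le_measure; rewrite ?inE//; exact: measurableT.
by rewrite sphere_measureT ltry.
Qed.

HB.instance Definition _ n :=
  Measure_isFinite.Build _ _ _ (@sphere_measure R n) (@sphere_measure_fin n).

Lemma direction_le1 n (x : 'cV[R]_n) : (euclid_norm (direction x) <= 1)%R.
Proof.
rewrite /direction euclid_normZ ger0_norm ?invr_ge0 ?euclid_norm_ge0//.
have [->|x0] := eqVneq (euclid_norm x) 0%R; first by rewrite mulr0.
by rewrite mulVf.
Qed.

Lemma directionN n (x : 'cV[R]_n) : direction (- x) = (- direction x)%R.
Proof. by rewrite /direction euclid_normN scalerN. Qed.

Lemma sphere_measureN n (A : set 'cV[R]_n) : measurable A ->
  sphere_measure n ((fun x => (- x)%R) @^-1` A) = sphere_measure n A.
Proof.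
move=> mA; rewrite /sphere_measure; congr (_ * _).
pose D := unit_ball n `&` @direction R n @^-1` A.
have mD : measurable D.
  apply: measurableI; first exact: measurable_unit_ball.
  by rewrite -[X in measurable X]setTI; exact: measurable_direction.
have [mN _ N] := @transports_opp R n.
have mI : measurable_fun setT (fun x => (\1_D x : R)%:E).
  by apply/measurable_EFinP; exact: measurable_indic.
have I0 x : 0 <= (\1_D x : R)%:E by rewrite lee_fin.
have := N _ mI I0; rewrite mul1e (integral_indic _ measurableT mD) setIT => <-.
rewrite -[X in vol n X]setIT -integral_indic//; last first.
  apply: measurableI; first exact: measurable_unit_ball.
  rewrite -[X in measurable X]setTI; apply: measurable_direction => //.
  by rewrite -[X in measurable X]setTI; exact: mN.
apply: eq_integral => x _; rewrite !indicE; congr (_%:R%:E).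
congr nat_of_bool; apply/idP/idP; rewrite !inE /D /unit_ball /= euclid_normN directionN//.
Qed.

Lemma transports_sphere_opp n :
  transports (@sphere_measure R n) (@sphere_measure R n) (fun x => (- x)%R) 1.
Proof.
have [mN _ _] := @transports_opp R n.
split => // F mF F0; rewrite mul1e.
pose nu := measure_function_pushforward__canonical__measure_function_Measure
  (@sphere_measure R n) mN.
rewrite [in RHS](eq_measure_integral nu); last first.
  by move=> A mA _; exact/esym/sphere_measureN.
by rewrite ge0_integral_pushforward.
Qed.

(** The measure is carried by the values of [direction]. An inequality is stated because it holds
    for all of them: the direction of 0 is 0. *)
Lemma ae_sphere n : {ae @sphere_measure R n, forall x, (euclid_norm x <= 1)%R}.
Proof.
exists [set x | (1 < euclid_norm x)%R]; split.
- rewrite (_ : [set x | _] = setT `&` @euclid_norm R n @^-1` `]1%R, +oo[%classic).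
    exact: measurable_euclid_norm.
  by rewrite setTI; apply/seteqP; split => x /=; rewrite in_itv/= andbT.
- rewrite /sphere_measure (_ : _ `&` _ = set0) ?measure0 ?mule0//.
  by rewrite -subset0 => x [_ /=]; rewrite ltNge direction_le1.
by move=> x /= /negP; rewrite -ltNge.
Qed.

Lemma ae_product d1 d2 (T1 : measurableType d1) (T2 : measurableType d2)
    (m1 : {measure set T1 -> \bar R}) (m2 : {sigma_finite_measure set T2 -> \bar R})
    (P : T1 * T2 -> Prop) :
  {ae (m1 \x m2), forall z, P z} -> {ae m1, forall x, {ae m2, forall y, P (x, y)}}.
Proof.
move=> [N [mN N0 PN]].
have mx : measurable_fun setT (m2 \o xsection N) by exact: measurable_fun_xsection.
have : ae_eq m1 setT (m2 \o xsection N) (cst 0).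
  apply/(ae_eq_integral_abs m1 measurableT mx); rewrite -[RHS]N0.
  by apply: eq_integral => x _; rewrite gee0_abs.
apply: filterS => x /(_ I) /= x0; exists (xsection N x); split => //.
  exact: measurable_xsection.
by move=> y /= nP; rewrite /xsection /= inE; exact: PN.
Qed.

(** The surface measure of a set is a positive multiple of the volume of the cone over it in the
    ball, so null sets pull back to null sets. *)
Lemma ae_direction n (P : 'cV[R]_n -> Prop) :
  {ae @sphere_measure R n, forall x, P x} ->
  {ae vol n, forall x, unit_ball n x -> P (direction x)}.
Proof.
move=> [N [mN N0 PN]].
exists (unit_ball n `&` @direction R n @^-1` N); split.
- apply: measurableI; first exact: measurable_unit_ball.
  by rewrite -[X in measurable X]setTI; exact: measurable_direction.
- move: N0; rewrite /sphere_measure => /eqP; rewrite mule_eq0 => /orP[|/eqP//].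
  have := vol_ball_gt0 (R := R) n; have := vol_ball_lty (R := R) n.
  case: (vol n _) => // r _; rewrite lte_fin => r0 /=.
  by rewrite eqe invr_eq0 gt_eqF.
by move=> x /= /not_implyP[xb nP]; split => //=; exact: PN.
Qed.

End sphere.

(** * The Gamma factor and the kernels of the mean transform *)

Section gamma.
Context {R : realType}.
Local Notation leb := (@lebesgue_measure R).

Let integrand (a x : R) := x `^ (a - 1) * expR (- x) * \1_(`]0, +oo[) x.

Let measurable_integrand a : measurable_fun setT (integrand a).
Proof.
apply: measurable_funM; last exact: measurable_indic.
apply: measurable_funM; first exact: measurable_powR.
by apply: (measurableT_comp (continuous_measurable_fun (@continuous_expR R))); exact: measurable_funN.
Qed.

Let integrand_ge0 a x : 0 <= integrand a x.
Proof. by rewrite !mulr_ge0 ?powR_ge0 ?expR_ge0. Qed.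

Let integrable_integrand a : 0 < a -> leb.-integrable setT (EFin \o integrand a).
Proof.
move=> a0; pose N := (Num.truncn (a + 1)).+1.
(* From expR (- x) <= N! x^(-N) and a - 1 <= N - 2, the integrand is at most N! x^(-2) for x > 1. *)
have aN : a + 1 <= N%:R by rewrite ltW// truncnS_gt.
have i1 : leb.-integrable setT (fun t : R => ((t `^ (a - 1)) * \1_(`[0, 1]) t)%:E).
  by apply: integrable_le1_powR; lra.
have i2 : leb.-integrable setT (fun t : R => ((t `^ (- 2)) * \1_(`[1, +oo[) t)%:E).
  by apply: integrable_ge1_powR; lra.
have i3 := integrableD measurableT i1 (integrableZl measurableT (N`!%:R) i2).
apply: le_integrable i3 => //.
  by apply/measurable_EFinP; exact: measurable_integrand.
move=> x _; rewrite /= lee_fin ger0_norm ?integrand_ge0//; apply: le_trans (ler_norm _).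
rewrite /integrand !indicE.
have [x0|] := boolP (x \in `]0, +oo[%classic); last first.
  by move=> _; rewrite mulr0; apply: addr_ge0; do ?apply: mulr_ge0; rewrite ?powR_ge0.
move: x0; rewrite inE/= in_itv/= andbT mulr1 => x0.
have [x1|x1] := leP x 1.
  rewrite (_ : (x \in `[0, 1]%classic) = true); last by rewrite mem_set//= in_itv/= (ltW x0).
  rewrite mulr1 (@le_trans _ _ (x `^ (a - 1)))//.
    by rewrite ler_piMr ?powR_ge0// -expR0 ler_expR oppr_le0 ltW.
  by rewrite lerDl mulr_ge0// mulr_ge0// powR_ge0.
rewrite (_ : (x \in `[1, +oo[%classic) = true); last by rewrite mem_set//= in_itv/= andbT ltW.
rewrite mulr1 (@le_trans _ _ (N`!%:R * x `^ (- 2)))//; last first.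
  by rewrite lerDr mulr_ge0// powR_ge0.
have h1 : expR (- x) <= N`!%:R * x `^ (- N%:R).
  rewrite expRN powRN powR_mulrn ?(ltW x0)// -[leRHS]invrK lef_pV2 ?posrE ?expR_gt0//; last first.
    by rewrite invr_gt0 mulr_gt0 ?ltr0n ?fact_gt0// invr_gt0 exprn_gt0.
  rewrite invfM invrK mulrC (le_trans _ (expR_ge1Dxn N.-1 (ltW x0)))//=.
  by rewrite lerDr.
have h2 : x `^ (a - 1) <= x `^ (N%:R - 2) by apply: ler_powR; [exact: ltW|lra].
rewrite (le_trans (ler_pM _ _ h2 h1)) ?powR_ge0 ?expR_ge0// mulrCA -powRD.
  by rewrite addrAC subrr add0r.
by apply/implyP => _; rewrite gt_eqF.
Qed.

(** A divergent real-valued integral would be 0 by default, so positivity rests on the convergence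
    proved above as well as on the lower bound from [1, 2]. *)
Lemma Gamma_gt0 (a : R) : 0 < a -> 0 < Gamma a.
Proof.
move=> a0.
have -> : Gamma a = \int[leb]_x integrand a x.
  rewrite /Gamma Rintegral_mkcond; apply: eq_Rintegral => x _.
  by rewrite patchE /integrand indicE; case: ifP => _; rewrite ?mulr1 ?mulr0.
pose c : R := 2 `^ (- `|a - 1|) * expR (- 2).
have c0 : 0 < c by rewrite mulr_gt0 ?powR_gt0 ?expR_gt0.
have iI := integrable_indic_itv (1 : R) 2 true false.
have i1 := integrableZl measurableT c iI.
apply: (@lt_le_trans _ _ (\int[leb]_x (c * \1_(`[1, 2]) x))).
  rewrite RintegralZl//.
  rewrite /Rintegral integral_indic//= setIT lebesgue_measure_itv/= lte_fin ltr1n/=.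
  by rewrite mulr_gt0// subr_gt0 ltr1n.
apply: le_Rintegral => //.
  exact: integrable_integrand.
move=> x _; rewrite [in leLHS]indicE.
have [|_] := boolP (x \in `[1, 2]%classic); last by rewrite mulr0.
rewrite inE/= in_itv/= mulr1 => /andP[x1 x2].
rewrite /integrand indicE mem_set ?mulr1/=; last by rewrite in_itv/= andbT; lra.
apply: ler_pM; rewrite ?powR_ge0 ?expR_ge0// ?ler_expR ?lerN2//.
apply: (@le_trans _ _ (x `^ (- `|a - 1|))).
  rewrite !powRN lef_pV2 ?posrE ?powR_gt0//; last lra.
  by apply: ge0_ler_powR; rewrite ?nnegrE//; lra.
by apply: ler_powR => //; rewrite lerNl -normrN ler_norm.
Qed.

End gamma.

Section kernels.
Context {R : realType}.
Local Notation leb := (@lebesgue_measure R).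
Local Notation vol := (@lebesgue_cV R).

Lemma integrable_cube n (c : R) : 0 <= c ->
  (vol n).-integrable setT (fun y => (\1_(cube n c) y : R)%:E).
Proof.
move=> c0; have mC := @measurable_cube R n c.
apply/integrableP; split; first by apply/measurable_EFinP; exact: measurable_indic.
under eq_integral do rewrite gee0_abs ?lee_fin//.
rewrite integral_indic// setIT; apply: le_lt_trans (ltry ((c *+ 2) ^+ n)).
by rewrite -(vol_cube n c0).
Qed.

Lemma Rintegral_cube n (c : R) : 0 <= c ->
  \int[vol n]_y (\1_(cube n c) y : R) = (c *+ 2) ^+ n.
Proof.
move=> c0; have mC := @measurable_cube R n c.
rewrite /Rintegral integral_indic// setIT.
exact: (congr1 fine (vol_cube n c0)).
Qed.

Lemma euclid_norm1 (y : 'cV[R]_1) : euclid_norm y = `|y ord0 ord0|.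
Proof. by rewrite /euclid_norm big_ord1 sqrtr_sqr. Qed.

(** The unnormalized kernel: the Gamma factor of the mean transform is positive, so both means
    vanish at the same points. *)
Definition ball_kernel (alpha : R) (y : 'cV[R]_1) : R :=
  \1_(unit_ball 1) y * (1 - euclid_norm y ^+ 2) `^ (alpha - 1).

Lemma ball_kernel_ge0 alpha y : 0 <= ball_kernel alpha y.
Proof. by rewrite mulr_ge0 ?powR_ge0. Qed.

Lemma ball_kernel_supp alpha y : ball_kernel alpha y != 0 -> `|y ord0 ord0| <= 1.
Proof.
rewrite mulf_eq0 => /norP[+ _]; rewrite indicE; case: (boolP (y \in _)) => [|_].
  by rewrite inE /unit_ball /= euclid_norm1 => /ltW.
by rewrite eqxx.
Qed.

Lemma ball_kernelN alpha y : ball_kernel alpha (- y) = ball_kernel alpha y.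
Proof.
rewrite /ball_kernel euclid_normN; congr (_ * _); rewrite !indicE; congr (_%:R).
by congr nat_of_bool; apply/idP/idP; rewrite !inE /unit_ball /= euclid_normN.
Qed.

Lemma measurable_ball_kernel alpha : measurable_fun setT (ball_kernel alpha).
Proof.
apply: measurable_funM; first by apply: measurable_indic; exact: measurable_unit_ball.
apply: (measurableT_comp (measurable_powR _)).
by apply: measurable_funB => //; apply: measurable_funX; exact: measurable_euclid_norm.
Qed.

(** For alpha >= 1 the kernel is at most 1. For alpha < 1 it is at most (1 - |t|)^(alpha - 1), since
    1 - t^2 >= 1 - |t|; [H], shifted and reflected, is this power placed at the two endpoints. *)
Lemma integrable_ball_kernel alpha : 0 < alpha ->
  (vol 1).-integrable setT (EFin \o ball_kernel alpha).
Proof.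
move=> a0; pose H (u : R) := u `^ (alpha - 1) * \1_(`[0, 1]) u.
have iH : leb.-integrable setT (EFin \o H) by apply: integrable_le1_powR; lra.
have iH1 := transports_integrable (transports_shift_line (1 : R)) iH.
have iH2 := transports_integrable (@transports_opp_line R) iH1.
have iI := integrable_indic_itv (-1 : R) 1 false true.
have iS := integrableD measurableT iI (integrableD measurableT iH1 iH2).
pose g (t : R) := \1_(`]-1, 1[) t + (H (t + 1) + H (- t + 1)).
have [iP _] := @integral_prod_cV R 1 (fun=> g) (fun=> iS).
apply: le_integrable iP => //.
  by apply/measurable_EFinP; exact: measurable_ball_kernel.
move=> y _; rewrite /= lee_fin ger0_norm ?ball_kernel_ge0//.
rewrite big_ord1 (le_trans _ (ler_norm _))// /ball_kernel euclid_norm1.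
set t := y ord0 ord0.
have H0 u : 0 <= H u by rewrite mulr_ge0 ?powR_ge0.
rewrite indicE; have [|_] := boolP (y \in _); last first.
  by rewrite mul0r /g !addr_ge0.
rewrite inE /unit_ball /= euclid_norm1 -/t mul1r => t1.
rewrite /g indicE mem_set/=; last by rewrite in_itv/= -ltr_norml.
have t0 := normr_ge0 t.
have u0 : 0 < 1 - `|t| ^+ 2 by nra.
have [a1|a1] := leP 1 alpha.
  rewrite -[leLHS]addr0 lerD ?addr_ge0//.
  apply: (@le_trans _ _ (1 `^ (alpha - 1))); last by rewrite powR1.
  apply: ge0_ler_powR; rewrite ?nnegrE; [lra|exact: ltW|by []|].
  by rewrite gerBl sqr_ge0.
have key : (1 - `|t| ^+ 2) `^ (alpha - 1) <= (1 - `|t|) `^ (alpha - 1).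
  have w0 : 0 < 1 - `|t| by lra.
  rewrite -(opprB 1 alpha) !powRN lef_pV2 ?posrE ?powR_gt0//.
  apply: ge0_ler_powR; rewrite ?nnegrE; [lra|lra|exact: ltW|].
  by rewrite lerD2l lerN2; nra.
apply: (le_trans key); rewrite (@le_trans _ _ (H (t + 1) + H (- t + 1)))//; last first.
  by rewrite lerDr.
have [t00|t00] := leP 0 t.
  apply: (@le_trans _ _ (H (- t + 1))); last by rewrite lerDr.
  rewrite /H indicE mem_set ?mulr1/=; last first.
    by move: t1; rewrite in_itv/= ger0_norm// => t1; apply/andP; split; lra.
  by rewrite ger0_norm// addrC.
apply: (@le_trans _ _ (H (t + 1))); last by rewrite lerDl.
rewrite /H indicE mem_set ?mulr1/=; last first.
  by move: t1; rewrite in_itv/= ltr0_norm// => t1; apply/andP; split; lra.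
by rewrite ltr0_norm// opprK addrC.
Qed.

Lemma ball_kernel_mass alpha : 0 < alpha -> 0 < mass (vol 1) (ball_kernel alpha).
Proof.
(* For |t| < 1/2 the base 1 - t^2 lies between 3/4 and 1, so its power alpha - 1 is at least its
   power |alpha - 1|, whatever the sign of alpha - 1. *)
move=> a0; pose c : R := (3 / 4) `^ `|alpha - 1|.
have c0 : 0 < c by rewrite powR_gt0; lra.
have h0 : 0 <= 2^-1 :> R by rewrite invr_ge0.
have ic := integrableZl measurableT c (integrable_cube 1 h0).
apply: (@lt_le_trans _ _ (\int[vol 1]_y (c * \1_(cube 1 2^-1) y))).
  rewrite RintegralZl//; last exact: integrable_cube.
  by rewrite mulr_gt0// Rintegral_cube// exprn_gt0// mulrn_wgt0// invr_gt0.
apply: le_Rintegral => //.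
  exact: integrable_ball_kernel.
move=> y _; rewrite [in leLHS]indicE; have [|_] := boolP (y \in cube 1 2^-1); last first.
  by rewrite mulr0 ball_kernel_ge0.
rewrite inE => /(_ ord0) y2; rewrite mulr1 /ball_kernel indicE mem_set ?mul1r; last first.
  by rewrite /unit_ball /= euclid_norm1 (lt_trans y2)// invf_lt1// ltr1n.
rewrite euclid_norm1; set t := `|_| in y2 *; have t0 : 0 <= t by exact: normr_ge0.
have u34 : 3 / 4 <= 1 - t ^+ 2.
  have : t * t <= 2^-1 * 2^-1 by rewrite ler_pM// ltW.
  by rewrite expr2; lra.
have u1 : 1 - t ^+ 2 <= 1 by rewrite gerBl sqr_ge0.
apply: (@le_trans _ _ ((1 - t ^+ 2) `^ `|alpha - 1|)).
  by apply: ge0_ler_powR; rewrite ?nnegrE//; lra.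
by apply: ger_powR; [apply/andP; split; lra|exact: ler_norm].
Qed.

(* The sphere measure lives on the unit sphere; the constant kernel 1 is cut off
   because the convolution lemmas want kernels vanishing off [-1, 1]. *)
Definition sphere_kernel (y : 'cV[R]_1) : R := \1_(`[0, 1]) (euclid_norm y).

Lemma odd_Rintegral0 (nu : {measure set 'cV[R]_1 -> \bar R}) (g : 'cV[R]_1 -> R) :
  transports nu nu (fun x => - x) 1 -> nu.-integrable setT (EFin \o g) ->
  (forall y, g (- y) = - g y) -> \int[nu]_y g y = 0.
Proof.
move=> tN ig gN; have E := transports_integral tN ig.
have : \int[nu]_y g y = - \int[nu]_y g y.
  rewrite -mulN1r -RintegralZl// {1}/Rintegral -[X in fine X]mul1e -E.
  by congr fine; apply: eq_integral => y _; rewrite /= gN mulN1r.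
by lra.
Qed.

Lemma kernel_sin0 (nu : {measure set 'cV[R]_1 -> \bar R}) (om : 'cV[R]_1 -> R) rho a :
  transports nu nu (fun x => - x) 1 -> nu.-integrable setT (EFin \o om) ->
  (forall y, om (- y) = om y) ->
  \int[nu]_y (om y * sin (a * (rho * y ord0 ord0))) = 0.
Proof.
move=> tN iom omN.
have mom : measurable_fun setT om by apply/measurable_EFinP; exact: measurable_int iom.
apply: odd_Rintegral0 => //; last first.
  by move=> y; rewrite omN mxE !mulrN sinN mulrN.
apply: le_integrable iom => //.
  apply/measurable_EFinP/measurable_funM => //.
  apply: (measurableT_comp (continuous_measurable_fun (@continuous_sin R))).
  apply: measurable_funM => //; apply: measurable_funM => //.
  exact: measurable_mx_entry.
by move=> y _; rewrite lee_fin normrM ler_piMr// sin_max.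
Qed.

End kernels.

Section mean_transform_kernel.
Context {R : realType} (k : nat).
Local Notation vol := (@lebesgue_cV R).
Variables (alpha rho : R) (f : 'cV[R]_k.+2 -> R) (v : 'cV[R]_k.+2).
Hypothesis alpha0 : 0 <= alpha.
Hypothesis rho0 : 0 < rho.
Hypothesis mf : measurable_fun setT f.
Hypothesis sv : stiefel k.+2 1 v.
Hypothesis fi : (vol k.+2).-integrable setT (fun x => (f x * weight 1 (dot v x))%:E).
Hypothesis mean0 : {ae vol 1, forall t, mean_transform alpha rho f v t = 0%E}.

Let q : 'M[R]_(k.+2, k.+1) := perp_frame v.
Let qq : q^T *m q = 1%:M. Proof. by have [] := stiefel_frame sv. Qed.
Let vq : v^T *m q = 0. Proof. by have [] := stiefel_frame sv. Qed.
Let phi := plane_integral v q f.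

Let mphi : measurable_fun setT phi.
Proof. exact: measurable_plane_integral. Qed.

Let iphi : (vol 1).-integrable setT (fun t => phi t * (weight 1 (t ord0 ord0))%:E)%E.
Proof. exact: integrable_plane_integral. Qed.

Let pairing (F : R -> R) (S B V b : R) : 0 <= B -> L1_variation F S B V ->
  (\int[vol 1]_t (phi t * (cos_transform F (t ord0 ord0 - b))%:E) = 0)%E ->
  (\int[vol k.+2]_x (f x * cos_transform F (dot v x - b))%:E = 0)%E.
Proof.
move=> B0 bF; have [|_ <- //] := plane_integral_pairing sv qq vq mf fi
  (psi := fun t => cos_transform F (t - b)) _
  (fun t => transform_shift_bound b t B0 bF).
apply: (measurableT_comp (measurable_cos_transform bF)).
by apply: measurable_funB.
Qed.

Let measurable_kernel_slice (om : 'cV[R]_1 -> R) t : measurable_fun setT om ->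
  measurable_fun setT (fun y => ((om y)%:E * phi (t - rho *: y))%E).
Proof.
move=> mom; apply: emeasurable_funM; first exact/measurable_EFinP.
apply: (measurableT_comp mphi); apply: measurable_subrmx; first exact: measurable_cst.
by apply: measurable_scalemx; [exact: measurable_cst|exact: measurable_id].
Qed.

Let measurable_sphere_kernel : measurable_fun setT (@sphere_kernel R).
Proof.
apply: (measurableT_comp (f := \1_(`[0, 1]) : R -> R)); last exact: measurable_euclid_norm.
exact: measurable_indic.
Qed.

Let sphere_kernel1 (y : 'cV[R]_1) : euclid_norm y <= 1 -> sphere_kernel y = 1.
Proof.
by move=> y1; rewrite /sphere_kernel indicE mem_set//= in_itv/= euclid_norm_ge0.
Qed.

Let integrable_sphere_kernel :
  (@sphere_measure R 1).-integrable setT (EFin \o @sphere_kernel R).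
Proof.
apply: le_integrable (finite_measure_integrable_cst (@sphere_measure R 1) 1 measurableT) => //.
  by apply/measurable_EFinP; exact: measurable_sphere_kernel.
move=> y _ /=; rewrite lee_fin normr1 ger0_norm /sphere_kernel indicE//.
by case: (_ \in _).
Qed.

Let sphere_kernel_mass : 0 < mass (@sphere_measure R 1) (@sphere_kernel R).
Proof.
rewrite /mass /Rintegral (ae_eq_integral (cst 1%E)) //.
- have -> : (\int[@sphere_measure R 1]_y (cst 1 y) = 1)%E.
    by rewrite integral_cst// mul1e; exact: sphere_measureT.
  exact: ltr01.
- by apply/measurable_EFinP; exact: measurable_sphere_kernel.
by apply: filterS (@ae_sphere R 1) => y y1 _; rewrite sphere_kernel1.
Qed.

(** Both cases are deconvolutions by an even nonnegative kernel of positive mass supported in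
    [-1, 1]: [sphere_kernel] against the surface measure for alpha = 0, [ball_kernel] against
    Lebesgue measure for alpha > 0. *)
Lemma mean_transform_annihilates (F : R -> R) (S B V b : R) : 0 <= B ->
  L1_variation F S B V ->
  (\int[vol k.+2]_x (f x * cos_transform F (dot v x - b))%:E = 0)%E.
Proof.
move=> B0 bF; apply: (pairing B0 bF).
have [a0|a0] := eqVneq alpha 0.
  have tN := @transports_sphere_opp R 1.
  have sN (y : 'cV[R]_1) : sphere_kernel (- y) = sphere_kernel y.
    by rewrite /sphere_kernel euclid_normN.
  have s1 (y : 'cV[R]_1) : sphere_kernel y != 0 -> `|y ord0 ord0| <= 1.
    rewrite /sphere_kernel indicE euclid_norm1; case: (boolP (_ \in _)); last by rewrite eqxx.
    by rewrite inE/= in_itv/= => /andP[].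
  apply: (@deconvolution R (@sphere_measure R 1) (@sphere_kernel R) rho _
    integrable_sphere_kernel s1 sphere_kernel_mass _ rho0 phi mphi iphi _ F S B V b B0 bF).
  - by move=> y; rewrite /sphere_kernel.
  - by move=> a; exact: kernel_sin0.
  apply: filterS mean0 => t; rewrite /mean_transform a0 eqxx => E.
  rewrite -[RHS]E; apply: ae_eq_integral => //.
  - exact: measurable_kernel_slice.
  - have := measurable_kernel_slice t (@measurable_cst _ _ _ _ setT (1 : R)).
    by under eq_fun do rewrite mul1e.
  by apply: filterS (@ae_sphere R 1) => y y1 _; rewrite sphere_kernel1// mul1e.
have ap : 0 < alpha by rewrite lt_def a0.
have tN := @transports_opp R 1.
apply: (@deconvolution R (vol 1) (ball_kernel alpha) rho (@ball_kernel_ge0 R alpha)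
  (integrable_ball_kernel ap) (@ball_kernel_supp R alpha) (ball_kernel_mass ap) _
  rho0 phi mphi iphi _ F S B V b B0 bF).
  move=> a; apply: kernel_sin0 => //; first exact: integrable_ball_kernel.
  exact: ball_kernelN.
apply: filterS mean0 => t; rewrite /mean_transform (negbTE a0) => /eqP.
rewrite mule_eq0 => /orP[|/eqP E].
  rewrite eqe gt_eqF// divr_gt0 ?Gamma_gt0 ?addr_gt0// mulr_gt0 ?Gamma_gt0//.
  by rewrite powR_gt0 ?pi_gt0.
rewrite -[RHS]E [RHS]integral_mkcond; apply: eq_integral => y _.
rewrite patchE /ball_kernel indicE; case: ifPn => _; last by rewrite mul0r mul0e.
by rewrite mul1r.
Qed.

End mean_transform_kernel.

(** * Averaging over the direction *)

Section tent.
Context {R : realType}.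
Local Notation leb := (@lebesgue_measure R).

Definition bounded_lipschitz (F : R -> R) (S L : R) :=
  (forall r, `|F r| <= S) /\ (forall r u, `|F r - F u| <= L * `|r - u|).

Lemma bounded_lipschitzM F G S L S' L' :
  bounded_lipschitz F S L -> bounded_lipschitz G S' L' ->
  bounded_lipschitz (fun r => F r * G r) (S * S') (S * L' + S' * L).
Proof.
move=> [FS FL] [GS GL]; split=> [r|r u]; first by rewrite normrM ler_pM.
have S0 : 0 <= S by exact: le_trans (FS 0).
have S'0 : 0 <= S' by exact: le_trans (GS 0).
rewrite (_ : _ - _ = F r * (G r - G u) + G u * (F r - F u)); last by ring.
apply: le_trans (ler_normD _ _) _; rewrite mulrDl.
by apply: lerD; rewrite normrM -mulrA ler_pM.
Qed.

Lemma bounded_lipschitz_prod n (F : 'I_n -> R -> R) L :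
  (forall i, bounded_lipschitz (F i) 1 L) ->
  bounded_lipschitz (fun r => \prod_(i < n) F i r) 1 (L *+ n).
Proof.
elim: n => [|n IH] in F * => FL.
  by split=> [r|r u]; rewrite !big_ord0 ?normr1// subrr normr0 mul0r.
have := bounded_lipschitzM (FL ord0) (IH _ (fun i => FL (lift ord0 i))).
rewrite !mul1r mulrSr => -[h1 h2].
by split=> [r|r u]; rewrite !big_ord_recl; [exact: h1|exact: h2].
Qed.

Lemma bounded_lipschitz_scale F S L c :
  bounded_lipschitz F S L -> bounded_lipschitz (fun r => F (r * c)) S (L * `|c|).
Proof.
move=> [FS FL]; split=> [r|r u]; first exact: FS.
by rewrite -mulrA (le_trans (FL _ _))// -mulrBl normrM [`|c| * _]mulrC.
Qed.

Lemma bounded_lipschitz_shift F S L c :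
  bounded_lipschitz F S L -> bounded_lipschitz (fun r => F (r - c)) S L.
Proof.
move=> [FS FL]; split=> [r|r u]; first exact: FS.
by rewrite (le_trans (FL _ _))// opprB addrA subrK.
Qed.

Lemma bounded_lipschitz_le F S L L' : L <= L' ->
  bounded_lipschitz F S L -> bounded_lipschitz F S L'.
Proof.
move=> LL' [FS FL]; split=> // r u.
by rewrite (le_trans (FL _ _))// ler_wpM2r.
Qed.

Definition tent (r : R) : R := Num.max 0 (1 - `|r|).

Lemma tent_ge0 r : 0 <= tent r.
Proof. by rewrite le_max lexx. Qed.

Lemma tent_le1 r : tent r <= 1.
Proof. by rewrite ge_max ler01 gerBl normr_ge0. Qed.

Lemma tent_eq0 r : 1 <= `|r| -> tent r = 0.
Proof. by move=> r1; apply: max_l; rewrite subr_le0. Qed.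

Lemma tentN r : tent (- r) = tent r.
Proof. by rewrite /tent normrN. Qed.

Lemma bounded_lipschitz_tent : bounded_lipschitz tent 1 1.
Proof.
split=> [r|r u]; first by rewrite ger0_norm ?tent_ge0 ?tent_le1.
rewrite mul1r; have h1 : `|r| - `|u| <= `|r - u| by exact: lerB_dist.
have h2 : `|u| - `|r| <= `|r - u| by rewrite distrC lerB_dist.
have h3 := normr_ge0 (r - u).
rewrite /tent; case: (leP 0 (1 - `|r|)) => a; case: (leP 0 (1 - `|u|)) => b;
  rewrite ler_norml; apply/andP; split; lra.
Qed.

Lemma measurable_tent : measurable_fun setT tent.
Proof.
apply: measurable_maxr; first exact: measurable_cst.
by apply: measurable_funB => //; exact: measurableT_comp.
Qed.

End tent.

(** * Probes: the test profiles attached to the directions w *)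

Section probe.
Context {R : realType} (n : nat) (beta : R).
Hypothesis beta0 : 0 < beta.
Local Notation leb := (@lebesgue_measure R).
Local Notation vol := (@lebesgue_cV R).

Definition tent_prod (z : 'cV[R]_n.+1) : R :=
  \prod_(i < n.+1) tent (z i ord0 * beta^-1).

Definition probe_radius : R := beta *+ n.+1.

(** Centred at 2M with half-width M = [probe_radius], hence supported in [M, 3M]: away from 0, where
    the factor |r|^(-n-1) of the substitution z = r w is singular. *)
Definition radial_tent (r : R) : R := tent ((r - probe_radius *+ 2) * probe_radius^-1).

(* probe_radius is the largest l1-norm on the cube of half-width beta, so that r w
   cannot lie in this cube for r > probe_radius unless w lies in the unit ball. *)
Definition probe (w : 'cV[R]_n.+1) (r : R) : R :=
  radial_tent r * tent_prod (r *: w).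

Lemma probe_radius_gt0 : 0 < probe_radius.
Proof. by rewrite mulrn_wgt0. Qed.

Lemma radial_tent_supp r : radial_tent r != 0 -> probe_radius < r < probe_radius *+ 3.
Proof.
have M0 := probe_radius_gt0; apply: contraR => h; apply/eqP/tent_eq0.
rewrite normrM [`|probe_radius^-1|]gtr0_norm ?invr_gt0// ler_pdivlMr// mul1r.
rewrite leNgt; apply: contra h; rewrite ltr_norml !mulr2n mulrSr mulr2n => /andP[h1 h2].
by apply/andP; split; lra.
Qed.

Lemma tent_prod_ge0 z : 0 <= tent_prod z.
Proof. by apply: prodr_ge0 => i _; exact: tent_ge0. Qed.

Lemma tent_prod_le1 z : tent_prod z <= 1.
Proof.
apply: (@le_trans _ _ (\prod_(i < n.+1) 1)); last by rewrite big1.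
by apply: ler_prod => i _; rewrite tent_ge0 tent_le1.
Qed.

Lemma tent_prod_supp z : tent_prod z != 0 -> cube n.+1 beta z.
Proof.
move=> z0 i; rewrite ltNge; apply: contra z0 => zi.
apply/eqP; rewrite /tent_prod (bigD1 i)//= tent_eq0 ?mul0r//.
by rewrite normrM [`|beta^-1|]gtr0_norm ?invr_gt0// ler_pdivlMr// mul1r.
Qed.

Lemma probe_supp w r : probe w r != 0 -> unit_ball n.+1 w.
Proof.
rewrite mulf_eq0 => /norP[/radial_tent_supp/andP[r1 _] /tent_prod_supp h].
have M0 := probe_radius_gt0; have r0 : 0 < r by exact: lt_trans r1.
apply: le_lt_trans (norm_le_sum _) _.
rewrite -(@ltr_pM2l _ r)// mulr1 mulr_sumr; apply: lt_trans r1.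
have -> : probe_radius = \sum_(i < n.+1) beta by rewrite sumr_const card_ord.
rewrite !big_ord_recl ltr_leD//.
  by have := h ord0; rewrite mxE normrM gtr0_norm.
apply: ler_sum => i _; apply: ltW.
by have := h (lift ord0 i); rewrite mxE normrM gtr0_norm.
Qed.

Lemma measurable_tent_prod : measurable_fun setT tent_prod.
Proof.
apply: measurable_prod => i _; apply: (measurableT_comp (@measurable_tent R)).
by apply: measurable_funM => //; exact: measurable_mx_entry.
Qed.

Lemma measurable_radial_tent : measurable_fun setT radial_tent.
Proof.
apply: (measurableT_comp (@measurable_tent R)).
by apply: measurable_funM => //; exact: measurable_funB.
Qed.

Definition probe_lip : R := probe_radius^-1 + beta^-1 *+ n.+1.

Lemma probe_lip_ge0 : 0 <= probe_lip.
Proof. by rewrite addr_ge0// ?mulrn_wge0// invr_ge0 ltW// probe_radius_gt0. Qed.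

(** The constant is the same for all w: in the ball the entries of w are at most 1 in absolute value
    and do not enlarge the Lipschitz constants of the tents in r w; off the ball the probe
    vanishes. *)
Lemma probe_lipschitz w : bounded_lipschitz (probe w) 1 probe_lip.
Proof.
have [wb|wb] := pselect (unit_ball n.+1 w); last first.
  have p0 r : probe w r = 0 by apply/eqP; apply: contrapT => /negP/probe_supp.
  by split=> [r|r u]; rewrite !p0 ?subrr normr0// mulr_ge0// probe_lip_ge0.
have h1 : bounded_lipschitz radial_tent 1 probe_radius^-1.
  have := bounded_lipschitz_shift (probe_radius *+ 2)
    (bounded_lipschitz_scale probe_radius^-1 (@bounded_lipschitz_tent R)).
  by rewrite mul1r (gtr0_norm (_ : 0 < probe_radius^-1)) ?invr_gt0 ?probe_radius_gt0.
have h2 : bounded_lipschitz (fun r => tent_prod (r *: w)) 1 (beta^-1 *+ n.+1).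
  apply: bounded_lipschitz_prod => i.
  have := bounded_lipschitz_scale (w i ord0 * beta^-1) (@bounded_lipschitz_tent R).
  rewrite mul1r => /(@bounded_lipschitz_le _ _ _ _ beta^-1) [].
    rewrite normrM [`|beta^-1|]gtr0_norm ?invr_gt0// ler_piMl ?invr_ge0 ?(ltW beta0)//.
    by rewrite (le_trans (entry_le_norm _ _))// ltW.
  by split=> [r|r u]; rewrite !mxE -!mulrA.
have [h3 h4] := bounded_lipschitzM h1 h2.
split=> [r|r u]; first by have := h3 r; rewrite mulr1.
by have := h4 r u; rewrite !mul1r /probe_lip [probe_radius^-1 + _]addrC.
Qed.

Lemma probe_out w r : probe_radius *+ 3 < `|r| -> probe w r = 0.
Proof.
have M0 := probe_radius_gt0.
move=> rM; apply/eqP; rewrite mulf_eq0; apply/orP; left.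
apply: contraTT rM => /radial_tent_supp/andP[r1 r2].
by rewrite -leNgt gtr0_norm ?(ltW r2)// (lt_trans _ r1).
Qed.

Lemma measurable_probe_comp d (T : measurableType d) (w : T -> 'cV[R]_n.+1) (r : T -> R) :
  measurable_fun setT w -> measurable_fun setT r ->
  measurable_fun setT (fun x => probe (w x) (r x)).
Proof.
move=> mw mr; apply: measurable_funM; first exact: (measurableT_comp measurable_radial_tent).
by apply: (measurableT_comp measurable_tent_prod); exact: measurable_scalemx.
Qed.

Definition probe_variation : R := probe_lip * (probe_radius *+ 3 + 1) *+ 2.

Lemma probe_L1_variation w :
  L1_variation (probe w) 1 (probe_radius *+ 3) probe_variation.
Proof.
have [h1 h2] := probe_lipschitz w.
apply: bv_lipschitz => //.
- by rewrite mulrn_wge0// ltW// probe_radius_gt0.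
- exact: probe_lip_ge0.
- apply: measurable_probe_comp; first exact: measurable_cst.
  exact: measurable_id.
- exact: probe_out.
Qed.

(** The deconvolution concerns unit vectors. With c = 1/|w|, the transform of this profile at v.x
    for v = w/|w| is the transform of [probe w] at w.x. The constants are not uniform as w -> 0, but
    w is fixed where they are used. *)
Lemma scaled_probe_L1_variation w (c : R) : 0 < c ->
  L1_variation (fun r => c * probe w (c * r)) c (c^-1 * (probe_radius *+ 3))
    (c * (probe_lip * c) * (c^-1 * (probe_radius *+ 3) + 1) *+ 2).
Proof.
move=> c0; have [h1 h2] := probe_lipschitz w.
apply: bv_lipschitz.
- by rewrite mulr_ge0 ?invr_ge0 ?(ltW c0)// mulrn_wge0// ltW// probe_radius_gt0.
- by rewrite !mulr_ge0 ?probe_lip_ge0 ?(ltW c0).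
- apply: measurable_funM => //.
  by apply: (@measurable_probe_comp _ _ (fun=> w)); [exact: measurable_cst|exact: measurable_funM].
- by move=> r; rewrite normrM (gtr0_norm c0) ler_piMr ?(ltW c0).
- move=> r; rewrite ltr_pdivrMl// => cr; rewrite probe_out ?mulr0//.
  by rewrite normrM (gtr0_norm c0).
move=> r u; rewrite -mulrBr normrM (gtr0_norm c0) -mulrA ler_wpM2l ?(ltW c0)//.
by rewrite (le_trans (h2 _ _))// -mulrBr normrM (gtr0_norm c0) mulrA.
Qed.

Lemma cos_transform_probe_scale w (c t : R) : 0 < c ->
  cos_transform (fun r => c * probe w (c * r)) t = cos_transform (probe w) (c^-1 * t).
Proof.
move=> c0; have c00 : c != 0 by rewrite gt_eqF.
have ip := bv_integrable_cos (probe_L1_variation w) (c^-1 * t).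
have := transports_integral (transports_scale_line c00) ip; rewrite gtr0_norm// => E.
have iq := transports_integrable (transports_scale_line c00) ip.
rewrite /cos_transform [RHS]/Rintegral -[X in fine X]mul1e -(divff c00) EFinM -muleA -E.
rewrite -integralZl//; congr fine; apply: eq_integral => r _.
rewrite -EFinM /=; congr EFin; rewrite -mulrA; congr (_ * (_ * cos _)).
by field.
Qed.

End probe.

Section probe_average.
Context {R : realType} {n : nat} (beta : R).
Hypothesis beta0 : 0 < beta.
Local Notation leb := (@lebesgue_measure R).
Local Notation vol := (@lebesgue_cV R).
Local Notation probe := (@probe R n beta).
Local Notation radius := (@probe_radius R n beta).

Definition tent_transform (y : 'cV[R]_n.+1) : R :=
  \int[vol n.+1]_z (tent_prod beta z * cos (dot z y)).

(** The power of |r| is the Jacobian of w = z/r in dimension n+1. *)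
Definition probe_mass : R :=
  \int[leb]_r (radial_tent n beta r * `|r| ^- n.+1).

Lemma integrable_tent_cos y :
  (vol n.+1).-integrable setT (fun z => (tent_prod beta z * cos (dot z y))%:E).
Proof.
apply: le_integrable (integrable_cube n.+1 (ltW beta0)) => //.
  apply/measurable_EFinP/measurable_funM; first exact: measurable_tent_prod.
  apply: (measurableT_comp (continuous_measurable_fun (@continuous_cos R))).
  apply: measurable_dot; first exact: measurable_id.
  exact: measurable_cst.
move=> z _; rewrite lee_fin normrM (ger0_norm (tent_prod_ge0 _ _)).
have [->|/(tent_prod_supp beta0) cz] := eqVneq (tent_prod beta z) 0; first by rewrite mul0r.
rewrite [X in _ <= X]ger0_norm// indicE mem_set//.
apply: (@le_trans _ _ (tent_prod beta z)); last exact: tent_prod_le1.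
by rewrite ler_piMr ?tent_prod_ge0// cos_max.
Qed.

Lemma radial_tent_ge0 r : 0 <= radial_tent n beta r.
Proof. exact: tent_ge0. Qed.

Lemma integrable_radial : leb.-integrable setT
  (fun r => (radial_tent n beta r * `|r| ^- n.+1)%:E).
Proof.
have M0 := @probe_radius_gt0 R n beta beta0.
apply: le_integrable (integrable_indic_itvcc (radius *+ 3) (radius ^- n.+1)) => //.
  apply/measurable_EFinP/measurable_funM; first exact: measurable_radial_tent.
  rewrite (_ : (fun r => _) = fun r : R => `|r| `^ (- n.+1%:R)).
    by apply: (measurableT_comp (measurable_powR _)); exact: (@normr_measurable R setT).
  by apply/funext => r; rewrite powRN powR_mulrn.
move=> r _; rewrite lee_fin.
have [->|/(radial_tent_supp beta0)/andP[r1 r2]] := eqVneq (radial_tent n beta r) 0.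
  by rewrite mul0r normr0.
have r0 : 0 < r by exact: lt_trans r1.
rewrite (gtr0_norm r0) ger0_norm; last first.
  by rewrite mulr_ge0 ?radial_tent_ge0// invr_ge0 exprn_ge0// ltW.
rewrite [X in _ <= X]ger0_norm; last by rewrite mulr_ge0// invr_ge0 exprn_ge0// ltW.
rewrite indicE mem_set; last first.
  by rewrite /= in_itv/=; apply/andP; split; [apply: le_trans (ltW r0)|exact: ltW];
     rewrite // oppr_le0 mulrn_wge0// ltW.
rewrite mulr1; apply: (@le_trans _ _ (r ^- n.+1)).
  by rewrite ler_piMl ?invr_ge0 ?exprn_ge0 ?(ltW r0)//; exact: tent_le1.
by rewrite lef_pV2 ?posrE ?exprn_gt0// lerXn2r ?nnegrE ?(ltW r0) ?(ltW M0)// ltW.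
Qed.

Lemma probe_mass_gt0 : 0 < probe_mass.
Proof.
have M0 := @probe_radius_gt0 R n beta beta0; set M := radius in M0.
(* Within M/2 of its centre 2M the tent is at least 1/2, and there r <= 3M. *)
pose c : R := 2^-1 * (M *+ 3) ^- n.+1.
have M3 : 0 < (M *+ 3) ^- n.+1 by rewrite invr_gt0 exprn_gt0// mulrn_wgt0.
have c0 : 0 < c by rewrite mulr_gt0// invr_gt0.
have iI := integrable_indic_itv (M *+ 2 - M / 2) (M *+ 2 + M / 2) true false (R := R).
have : c * (M *+ 2 + M / 2 - (M *+ 2 - M / 2)) <= probe_mass.
  rewrite -(@integral_itv_indic R (M *+ 2 - M / 2)); last lra.
  have iI' : leb.-integrable setT
    (EFin \o (\1_(`](M *+ 2 - M / 2), (M *+ 2 + M / 2)[) : R -> R)).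
    exact: integrable_indic_itv.
  rewrite -RintegralZl//; apply: le_Rintegral => //.
  - exact: (integrableZl measurableT c iI').
  - exact: integrable_radial.
  move=> r _; rewrite indicE; case: (boolP (r \in _)) => [|_]; last first.
    by rewrite mulr0 mulr_ge0 ?radial_tent_ge0// invr_ge0 exprn_ge0.
  rewrite inE /= in_itv/= ![M *+ 2]mulr2n => /andP[r1 r2]; rewrite mulr1.
  have r0 : 0 < r by lra.
  apply: ler_pM; [by []|exact: ltW| |].
    apply: (@le_trans _ _ (1 - `|(r - M *+ 2) * M^-1|)); last by rewrite le_max lexx orbT.
    rewrite normrM [`|_^-1|]gtr0_norm ?invr_gt0// -/M.
    have : `|r - M *+ 2| / M <= 2^-1.
      rewrite ler_pdivrMr// ler_norml [M *+ 2]mulr2n; apply/andP; split; lra.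
    by move: (_ / M) => q h; lra.
  rewrite (gtr0_norm r0) lef_pV2 ?posrE ?exprn_gt0 ?mulrn_wgt0//.
  have r3 : r <= M *+ 3 by rewrite (_ : M *+ 3 = M + M + M) ?mulrS ?mulr0n ?addr0 ?addrA//; lra.
  by rewrite lerXn2r// nnegrE ?(ltW r0)// mulrn_wge0// ltW.
by apply: lt_le_trans; rewrite mulr_gt0//; lra.
Qed.

(* Substituting z = r w turns the inner integral over w into |r|^-(n+1) times
   the transform of tent_prod, independently of r. *)
Lemma probe_average y : (\int[vol n.+1]_w
  (cos_transform (probe w) (dot w y))%:E = (probe_mass * tent_transform y)%:E)%E.
Proof.
have M0 := @probe_radius_gt0 R n beta beta0.
pose H (z : 'cV[R]_n.+1 * measurableTypeR R) : R := probe z.1 z.2 * cos (z.2 * dot z.1 y).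
have mH : measurable_fun setT H.
  apply: measurable_funM; first exact: (measurable_probe_comp _ measurable_fst measurable_snd).
  apply: (measurableT_comp (continuous_measurable_fun (@continuous_cos R))).
  apply: measurable_funM; first exact: measurable_snd.
  apply: measurable_dot; first exact: measurable_fst.
  exact: measurable_cst.
have mHE : measurable_fun setT (EFin \o H) by exact/measurable_EFinP.
have bP w : L1_variation (probe w) _ _ _ := probe_L1_variation beta0 w.
have iH : (vol n.+1 \x leb)%E.-integrable setT (EFin \o H).
  apply/(integrable12ltyP (vol n.+1) leb mHE) => /=.
  have iC := integrableZl measurableT (radius *+ 6) (@integrable_cube R n.+1 1 ler01).
  have /integrableP[_] := iC; apply: le_lt_trans.
  apply: ge0_le_integral => //.
  - by move=> x _; exact: integral_ge0.
  - exact: (measurable_fun_fubini_tonelli_F _ (measurable_abse_comp mHE)).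
  - exact: measurable_abse_comp (measurable_int _ iC).
  move=> w _; rewrite /H /=.
  have [wc|wc] := pselect (cube n.+1 1 w); last first.
    rewrite integral0_eq ?mule_ge0// => r _.
    have [->|/(probe_supp beta0)/unit_ball_cube//] := eqVneq (probe w r) 0.
    by rewrite mul0r normr0.
  have -> : `|radius *+ 6 * \1_(cube n.+1 1) w| = 1 * (radius *+ 3 *+ 2).
    rewrite indicE mem_set// mulr1 mul1r -(mulrnA radius 3 2) ger0_norm//.
    by rewrite mulrn_wge0// ltW.
  have M30 : 0 <= radius *+ 3 by exact/mulrn_wge0/ltW.
  rewrite -integral_indic_itvcc//.
  apply: ge0_le_integral => //.
  - exact: measurable_abse_comp (measurable_int _ (bv_integrable_cos (bP w) (dot w y))).
  - exact: measurable_int (integrable_indic_itvcc _ _).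
  move=> r _; rewrite lee_fin (le_trans _ (bv_le_indic (bP w) r))//.
  by rewrite normrM ler_piMr// cos_max.
transitivity (\int[vol n.+1]_w \int[leb]_r (EFin \o H) (w, r))%E.
  apply: eq_integral => w _; rewrite /cos_transform /Rintegral fineK//.
  exact: (integrable_fin_num measurableT (bv_integrable_cos (bP w) (dot w y))).
rewrite (Fubini iH).
rewrite (eq_integral (fun r : measurableTypeR R =>
  (tent_transform y)%:E * (radial_tent n beta r * `|r| ^- n.+1)%:E)%E).
  rewrite integralZl//; last exact: integrable_radial.
  rewrite mulrC EFinM; congr (_ * _)%E; rewrite /probe_mass /Rintegral fineK//.
  exact: (integrable_fin_num measurableT integrable_radial).
move=> r _.
(* Where the radial tent vanishes both sides are 0; elsewhere r > M > 0, so scaling by r is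
   invertible. *)
have [r00|rN0] := eqVneq (radial_tent n beta r) 0.
  by rewrite r00 mul0r mule0 integral0_eq// => w _; rewrite /H /= /probe r00 !mul0r.
have /andP[r1 _] := radial_tent_supp beta0 rN0.
have r0 : r != 0 by rewrite gt_eqF// (lt_trans _ r1).
have iz := integrable_tent_cos y.
have E := transports_integral (@transports_scale R n.+1 r r0) iz.
rewrite (eq_integral (fun w : 'cV[R]_n.+1 => (radial_tent n beta r)%:E *
    (tent_prod beta (r *: w) * cos (dot (r *: w) y))%:E)%E); last first.
  by move=> w _; rewrite -EFinM /H /= /probe dotZl mulrA.
rewrite integralZl//; last exact: (transports_integrable (@transports_scale R n.+1 r r0) iz).
rewrite E /tent_transform /Rintegral EFinM fineK; last exact: (integrable_fin_num measurableT iz).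
by rewrite [RHS]muleC -muleA.
Qed.

End probe_average.

Section tent_product.
Context {R : realType}.
Local Notation leb := (@lebesgue_measure R).
Local Notation vol := (@lebesgue_cV R).

Lemma measurable_sin_mul t : measurable_fun setT (fun r : R => sin (r * t)).
Proof.
apply: (measurableT_comp (continuous_measurable_fun (@continuous_sin R))).
exact: measurable_funM.
Qed.

Section even_factor.
Variable g : R -> R.
Hypothesis ig : leb.-integrable setT (EFin \o g).
Hypothesis gN : forall r, g (- r) = g r.

Let mg : measurable_fun setT g.
Proof. by apply/measurable_EFinP; exact: measurable_int ig. Qed.

Lemma integrable_mul_cos t : leb.-integrable setT (fun r => (g r * cos (r * t))%:E).
Proof.
apply: le_integrable ig => //.
  by apply/measurable_EFinP/measurable_funM => //; exact: measurable_cos_mul.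
by move=> r _; rewrite lee_fin normrM ler_piMr// cos_max.
Qed.

Lemma integrable_mul_sin t : leb.-integrable setT (fun r => (g r * sin (r * t))%:E).
Proof.
apply: le_integrable ig => //.
  by apply/measurable_EFinP/measurable_funM => //; exact: measurable_sin_mul.
by move=> r _; rewrite lee_fin normrM ler_piMr// sin_max.
Qed.

Lemma integral_mul_sin t : \int[leb]_r (g r * sin (r * t)) = 0.
Proof.
have iS := integrable_mul_sin t.
have := transports_integral (@transports_opp_line R) iS; rewrite mul1e => E.
suff : \int[leb]_r (g r * sin (r * t)) = - \int[leb]_r (g r * sin (r * t)) by lra.
rewrite -mulN1r -RintegralZl// [in LHS]/Rintegral -E.
by congr fine; apply: eq_integral => r _; rewrite gN mulNr sinN mulN1r mulrN.
Qed.

Lemma integrable_prod_cos n (y : 'cV[R]_n) th : (vol n).-integrable setT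
  (fun z => (\prod_(i < n) g (z i ord0) * cos (dot z y + th))%:E).
Proof.
have [iP _] := @integral_prod_cV R n (fun=> g) (fun=> ig).
apply: le_integrable iP => //.
  apply/measurable_EFinP/measurable_funM.
    by apply: measurable_prod => i _; apply: measurableT_comp mg _; exact: measurable_mx_entry.
  apply: (measurableT_comp (continuous_measurable_fun (@continuous_cos R))).
  apply: measurable_funD => //; apply: measurable_dot; first exact: measurable_id.
  exact: measurable_cst.
by move=> r _; rewrite lee_fin normrM ler_piMr// cos_max.
Qed.

(* The phase th makes the induction go through. *)
Lemma integral_prod_cos n (y : 'cV[R]_n) th :
  (\int[vol n]_z (\prod_(i < n) g (z i ord0) * cos (dot z y + th))%:E =
  (cos th * \prod_(i < n) cos_transform g (y i ord0))%:E)%E.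
Proof.
elim: n y th => [|n IH] y th.
  rewrite (eq_integral (cst (cos th)%:E)) => [|z _]; last first.
    by rewrite dotE !big_ord0 mul1r add0r.
  rewrite ge0_integral_cV0 ?big_ord0 ?mulr1//.
rewrite integral_cVS; last exact: integrable_prod_cos.
pose y' := @dsubmx _ 1 n 1 y; pose y0 := y ord0 ord0.
pose P := \prod_(i < n) cos_transform g (y' i ord0).
rewrite (eq_integral (fun a : measurableTypeR R =>
  (P * cos th)%:E * (g a * cos (a * y0))%:E - (P * sin th)%:E * (g a * sin (a * y0))%:E)%E).
  have ic := integrable_mul_cos y0; have is' := integrable_mul_sin y0.
  rewrite integralB//; [|exact: integrableZl|exact: integrableZl].
  rewrite !integralZl//.
  have -> : (\int[leb]_r (g r * sin (r * y0))%:E = 0)%E.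
    apply: etrans (congr1 EFin (integral_mul_sin y0)); rewrite /Rintegral fineK//.
    exact: (integrable_fin_num measurableT is').
  rewrite mule0 sube0 big_ord_recl.
  rewrite (_ : \prod_(i < n) _ = P); last first.
    by apply: eq_bigr => i _; rewrite -[y]cons_cV_eta cons_cVS.
  rewrite /cos_transform -/y0 /Rintegral [in RHS]mulrA [in RHS]mulrAC -[in RHS]mulrC.
  rewrite [P * _]mulrC [RHS]EFinM fineK 1?[RHS]muleC//.
  exact: (integrable_fin_num measurableT ic).
move=> a _.
transitivity (\int[vol n]_z ((g a)%:E * (\prod_(i < n) g (z i ord0) *
    cos (dot z y' + (a * y0 + th)))%:E))%E.
  apply: eq_integral => z _; rewrite -EFinM mulrA; congr ((_ * cos _)%:E).
    rewrite big_ord_recl cons_cV0; congr (_ * _).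
    by apply: eq_bigr => i _; rewrite cons_cVS.
  rewrite addrA !dotE big_ord_recl cons_cV0 [_ + a * _]addrC; congr (_ + _ + _).
  by apply: eq_bigr => i _; rewrite cons_cVS -[in LHS](cons_cV_eta y) cons_cVS.
rewrite integralZl//; last exact: integrable_prod_cos.
rewrite IH -!EFinM -EFinB; congr EFin; rewrite cosD -/P; ring.
Qed.

End even_factor.

Definition tent_factor (beta : R) (s : R) : R :=
  cos_transform (fun r => tent (r * beta^-1)) s.

Lemma integrable_tent_scale (beta : R) : 0 < beta ->
  leb.-integrable setT (EFin \o (fun r : R => tent (r * beta^-1))).
Proof.
move=> beta0; apply: le_integrable (integrable_indic_itvcc beta 1) => //.
  by apply/measurable_EFinP; apply: (measurableT_comp (@measurable_tent R)); exact: measurable_funM.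
move=> r _; rewrite lee_fin mul1r ger0_norm ?tent_ge0//.
have [rb|rb] := leP `|r| beta; last first.
  rewrite tent_eq0// normrM [`|_^-1|]gtr0_norm ?invr_gt0// ler_pdivlMr// mul1r.
  exact: ltW.
by rewrite indicE mem_set ?normr1 ?tent_le1//= in_itv/= -ler_norml.
Qed.

Lemma tent_transform_prod n (beta : R) (y : 'cV[R]_n.+1) : 0 < beta ->
  tent_transform beta y = \prod_(i < n.+1) tent_factor beta (y i ord0).
Proof.
move=> beta0.
have gN (r : R) : tent (- r * beta^-1) = tent (r * beta^-1) by rewrite mulNr tentN.
have := integral_prod_cos (integrable_tent_scale beta0) gN y 0.
rewrite cos0 mul1r => /(congr1 fine) /= <-.
by congr fine; apply: eq_integral => z _; rewrite addr0.
Qed.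

End tent_product.

(** * Fejer kernels and boxes *)

Section fejer_kernel.
Context {R : realType}.
Local Notation leb := (@lebesgue_measure R).

(** For nonzero s this is 2 (1 - cos s)/s^2, the square of sin(s/2)/(s/2): nonnegative and
    integrable, which is what makes its dilations an approximate identity. *)
Definition fejer (s : R) : R := cos_transform (@tent R) s.

Lemma tent_L1_variation : L1_variation (@tent R) 1 1 (1 * (1 + 1) *+ 2).
Proof.
have [h1 h2] := @bounded_lipschitz_tent R.
apply: bv_lipschitz => //; first exact: measurable_tent.
by move=> r r1; rewrite tent_eq0// ltW.
Qed.

Lemma integral_half_tent (s : R) : s != 0 ->
  (\int[leb]_(r in `[0%R, 1%R]) ((1 - r) * cos (r * s))%:E =
  ((1 - cos s) / s ^+ 2)%:E)%E.
Proof.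
move=> s0.
pose F (r : R) := (1 - r) * (s^-1 * sin (r * s)) - s^-1 ^+ 2 * cos (r * s).
have dF (r : R) : is_derive r 1 F ((1 - r) * cos (r * s)).
  apply: is_derive_eq; rewrite /GRing.scale /=.
  by field.
have cF (r : R) : {for r, continuous F}.
  by apply: differentiable_continuous; apply/derivable1_diffP.
rewrite (@continuous_FTC2 _ (fun r => (1 - r) * cos (r * s)) F)//.
- rewrite /F -EFinB !subrr !mul0r sin0 cos0 !mul1r mulr0 mulr1 sub0r; congr EFin.
  by field.
- apply: continuous_in_subspaceT => r _.
  apply: differentiable_continuous; apply/derivable1_diffP.
  by apply: derivableM.
- split=> [r _||] //; first by apply: cvg_at_right_filter; exact: cF.
  by apply: cvg_at_left_filter; exact: cF.
- by move=> r _; rewrite derive1E derive_val.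
Qed.

Lemma fejerE (s : R) : s != 0 -> fejer s = 2 * (1 - cos s) / s ^+ 2.
Proof.
move=> s0; pose G (r : R) := (1 - r) * cos (r * s).
have mG : measurable_fun setT G.
  by apply: measurable_funM; [exact: measurable_funB|exact: measurable_cos_mul].
(* The flag [b] opens or closes the interval at 0: the tent splits into a half on r > 0 and a
   reflected half on r <= 0, which must not share the point 0. *)
have iG (b : bool) : leb.-integrable setT (EFin \o (fun r => G r * \1_([set` Interval (BSide b 0%R) (BRight 1%R)]) r)).
  apply: le_integrable (integrable_indic_itv 0 1 b false) => //.
    by apply/measurable_EFinP/measurable_funM => //; exact: measurable_indic.
  move=> r _; rewrite lee_fin /= indicE.
  case: (boolP (r \in _)) => [|_]; last by rewrite mulr0.
  rewrite inE /= in_itv/= mulr1 => /andP[r0 r1].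
  have {}r0 : 0 <= r by case: b r0 => //; exact: ltW.
  rewrite normrM normr1 mulr_ile1//; last exact: cos_max.
  by rewrite ger0_norm; lra.
have E b : (\int[leb]_r (G r * \1_([set` Interval (BSide b 0%R) (BRight 1%R)]) r)%R%:E =
    ((1 - cos s) / s ^+ 2)%R%:E)%E.
  rewrite -integral_half_tent//.
  transitivity (\int[leb]_(r in [set` Interval (BSide b 0%R) (BRight 1%R)]) (G r)%:E)%E.
    by rewrite [RHS]integral_mkcond; apply: eq_integral => r _; rewrite epatch_indic EFinM.
  case: b => //; rewrite integral_itv_obnd_cbnd//; apply/measurable_EFinP.
  exact: measurable_funTS.
have iN := transports_integrable (@transports_opp_line R) (iG true).
have := transports_integral (@transports_opp_line R) (iG true).
rewrite (E true) mul1e => EN.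
have -> : fejer s = \int[leb]_r (G r * \1_(`]0%R, 1%R]) r + G (- r) * \1_(`[0%R, 1%R]) (- r)).
  apply: eq_Rintegral => r _; rewrite !indicE !mem_setE !in_itv/= /G mulNr cosN opprK oppr_ge0.
  have [r0|r0] := ltP 0 r; have [r1|r1] := leP `|r| 1.
  - rewrite gtr0_norm// in r1; rewrite r1 /= mulr0 addr0 mulr1.
    by rewrite /tent gtr0_norm// max_r// subr_ge0.
  - rewrite tent_eq0 ?(ltW r1)//; rewrite gtr0_norm// in r1.
    by rewrite [r <= 1]leNgt r1 /= !mulr0 mul0r addr0.
  - rewrite ler0_norm// in r1; rewrite r1 /= mulr0 add0r mulr1 /tent ler0_norm// opprK.
    by rewrite max_r//; lra.
  rewrite tent_eq0 ?(ltW r1)//; rewrite ler0_norm// in r1.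
  by rewrite [- r <= 1]leNgt r1 /= !mulr0 mul0r addr0.
rewrite (RintegralD measurableT (iG false) iN).
rewrite /Rintegral (E false) EN /=; ring.
Qed.

Lemma fejer_ge0 s : 0 <= fejer s.
Proof.
have [->|s0] := eqVneq s 0.
  by apply: Rintegral_ge0 => r _; rewrite mulr0 cos0 mulr1 tent_ge0.
by rewrite fejerE// divr_ge0 ?sqr_ge0// mulr_ge0// subr_ge0 cos_le1.
Qed.

Lemma fejer_le2 s : fejer s <= 2.
Proof.
rewrite -[fejer s]ger0_norm ?fejer_ge0//.
by have := cos_transform_sup ler01 tent_L1_variation s; rewrite mul1r.
Qed.

(** For |s| <= 1 the kernel is at most 2 and (1 + |s|)^2 <= 4; for |s| > 1 the numerator 2 (1 - cos
    s) is at most 4 and (1 + |s|)^2 <= 4 s^2, whence 16. *)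
Lemma fejer_le s : fejer s <= 16 * (1 + `|s|) ^- 2.
Proof.
have a0 : 0 < (1 + `|s|) ^+ 2 by rewrite exprn_gt0// ltr_pwDl.
rewrite ler_pdivlMr//.
have [s1|s1] := leP `|s| 1.
  have : (1 + `|s|) ^+ 2 <= 4 by have := normr_ge0 s; nra.
  by have := fejer_le2 s; have := fejer_ge0 s; nra.
have s0 : s != 0 by rewrite -normr_gt0; lra.
have s2 : 0 < s ^+ 2 by rewrite exprn_even_gt0.
rewrite fejerE// mulrAC ler_pdivrMr//.
have c1 : 0 <= 1 - cos s <= 2 by have := cos_le1 s; have := cos_geN1 s; lra.
have : (1 + `|s|) ^+ 2 <= 4 * s ^+ 2 by rewrite -[s ^+ 2]real_normK ?num_real//; nra.
by nra.
Qed.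

Lemma measurable_fejer : measurable_fun setT fejer.
Proof. exact: measurable_cos_transform tent_L1_variation. Qed.

Lemma integrable_fejer : leb.-integrable setT (EFin \o fejer).
Proof.
have h12 : (1 : R) < 2 by rewrite ltr1n.
have iw := integrableZl measurableT 16 (integrable_weight h12).
apply: le_integrable iw => //; first by apply/measurable_EFinP; exact: measurable_fejer.
move=> s _; rewrite lee_fin ger0_norm ?fejer_ge0// ger0_norm ?mulr_ge0 ?weight_ge0//.
by rewrite /weight powRN powR_mulrn ?addr_ge0//; exact: fejer_le.
Qed.

Definition fejer_mass : R := \int[leb]_s fejer s.

Lemma fejer_mass_gt0 : 0 < fejer_mass.
Proof.
have pi0 := pi_gt0 R.
(* On []pi / 2, pi[] the cosine is nonpositive, so 2 (1 - cos s) >= 2, and s^2 <= pi^2. *)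
have c0 : 0 < 2 / pi ^+ 2 :> R by rewrite divr_gt0// exprn_gt0.
have iI : leb.-integrable setT (EFin \o (\1_(`](pi / 2 : R), pi[) : R -> R)).
  exact: integrable_indic_itv.
have : 2 / pi ^+ 2 * (pi - pi / 2) <= fejer_mass.
  rewrite -(@integral_itv_indic R (pi / 2)); last lra.
  rewrite -RintegralZl//; apply: le_Rintegral => //.
  - exact: (integrableZl measurableT _ iI).
  - exact: integrable_fejer.
  move=> s _; rewrite indicE; case: (boolP (s \in _)) => [|_]; last first.
    by rewrite mulr0 fejer_ge0.
  rewrite inE /= in_itv/= => /andP[s1 s2]; rewrite mulr1.
  have s0 : 0 < s by lra.
  rewrite fejerE ?gt_eqF//; apply: ler_pM => //; first by rewrite invr_ge0 exprn_ge0// ltW.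
    have : 0 <= cos (s - pi) by apply: cos_ge0_pihalf; lra.
    by rewrite cosB cospi sinpi; lra.
  by rewrite lef_pV2 ?posrE ?exprn_gt0// lerXn2r ?nnegrE ?(ltW s0) ?(ltW pi0)// ltW.
by apply: lt_le_trans; rewrite mulr_gt0//; lra.
Qed.

Lemma tent_factorE (beta s : R) : 0 < beta ->
  tent_factor beta s = beta * fejer (beta * s).
Proof.
move=> b0; have b00 : beta^-1 != 0 by rewrite invr_eq0 gt_eqF.
have iq := bv_integrable_cos tent_L1_variation (beta * s).
have := transports_integral (transports_scale_line b00) iq.
rewrite gtr0_norm ?invr_gt0// invrK => E.
rewrite /tent_factor /fejer /cos_transform /Rintegral -[X in X * _]/(fine beta%:E).
rewrite -fineM//; last exact: (integrable_fin_num measurableT iq).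
rewrite -E; congr fine; apply: eq_integral => r _ /=.
by rewrite mulrC [_^-1 * r]mulrC mulrA divfK ?gt_eqF// mulrC.
Qed.

Lemma tent_factor_ge0 (beta s : R) : 0 < beta -> 0 <= tent_factor beta s.
Proof. by move=> b0; rewrite tent_factorE// mulr_ge0 ?fejer_ge0// ltW. Qed.

(** Uniform in [beta], since t <= (1 + t)^2 for t = beta |s|; this keeps a common dominating
    function when beta tends to infinity. *)
Lemma norm_tent_factor_le (beta s : R) : 0 < beta -> `|s| * tent_factor beta s <= 16.
Proof.
move=> b0; rewrite tent_factorE//.
have := fejer_le (beta * s); rewrite normrM (gtr0_norm b0).
have := fejer_ge0 (beta * s); move: (fejer _) => K K0.
rewrite mulrCA mulrA; set t := beta * `|s|; have t0 : 0 <= t by rewrite mulr_ge0// ltW.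
have a0 : 0 < (1 + t) ^+ 2 by rewrite exprn_gt0// ltr_pwDl.
rewrite ler_pdivlMr//; apply: le_trans; rewrite mulrC ler_wpM2l//.
by rewrite sqrrD expr1n mul1r mulr2n; have := sqr_ge0 t; lra.
Qed.

Lemma tent_factor_decay (beta s : R) : 0 < beta ->
  tent_factor beta s <= (beta *+ 2 + 16) * weight 1 s.
Proof.
move=> b0; rewrite weight1E ler_pdivlMr ?ltr_pwDl// mulrDr mulr1 lerD//.
  by rewrite tent_factorE// -mulr_natr ler_wpM2l ?fejer_le2// ltW.
by rewrite mulrC norm_tent_factor_le.
Qed.

Lemma measurable_tent_factor (beta : R) : 0 < beta -> measurable_fun setT (tent_factor beta).
Proof.
move=> b0; rewrite (_ : tent_factor beta = fun s => beta * fejer (beta * s)).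
  by apply: measurable_funM => //; apply: (measurableT_comp measurable_fejer); exact: measurable_funM.
by apply/funext => s; rewrite tent_factorE.
Qed.

(** The product of the 1 + |x_i| is at least 1 + |x|, so a product of one-variable decays can be
    paired with [f], whose integrability is known for radial weights. *)
Lemma prod_weight1_le n (x : 'cV[R]_n) :
  \prod_(i < n) weight 1 (x i ord0) <= weight 1 (euclid_norm x).
Proof.
rewrite weight1E ger0_norm ?euclid_norm_ge0//.
rewrite (eq_bigr (fun i => (1 + `|x i ord0|)^-1)) => [|i _]; last by rewrite weight1E.
rewrite prodfV lef_pV2 ?posrE; first exact: norm_le_prod.
  by apply: prodr_gt0 => i _; rewrite ltr_pwDl.
by rewrite ltr_pwDl ?euclid_norm_ge0.
Qed.

End fejer_kernel.

Section annihilation.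
Context {R : realType}.
Local Notation leb := (@lebesgue_measure R).
Local Notation vol := (@lebesgue_cV R).

Lemma euclid_norm_eq0 n (x : 'cV[R]_n) : (euclid_norm x == 0) = (x == 0).
Proof.
apply/eqP/eqP => [x0|->]; last by rewrite -[0](scale0r 0) euclid_normZ normr0 mul0r.
apply/matrixP => i j; rewrite !ord1 mxE; apply/eqP.
by rewrite -normr_le0 (le_trans (entry_le_norm _ _))// x0.
Qed.

Lemma ae_neq0 n : {ae vol n.+1, forall x, x != 0}.
Proof.
have mS : measurable [set (0 : 'cV[R]_n.+1)].
  rewrite (_ : [set _] = setT `&` @euclid_norm R n.+1 @^-1` [set 0]).
    exact: measurable_euclid_norm.
  rewrite setTI; apply/seteqP; split => x /= /eqP; first by rewrite -euclid_norm_eq0 => /eqP.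
  by rewrite euclid_norm_eq0 => /eqP.
exists [set 0]; split => //; last by move=> x /= /negP; rewrite negbK => /eqP.
apply/eqP; rewrite eq_le measure_ge0 andbT; apply/lee_addgt0Pr => e e0.
rewrite add0e; pose c := Num.min e 1 / 2.
have c0 : 0 < c by rewrite divr_gt0// lt_min e0 ltr01.
have c2 : c *+ 2 = Num.min e 1 by rewrite -mulr_natr divfK.
apply: (@le_trans _ _ (vol n.+1 (cube n.+1 c))).
  apply: le_measure; rewrite ?inE//; first exact: measurable_cube.
  by move=> _ -> i; rewrite mxE normr0.
rewrite (vol_cube n.+1 (ltW c0)) lee_fin c2 exprS.
have m0 : 0 <= Num.min e 1 by rewrite le_min ltW//= ler01.
apply: (@le_trans _ _ (Num.min e 1)); last by rewrite ge_min lexx.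
by rewrite ler_piMr// exprn_ile1// ge_min lexx orbT.
Qed.

Lemma weight_le_exponent (s t x : R) : s <= t -> weight t x <= weight s x.
Proof.
by move=> st; rewrite /weight ler_powR ?lerN2// lerDl.
Qed.

Lemma direction_stiefel n (w : 'cV[R]_n) : w != 0 -> stiefel n 1 (direction w).
Proof.
rewrite -euclid_norm_eq0 => e0.
rewrite /stiefel /= [LHS]mx11_scalar; congr scalar_mx.
rewrite -[LHS]/(dot (direction w) (direction w)) -sqr_euclid_norm /direction.
by rewrite euclid_normZ ger0_norm ?invr_ge0 ?euclid_norm_ge0// mulVf// expr1n.
Qed.

Variables (k : nat) (alpha rho s beta : R) (f : 'cV[R]_k.+2 -> R).
Hypothesis alpha0 : 0 <= alpha.
Hypothesis rho0 : 0 < rho.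
Hypothesis s01 : 0 < s < 1.
Hypothesis beta0 : 0 < beta.
Hypothesis mf : measurable_fun setT f.
Hypothesis fi : (vol k.+2).-integrable setT (fun x => (f x * weight s (euclid_norm x))%:E).
Hypothesis mean0 : {ae vol k.+2, forall w, unit_ball k.+2 w ->
  stiefel k.+2 1 (direction w) ->
  {ae vol 1, forall t, mean_transform alpha rho f (direction w) t = 0%E}}.

Let bP (w : 'cV[R]_k.+2) : L1_variation (probe beta w) _ _ _ := probe_L1_variation beta0 w.

Lemma probe_transform_out (w : 'cV[R]_k.+2) t :
  ~ unit_ball k.+2 w -> cos_transform (probe beta w) t = 0.
Proof.
move=> wb; rewrite /cos_transform /Rintegral integral0_eq// => r _.
by have [->|/(probe_supp beta0)//] := eqVneq (probe beta w r) 0; rewrite mul0r.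
Qed.

(** Almost every [w] in the ball is nonzero, has a direction with vanishing mean, and makes [f]
    integrable against [weight s (dot w x)]; for such a [w] the rescaled probe is an admissible
    profile at the unit vector w/|w|. *)
Lemma probe_annihilates a : {ae vol k.+2, forall w,
  (\int[vol k.+2]_x (f x * cos_transform (probe beta w) (dot w (x - a)))%:E = 0)%E}.
Proof.
have := ae_integrable1 (weighted_integrable_prod s01 mf fi).
move: (ae_neq0 k.+1) mean0; apply: filterS3 => w w0 mw iw.
have [wb|wb] := pselect (unit_ball k.+2 w); last first.
  by apply: integral0_eq => x _; rewrite probe_transform_out// mulr0.
have e0 : 0 < euclid_norm w by rewrite lt_def euclid_norm_ge0 andbT euclid_norm_eq0.
have wE x : dot w x = euclid_norm w * dot (direction w) x.
  by rewrite /direction dotZl mulrA divff ?mul1r// gt_eqF.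
(* With v = w/|w|, the inequalities |w| <= 1 and s < 1 give (1 + |v.x|)^(-1) <= (1 + |w.x|)^(-s). *)
have iv : (vol k.+2).-integrable setT (fun x => (f x * weight 1 (dot (direction w) x))%:E).
  apply: le_integrable iw => //.
    apply/measurable_EFinP/measurable_funM => //.
    apply: (measurableT_comp (measurable_weight 1)); apply: measurable_dot.
      exact: measurable_cst.
    exact: measurable_id.
  move=> x _; rewrite lee_fin /= indicE mem_set// mul1r !normrM ler_wpM2l//.
  rewrite !ger0_norm ?weight_ge0//.
  have /andP[s0 s1] := s01.
  apply: le_trans (weight_le_exponent _ (ltW s1)).
  apply: weight_anti => //; rewrite wE normrM gtr0_norm//.
  by rewrite ler_piMl//; exact: ltW.
have sd := direction_stiefel w0.
have := mean_transform_annihilates alpha0 rho0 mf sd iv (mw wb sd).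
have ei0 : 0 < (euclid_norm w)^-1 by rewrite invr_gt0.
have B0 : 0 <= (euclid_norm w)^-1^-1 * (probe_radius k.+1 beta *+ 3).
  by rewrite invrK mulr_ge0 ?(ltW e0)// mulrn_wge0// ltW// probe_radius_gt0.
move=> /(_ _ _ _ _ (dot (direction w) a) B0 (scaled_probe_L1_variation beta0 w ei0)) <-.
apply: eq_integral => x _; congr EFin; congr (_ * _).
by rewrite (cos_transform_probe_scale beta0 w _ ei0) invrK mulrBr -!wE dotBr.
Qed.

Lemma integrable_probe_transform (y : 'cV[R]_k.+2) : (vol k.+2).-integrable setT
  (fun w => (cos_transform (probe beta w) (dot w y))%:E).
Proof.
apply: le_integrable (integrableZl measurableT (1 * (probe_radius k.+1 beta *+ 3 *+ 2))
    (@integrable_cube R k.+2 1 ler01)) => //.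
  apply/measurable_EFinP.
  pose G (u : 'cV[R]_k.+2 * measurableTypeR R) :=
    probe beta u.1 u.2 * cos (u.2 * dot u.1 y).
  apply: (@measurable_Rintegral_param R _ _ _ _ leb G).
  apply: measurable_funM; first exact: (measurable_probe_comp _ measurable_fst measurable_snd).
  apply: (measurableT_comp (continuous_measurable_fun (@continuous_cos R))).
  apply: measurable_funM; first exact: measurable_snd.
  apply: measurable_dot; first exact: measurable_fst.
  exact: measurable_cst.
have M0 : 0 <= probe_radius k.+1 beta *+ 3 by apply/mulrn_wge0/ltW/probe_radius_gt0.
move=> w _; rewrite -EFinM lee_fin.
have [wb|wb] := pselect (unit_ball k.+2 w); last by rewrite probe_transform_out// normr0.
rewrite indicE mem_set; last exact: unit_ball_cube.
rewrite mulr1; apply: le_trans (ler_norm _).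
exact: cos_transform_sup M0 (bP w) _.
Qed.

Let H a (z : 'cV[R]_k.+2 * 'cV[R]_k.+2) :=
  f z.2 * cos_transform (probe beta z.1) (dot z.1 (z.2 - a)).

(** The probes share their bounds on sup norm, support and variation, so their transforms decay
    uniformly in [w]; the translation by a costs at most a factor 1 + |a|, and
    [weighted_integrable_prod] does the rest. *)
Lemma integrable_probe_pairing a :
  (vol k.+2 \x vol k.+2)%E.-integrable setT (EFin \o H a).
Proof.
pose C := (10 * (probe_radius k.+1 beta *+ 3) * 1 + 4 * probe_variation k.+1 beta) *
  (1 + euclid_norm a).
have iC := integrableZl measurableT C (weighted_integrable_prod s01 mf fi).
apply: le_integrable iC => //.
  apply/measurable_EFinP/measurable_funM.
    exact: (measurableT_comp mf measurable_snd).
  pose G (u : ('cV[R]_k.+2 * 'cV[R]_k.+2) * measurableTypeR R) :=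
    probe beta u.1.1 u.2 * cos (u.2 * dot u.1.1 (u.1.2 - a)).
  apply: (@measurable_Rintegral_param R _ _ _ _ leb G).
  have m11 := measurableT_comp (measurable_fst (T1 := 'cV[R]_k.+2) (T2 := 'cV[R]_k.+2))
    (measurable_fst (T2 := measurableTypeR R)).
  have m12 := measurableT_comp (measurable_snd (T1 := 'cV[R]_k.+2) (T2 := 'cV[R]_k.+2))
    (measurable_fst (T2 := measurableTypeR R)).
  apply: measurable_funM; first exact: (measurable_probe_comp _ m11 measurable_snd).
  apply: (measurableT_comp (continuous_measurable_fun (@continuous_cos R))).
  apply: measurable_funM; first exact: measurable_snd.
  apply: measurable_dot; first exact: m11.
  apply: measurable_subrmx; first exact: m12.
  exact: measurable_cst.
move=> [w x] _; rewrite -EFinM lee_fin /H /=.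
have [wb|wb] := pselect (unit_ball k.+2 w); last first.
  by rewrite probe_transform_out// mulr0 normr0.
rewrite indicE mem_set// mul1r normrM.
have M0 : 0 <= probe_radius k.+1 beta *+ 3 by apply/mulrn_wge0/ltW/probe_radius_gt0.
have V0 : 0 <= probe_variation k.+1 beta.
  have [_ _ _ /(_ 1)] := bP w; rewrite ltr01 lexx => /(_ isT).
  by rewrite mulr1 -lee_fin; apply: le_trans; exact: integral_ge0.
have D0 : 0 <= 10 * (probe_radius k.+1 beta *+ 3) * 1 + 4 * probe_variation k.+1 beta.
  by rewrite addr_ge0// !mulr_ge0.
have C0 : 0 <= C by rewrite mulr_ge0// addr_ge0// euclid_norm_ge0.
rewrite [X in _ <= X]normrM (ger0_norm C0) [`|f x * weight _ _|]normrM (ger0_norm (weight_ge0 _ _)) mulrCA ler_wpM2l//.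
rewrite dotBr; apply: le_trans (transform_shift_bound _ _ M0 (bP w)) _.
have /andP[s0 s1] := s01.
apply: ler_pM; rewrite ?weight_ge0 ?weight_le_exponent ?(ltW s1)//.
  by rewrite mulr_ge0// addr_ge0.
rewrite ler_wpM2l// lerD2l (le_trans (dot_le_norm _ _))// ler_piMl ?euclid_norm_ge0//.
exact: ltW.
Qed.

Lemma measurable_tent_transform (a : 'cV[R]_k.+2) :
  measurable_fun setT (fun x : 'cV[R]_k.+2 => tent_transform beta (x - a)).
Proof.
under eq_fun => x do rewrite tent_transform_prod//.
apply: measurable_prod => i _; apply: (measurableT_comp (measurable_tent_factor beta0)).
apply: measurable_entrymx; apply: measurable_subrmx; first exact: measurable_id.
exact: measurable_cst.
Qed.

Lemma integrable_tent_pairing a : (vol k.+2).-integrable setT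
  (fun x => (f x * tent_transform beta (x - a))%:E).
Proof.
pose C := \prod_(i < k.+2) ((beta *+ 2 + 16) * (1 + `|- a i ord0|)).
have D0 : 0 <= beta *+ 2 + 16 by apply: addr_ge0 => //; apply: mulrn_wge0; exact: ltW.
have C0 : 0 <= C by apply: prodr_ge0 => i _; rewrite mulr_ge0// addr_ge0.
have iC := integrableZl measurableT C fi.
apply: le_integrable iC => //.
  by apply/measurable_EFinP/measurable_funM => //; exact: measurable_tent_transform.
move=> x _; rewrite -EFinM lee_fin mulrCA normrM.
rewrite [X in _ <= X]normrM ler_wpM2l// [X in _ <= X]ger0_norm ?mulr_ge0 ?weight_ge0//.
rewrite tent_transform_prod// ger0_norm; last first.
  by apply: prodr_ge0 => i _; exact: tent_factor_ge0.
apply: (@le_trans _ _ (C * \prod_(i < k.+2) weight 1 (x i ord0))).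
  rewrite -big_split /=; apply: ler_prod => i _; rewrite tent_factor_ge0//= !mxE.
  rewrite (le_trans (tent_factor_decay _ beta0))// -mulrA ler_wpM2l//.
  exact: weight1_shift.
rewrite ler_wpM2l//; apply: le_trans (prod_weight1_le x) _.
by apply: weight_le_exponent; have /andP[_ /ltW] := s01.
Qed.

(** Fubini for [H]: integrating over x first gives 0 for almost every w, while integrating over w
    first gives the positive constant [probe_mass] times the present integrand. *)
Lemma tent_transform_annihilates a :
  (\int[vol k.+2]_x (f x * tent_transform beta (x - a))%:E = 0)%E.
Proof.
have iH := integrable_probe_pairing a.
have K0 := @probe_mass_gt0 R k.+1 beta beta0.
have E (x : 'cV[R]_k.+2) : (\int[vol k.+2]_w (EFin \o H a) (w, x) =
    (@probe_mass R k.+1 beta)%:E * (f x * tent_transform beta (x - a))%:E)%E.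
  have iy := integrable_probe_transform (x - a).
  have Z := integralZl measurableT iy (f x).
  by rewrite (probe_average beta0) -EFinM mulrCA EFinM in Z.
have L0 : (\int[vol k.+2]_w \int[vol k.+2]_x (EFin \o H a) (w, x) = 0)%E.
  have mL := measurable_int _ (integrable_fubini_F iH).
  have EF : ae_eq (vol k.+2) setT (fubini_F (vol k.+2) (EFin \o H a)) (cst 0%E).
    by apply: filterS (probe_annihilates a) => w + _.
  have := ae_eq_integral _ _ measurableT mL (measurable_cst _) EF.
  by rewrite integral0.
rewrite (Fubini iH) in L0.
have Z := integralZl measurableT (integrable_tent_pairing a) (@probe_mass R k.+1 beta).
have {L0} : ((@probe_mass R k.+1 beta)%:E *
    \int[vol k.+2]_x (f x * tent_transform beta (x - a))%:E = 0)%E.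
  by rewrite -L0 -Z; apply: eq_integral => x _; rewrite E.
by move/eqP; rewrite mule_eq0 eqe gt_eqF//= => /eqP.
Qed.

End annihilation.

(** * Indicators of intervals smoothed by Fejer kernels *)

Section smoothed_indicator.
Context {R : realType}.
Local Notation leb := (@lebesgue_measure R).
Implicit Types l u beta s : R.

(** Convolution with [tent_factor beta], which is [beta] times a Fejer kernel dilated by [beta]: an
    approximate identity of total mass [fejer_mass] instead of 1. The variable a is the centre of a
    translate that [f] annihilates. *)
Definition smooth_indic l u beta s : R :=
  \int[leb]_a (\1_(`]l, u]) a * tent_factor beta (s - a)).

Lemma integrable_indic_tent_factor l u beta s : 0 < beta ->
  leb.-integrable setT (fun a => (\1_(`]l, u]) a * tent_factor beta (s - a))%:E).
Proof.
move=> b0; have iI := integrable_indic_itv l u false false (R := R).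
apply: le_integrable (integrableZl measurableT (beta * 2) iI) => //.
  apply/measurable_EFinP/measurable_funM; first exact: measurable_indic.
  apply: (measurableT_comp (measurable_tent_factor b0)).
  exact: measurable_funB.
move=> a _; rewrite -EFinM lee_fin [leLHS]normrM [leRHS]normrM [leLHS]mulrC ler_wpM2r//.
rewrite ger0_norm ?tent_factor_ge0// ger0_norm ?mulr_ge0 ?(ltW b0)//.
by rewrite tent_factorE// ler_wpM2l ?fejer_le2// ltW.
Qed.

Lemma integrable_indic_fejer l u (b s : R) :
  leb.-integrable setT (fun t => (\1_(`]l, u]) (s - b * t) * fejer t)%:E).
Proof.
apply: le_integrable (@integrable_fejer R) => //.
  apply/measurable_EFinP/measurable_funM; last exact: measurable_fejer.
  have mI : measurable_fun setT (\1_(`]l, u]) : R -> R) by exact: measurable_indic.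
  apply: (measurableT_comp mI).
  by apply: measurable_funB => //; exact: measurable_funM.
by move=> t _; rewrite lee_fin normrM ler_piMl// ger0_norm//.
Qed.

Lemma smooth_indicE l u beta s : 0 < beta ->
  smooth_indic l u beta s = \int[leb]_t (\1_(`]l, u]) (s - beta^-1 * t) * fejer t).
Proof.
move=> b0; pose G t := \1_(`]l, u]) (s - beta^-1 * t) * fejer t.
have bN0 : - beta != 0 by rewrite oppr_eq0 gt_eqF.
have iG := integrable_indic_fejer l u beta^-1 s.
have iG' := transports_integrable (transports_scale_line bN0) iG.
have E1 := transports_integral (transports_shift_line (- s)) iG'.
have E2 := transports_integral (transports_scale_line bN0) iG.
have E3 := etrans E1 (etrans (mul1e _) E2).
have iS := transports_integrable (transports_shift_line (- s)) iG'.
transitivity (beta * \int[leb]_a G (- beta * (a + - s))).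
  rewrite -RintegralZl//; apply: eq_Rintegral => a _; rewrite /G tent_factorE//.
  have -> : s - beta^-1 * (- beta * (a + - s)) = a by field; rewrite gt_eqF.
  have -> : - beta * (a + - s) = beta * (s - a) by ring.
  by rewrite mulrCA.
rewrite /Rintegral E3 normrN (gtr0_norm b0) fineM//; last exact: (integrable_fin_num measurableT iG).
by rewrite mulrA mulfV ?mul1r// gt_eqF.
Qed.

Lemma smooth_indic_ge0 l u beta s : 0 < beta -> 0 <= smooth_indic l u beta s.
Proof. by move=> b0; apply: Rintegral_ge0 => a _; rewrite mulr_ge0 ?tent_factor_ge0. Qed.

Lemma smooth_indic_le_mass l u beta s : 0 < beta -> smooth_indic l u beta s <= fejer_mass.
Proof.
move=> b0; rewrite smooth_indicE//; apply: le_Rintegral => //.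
- exact: integrable_indic_fejer.
- exact: integrable_fejer.
move=> t _; rewrite ler_piMl ?fejer_ge0// indicE; by case: (_ \in _).
Qed.

(** From |s| <= |a| + |s - a|: the first term is at most |l| + |u| on the interval, and the second
    is absorbed by the kernel through [norm_tent_factor_le]. The result does not involve [beta]. *)
Lemma smooth_indic_decay l u beta s : l <= u -> 0 < beta ->
  smooth_indic l u beta s <=
  ((1 + `|l| + `|u|) * fejer_mass + 16 * (u - l)) * weight 1 s.
Proof.
move=> lu b0; have k0 := smooth_indic_ge0 l u s b0.
have km := smooth_indic_le_mass l u s b0.
have iK := integrable_indic_tent_factor l u s b0.
have iI := integrable_indic_itv l u false false (R := R).
rewrite weight1E ler_pdivlMr ?ltr_pwDl//.
have h : smooth_indic l u beta s * `|s| <=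
    (`|l| + `|u|) * smooth_indic l u beta s + 16 * (u - l).
  have Il : \int[leb]_a (\1_(`]l, u]) a) = u - l.
    rewrite /Rintegral integral_indic//= setIT lebesgue_measure_itv/= lte_fin.
    by case: ltP => //= ul; apply/esym/eqP; rewrite subr_eq0 eq_le ul lu.
  rewrite -Il mulrC -!RintegralZl//.
  have i1 := integrableZl measurableT (`|l| + `|u|) iK.
  have i2 := integrableZl measurableT 16 iI.
  rewrite -(RintegralD measurableT i1 i2).
  apply: le_Rintegral => //; first exact: (integrableZl measurableT _ iK).
    exact: (integrableD measurableT i1 i2).
  move=> a _; rewrite indicE; case: (boolP (a \in _)) => [|_]; last by rewrite !mul0r !mulr0 addr0.
  rewrite inE /= in_itv/= !mul1r mulr1 => /andP[la au].
  have a0 : `|a| <= `|l| + `|u|.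
    rewrite ler_norml; have := ler_norm u; have := lerNnormlW (lexx `|l|).
    have := normr_ge0 l; have := normr_ge0 u; have := ler_norm (- l); rewrite normrN.
    by move=> *; apply/andP; split; lra.
  have sa : `|s| <= `|a| + `|s - a| by rewrite -{1}(subrKC a s) ler_normD.
  have := norm_tent_factor_le (s - a) b0; have := tent_factor_ge0 (s - a) b0.
  by move: (tent_factor _ _) => K K0 h; nra.
by have := normr_ge0 l; have := normr_ge0 u; nra.
Qed.

Lemma measurable_smooth_indic l u beta : 0 < beta -> measurable_fun setT (smooth_indic l u beta).
Proof.
move=> b0.
pose G (z : measurableTypeR R * measurableTypeR R) : R :=
  \1_(`]l, u]) z.2 * tent_factor beta (z.1 - z.2).
apply: (@measurable_Rintegral_param R _ _ _ _ leb G).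
apply: measurable_funM.
  have mI : measurable_fun setT (\1_(`]l, u]) : measurableTypeR R -> R) by exact: measurable_indic.
  exact: (measurableT_comp mI measurable_snd).
apply: (measurableT_comp (measurable_tent_factor b0)).
by apply: measurable_funB; [exact: measurable_fst|exact: measurable_snd].
Qed.

(** After rescaling the kernel is fixed and only the indicator moves. Since s is not an endpoint,
    the indicator is eventually constant in n for each t, and [fejer] dominates. *)
Lemma smooth_indic_cvg l u s : s != l -> s != u ->
  smooth_indic l u n.+1%:R s @[n --> \oo] --> fejer_mass * \1_(`]l, u]) s.
Proof.
move=> sl su.
pose d := Num.min `|s - l| `|s - u|.
have d0 : 0 < d by rewrite lt_min !normr_gt0 !subr_eq0 sl su.
have step t : \forall n \near \oo, \1_(`]l, u]) (s - n.+1%:R^-1 * t) = \1_(`]l, u]) s :> R.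
  exists (Num.truncn (`|t| / d)) => // n /= tn.
  have nt : `|n.+1%:R^-1 * t| < d.
    rewrite normrM ger0_norm ?invr_ge0// mulrC ltr_pdivrMr// mulrC -ltr_pdivrMr//.
    by rewrite (lt_le_trans (truncnS_gt _))// ler_nat.
  move: nt; move: (_ * t) => v; rewrite lt_min !ltr_norml => /andP[v1 v2].
  rewrite !indicE !mem_setE !in_itv/=; congr (_%:R); congr nat_of_bool.
  have [ls|ls] := ltP l s; have [us|us] := leP s u => /=.
  - by apply/andP; split; move: v1 v2; rewrite gtr0_norm ?subr_gt0// ler0_norm ?subr_le0//; lra.
  - by apply/negbTE; rewrite negb_and -!leNgt -ltNge; apply/orP; right; move: v2; rewrite gtr0_norm ?subr_gt0//; lra.
  - by apply/negbTE; rewrite negb_and -!leNgt -ltNge; apply/orP; left; move: v1; rewrite ler0_norm ?subr_le0//; lra.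
  - by apply/negbTE; rewrite negb_and -!leNgt -ltNge; apply/orP; right; move: v2; rewrite gtr0_norm ?subr_gt0//; lra.
have iF n := integrable_indic_fejer l u n.+1%:R^-1 s.
have iL : leb.-integrable setT (fun t => (\1_(`]l, u]) s * fejer t)%:E).
  exact: (integrableZl measurableT _ (@integrable_fejer R)).
have cv (t : R) : (\1_(`]l, u]) (s - n.+1%:R^-1 * t) * fejer t)%:E @[n --> \oo] -->
    (\1_(`]l, u]) s * fejer t)%:E.
  by apply: cvg_near_cst; apply: filterS (step t) => n ->.
have bd n (t : R) : (`|(\1_(`]l, u]) (s - n.+1%:R^-1 * t) * fejer t)%:E| <= (fejer t)%:E)%E.
  rewrite lee_fin normrM (ger0_norm (fejer_ge0 t)) ler_piMl ?fejer_ge0// ger0_norm//.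
have [_ _ H] := dominated_convergence measurableT (fun n => measurable_int _ (iF n))
  (measurable_int _ iL) (aeW leb (fun t _ => cv t)) (@integrable_fejer R)
  (aeW leb (fun t n _ => bd n t)).
rewrite (_ : fejer_mass * _ = \int[leb]_t (\1_(`]l, u]) s * fejer t)); last first.
  rewrite mulrC -RintegralZl//; exact: integrable_fejer.
rewrite (_ : (fun n => _) = fun n => \int[leb]_t (\1_(`]l, u]) (s - n.+1%:R^-1 * t) * fejer t)).
  by apply: fine_cvg; rewrite fineK//; exact: (integrable_fin_num measurableT iL).
by apply/funext => n; rewrite smooth_indicE.
Qed.

End smoothed_indicator.

Section boxes.
Context {R : realType}.
Local Notation leb := (@lebesgue_measure R).
Local Notation vol := (@lebesgue_cV R).

(** The half-open sides match the intervals []a, b]] that generate the Borel sets of the line. Empty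
    boxes are allowed, so that boxes are stable under intersection. *)
Definition box n (l u : 'I_n -> R) : set 'cV[R]_n :=
  [set x | forall i, l i < x i ord0 <= u i].

Lemma cvg_prod_ord n (F : 'I_n -> nat -> R) (L : 'I_n -> R) :
  (forall i, F i m @[m --> \oo] --> L i) ->
  \prod_(i < n) F i m @[m --> \oo] --> \prod_(i < n) L i.
Proof.
elim: n => [|n IH] in F L * => FL.
  by rewrite big_ord0; under eq_fun do rewrite big_ord0; exact: cvg_cst.
rewrite big_ord_recl; under eq_fun do rewrite big_ord_recl.
by apply: cvgM; [exact: FL|apply: IH => i; exact: FL].
Qed.

Lemma boxE n (l u : 'I_n -> R) (x : 'cV[R]_n) :
  \1_(box l u) x = \prod_(i < n) \1_(`]l i, u i]) (x i ord0) :> R.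
Proof.
rewrite indicE; have [xb|xb] := pselect (box l u x).
  rewrite mem_set//; apply/esym/big1 => i _.
  by rewrite indicE mem_set//= in_itv/=; exact: xb.
rewrite memNset//; move/existsNP: xb => [i /negP xi].
rewrite (bigD1 i)//= indicE memNset ?mul0r//= in_itv/=; exact/negP.
Qed.

Lemma measurable_box n (l u : 'I_n -> R) : measurable (box l u).
Proof.
apply/(measurable_indicP R).
rewrite (_ : \1_(box l u) = fun x : 'cV[R]_n => \prod_(i < n) \1_(`]l i, u i]) (x i ord0) : R).
  apply: measurable_prod => i _.
  have mI : measurable_fun setT (\1_(`]l i, u i]) : R -> R) by exact: measurable_indic.
  exact: (measurableT_comp mI (measurable_mx_entry i ord0)).
by apply/funext => x; rewrite boxE.
Qed.

(** A slab over a null set is null, by Tonelli: for the first coordinate the outer integrand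
    vanishes off a null set, and for the others the inner integral vanishes by induction. *)
Lemma ae_coordinate n (i : 'I_n) (P : R -> Prop) :
  {ae leb, forall t, P t} -> {ae vol n, forall x : 'cV[R]_n, P (x i ord0)}.
Proof.
move=> [N [mN N0 PN]].
have mI : measurable_fun setT (\1_N : R -> R) by exact: measurable_indic.
have mC m (j : 'I_m) : measurable [set x : 'cV[R]_m | N (x j ord0)].
  by rewrite -[X in measurable X]setTI; exact: measurable_mx_entry.
exists [set x : 'cV[R]_n | N (x i ord0)]; split; [exact: mC| |by move=> x /= /PN].
elim: n i => [[]//|n IH] i.
rewrite -[[set x | _]]setIT -(integral_indic _ measurableT (mC _ i)).
have mX : measurable_fun setT
    (fun x : 'cV[R]_n.+1 => (\1_[set x : 'cV[R]_n.+1 | N (x i ord0)] x : R)%:E).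
  by apply/measurable_EFinP/measurable_indic; exact: mC.
rewrite ge0_integral_cVS//.
have [j ij|i0] := unliftP ord0 i; rewrite ?ij ?i0 in mX *.
  apply: integral0_eq => a _.
  rewrite (eq_integral (fun y : 'cV[R]_n => (\1_[set x : 'cV[R]_n | N (x j ord0)] y : R)%:E)).
    by rewrite (integral_indic _ measurableT (mC n j)) setIT; exact: IH.
  move=> y _; rewrite !indicE; congr (_%:R%:E); congr nat_of_bool.
  by apply/idP/idP; rewrite !inE /= cons_cVS.
have EF : ae_eq leb setT (fun a : measurableTypeR R => \int[vol n]_y
    (\1_[set x : 'cV[R]_n.+1 | N (x ord0 ord0)] (cons_cV (a, y)) : R)%:E)%E (cst 0%E).
  exists N; split => // a /= /not_implyP[_ aN]; apply: contrapT => Na; apply: aN.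
  by apply: integral0_eq => y _; rewrite indicE memNset//= cons_cV0.
rewrite (ae_eq_integral _ _ measurableT _ (measurable_cst _) EF) ?integral0//.
by apply: (measurable_integral_cons mX) => x; rewrite lee_fin.
Qed.

Variables (n : nat) (s : R) (f : 'cV[R]_n.+1 -> R).
Hypothesis s1 : s <= 1.
Hypothesis mf : measurable_fun setT f.
Hypothesis fi : (vol n.+1).-integrable setT (fun x => (f x * weight s (euclid_norm x))%:E).

Section kernel.
Variables (l u : 'I_n.+1 -> R).
Hypothesis lu : forall i, l i <= u i.

Let C := \prod_(i < n.+1) ((1 + `|l i| + `|u i|) * fejer_mass + 16 * (u i - l i)).

Let C0 : 0 <= C.
Proof.
apply: prodr_ge0 => i _; have m0 := @fejer_mass_gt0 R.
have := lu i; have := normr_ge0 (l i); have := normr_ge0 (u i); nra.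
Qed.

Let K beta (x : 'cV[R]_n.+1) : R := \prod_(i < n.+1) smooth_indic (l i) (u i) beta (x i ord0).

Let K_ge0 beta x : 0 < beta -> 0 <= K beta x.
Proof. by move=> b0; apply: prodr_ge0 => i _; exact: smooth_indic_ge0. Qed.

Let K_le beta x : 0 < beta -> K beta x <= C * weight s (euclid_norm x).
Proof.
move=> b0; apply: (@le_trans _ _ (C * \prod_(i < n.+1) weight 1 (x i ord0))).
  rewrite -big_split /=; apply: ler_prod => i _.
  by rewrite smooth_indic_ge0//= smooth_indic_decay.
rewrite ler_wpM2l//; apply: le_trans (prod_weight1_le x) _.
exact: weight_le_exponent.
Qed.

Let mK beta : 0 < beta -> measurable_fun setT (K beta).
Proof.
move=> b0; apply: measurable_prod => i _.
apply: (measurableT_comp (measurable_smooth_indic (l i) (u i) b0)).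
exact: measurable_mx_entry.
Qed.

Let fK_le beta x : 0 < beta ->
  (`|(f x * K beta x)%:E| <= `|C%:E * (f x * weight s (euclid_norm x))%:E|)%E.
Proof.
move=> b0; rewrite -EFinM lee_fin mulrCA [leLHS]normrM [leRHS]normrM ler_wpM2l//.
by rewrite !ger0_norm ?mulr_ge0 ?weight_ge0 ?K_ge0 ?K_le.
Qed.

(** Fubini over x and over the centres a in the box: for fixed a the integral in x vanishes by
    hypothesis, and for fixed x the integral in a factors into smoothed indicators. *)
Lemma box_kernel_annihilates beta : 0 < beta ->
  (forall a, (\int[vol n.+1]_x (f x * tent_transform beta (x - a))%:E = 0)%E) ->
  (\int[vol n.+1]_x (f x * K beta x)%:E = 0)%E.
Proof.
move=> b0 ann.
pose g (x : 'cV[R]_n.+1) (i : 'I_n.+1) (a : R) := \1_(`]l i, u i]) a * tent_factor beta (x i ord0 - a).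
have gi x i : leb.-integrable setT (EFin \o g x i).
  exact: integrable_indic_tent_factor.
have gE (x a : 'cV[R]_n.+1) : \prod_(i < n.+1) g x i (a i ord0) = \1_(box l u) a * tent_transform beta (x - a).
  rewrite boxE tent_transform_prod// -big_split /=; apply: eq_bigr => i _.
  by rewrite /g !mxE.
have iC := integrableZl measurableT C fi.
pose H (z : 'cV[R]_n.+1 * 'cV[R]_n.+1) : R :=
  f z.1 * (\1_(box l u) z.2 * tent_transform beta (z.1 - z.2)).
have mH : measurable_fun setT (EFin \o H).
  apply/measurable_EFinP; apply: measurable_funM.
    exact: (measurableT_comp mf measurable_fst).
  apply: measurable_funM.
    have mI : measurable_fun setT (\1_(box l u) : 'cV[R]_n.+1 -> R).
      by apply: measurable_indic; exact: measurable_box.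
    exact: (measurableT_comp mI measurable_snd).
  under eq_fun => z do rewrite tent_transform_prod//.
  apply: measurable_prod => i _; apply: (measurableT_comp (measurable_tent_factor b0)).
  apply: measurable_entrymx; apply: measurable_subrmx; first exact: measurable_fst.
  exact: measurable_snd.
have iH : (vol n.+1 \x vol n.+1)%E.-integrable setT (EFin \o H).
  apply/(integrable12ltyP _ _ mH).
  have /integrableP[_] := iC; apply: le_lt_trans.
  apply: ge0_le_integral => //.
  - by move=> x _; exact: integral_ge0.
  - exact: (measurable_fun_fubini_tonelli_F _ (measurable_abse_comp mH)).
  - exact: measurable_abse_comp (measurable_int _ iC).
  move=> x _; apply: le_trans (fK_le x b0).
  have [iP EP] := integral_prod_cV (gi x).
  have g0 (a : 'cV[R]_n.+1) : 0 <= \prod_(i < n.+1) g x i (a i ord0).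
    by apply: prodr_ge0 => i _; rewrite mulr_ge0// tent_factor_ge0.
  rewrite (eq_integral (fun a : 'cV[R]_n.+1 =>
      `|f x|%:E * (\prod_(i < n.+1) g x i (a i ord0))%:E)%E); last first.
    by move=> a _; rewrite -EFinM -(ger0_norm (g0 a)) -normrM gE.
  rewrite ge0_integralZl//; last 2 first.
  - exact: measurable_int iP.
  - by move=> a _; rewrite lee_fin.
  rewrite EP -EFinM lee_fin normrM ler_wpM2l//; exact: ler_norm.
have L (x : 'cV[R]_n.+1) : (\int[vol n.+1]_a (EFin \o H) (x, a) = (f x * K beta x)%:E)%E.
  have [iP EP] := integral_prod_cV (gi x).
  rewrite (eq_integral (fun a : 'cV[R]_n.+1 =>
      (f x)%:E * (\prod_(i < n.+1) g x i (a i ord0))%:E)%E).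
    by rewrite integralZl// EP EFinM.
  by move=> a _; rewrite -EFinM gE.
transitivity (\int[vol n.+1]_x \int[vol n.+1]_a (EFin \o H) (x, a))%E.
  by apply: eq_integral => x _; rewrite L.
rewrite (Fubini iH); apply: integral0_eq => a _.
have [ab|ab] := boolP (a \in box l u); last first.
  by apply: integral0_eq => x _; rewrite /H /= indicE (negbTE ab) mul0r mulr0.
rewrite -[RHS](ann a); apply: eq_integral => x _.
by rewrite /H /= indicE ab mul1r.
Qed.

(* The smoothed indicator of an interval converges off its two endpoints, hence
   the product over the coordinates converges off finitely many null hyperplanes. *)
Lemma box_integral0 :
  (forall beta, 0 < beta ->
    forall a, (\int[vol n.+1]_x (f x * tent_transform beta (x - a))%:E = 0)%E) ->
  (\int[vol n.+1]_x (f x * \1_(box l u) x)%:E = 0)%E.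
Proof.
move=> ann; pose k m (x : 'cV[R]_n.+1) : R := K m.+1%:R x.
have m0 m : 0 < m.+1%:R :> R by [].
have k0 m : (\int[vol n.+1]_x (f x * k m x)%:E = 0)%E.
  exact: box_kernel_annihilates (m0 m) (ann _ (m0 m)).
have mk m : measurable_fun setT (fun x => (f x * k m x)%:E).
  by apply/measurable_EFinP/measurable_funM => //; exact: mK (m0 m).
pose L x := f x * (fejer_mass ^+ n.+1 * \1_(box l u) x).
have mL : measurable_fun setT (EFin \o L).
  apply/measurable_EFinP/measurable_funM => //; apply: measurable_funM => //.
  by apply: measurable_indic; exact: measurable_box.
have cv : {ae vol n.+1, forall x, (f x * k m x)%:E @[m --> \oo] --> (L x)%:E}.
  have N0 i : {ae vol n.+1, forall x : 'cV[R]_n.+1, (x i ord0 != l i) && (x i ord0 != u i)}.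
    apply: (@ae_coordinate _ i (fun t => (t != l i) && (t != u i))).
    exists [set l i; u i]; split.
    - exact: measurableU.
    - exact/countable_lebesgue_measure0/finite_set_countable/finite_set2.
    - by move=> t /= /negP; rewrite negb_and !negbK => /orP[/eqP ->|/eqP ->]; [left|right].
  have := @filter_forall _ _ _ _ (ae_filter_ringOfSetsType (vol n.+1)) N0.
  apply: (@filterS _ _ (ae_filter_ringOfSetsType (vol n.+1))) => x xlu.
  apply: cvg_EFin; first exact: nearW.
  apply: cvgM; first exact: cvg_cst.
  have -> : fejer_mass ^+ n.+1 = \prod_(i < n.+1) fejer_mass :> R by rewrite prodr_const card_ord.
  rewrite boxE -big_split /=; apply: cvg_prod_ord => i.
  by have /andP[xl xu] := xlu i; exact: smooth_indic_cvg.
have iC := integrableZl measurableT C fi.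
have bd : {ae vol n.+1, forall x, forall m, setT x -> (`|(f x * k m x)%:E| <= `|C%:E * (f x * weight s (euclid_norm x))%:E|)%E}.
  by apply: aeW => x m _; exact: fK_le.
have [iL _ H] := dominated_convergence measurableT mk mL
  (@filterS _ _ (ae_filter_ringOfSetsType (vol n.+1)) _ _ (fun x h _ => h) cv)
  (integrable_abse iC) bd.
have L0 : (\int[vol n.+1]_x (L x)%:E = 0)%E.
  apply: (cvg_unique _ H); first exact: ereal_hausdorff.
  by rewrite (_ : (fun m => _) = cst 0%E); [exact: cvg_cst|apply/funext => m; exact: k0].
have c0 : 0 < fejer_mass ^+ n.+1 :> R by rewrite exprn_gt0// fejer_mass_gt0.
have Z := integralZl measurableT iL (fejer_mass ^+ n.+1)^-1.
rewrite L0 mule0 in Z; rewrite -Z; apply: eq_integral => x _.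
by rewrite -EFinM /L mulrCA mulKf// gt_eqF.
Qed.

End kernel.

End boxes.

(** * From vanishing integrals over boxes to vanishing almost everywhere *)

Section box_uniqueness.
Context {R : realType}.
Local Notation vol := (@lebesgue_cV R).

Definition boxes n : set (set 'cV[R]_n) := [set A | exists l u, A = box l u].

Lemma boxI n (l u l' u' : 'I_n -> R) : box l u `&` box l' u' =
  box (fun i => Num.max (l i) (l' i)) (fun i => Num.min (u i) (u' i)).
Proof.
apply/seteqP; split => x /= => [[b1 b2] i|b].
  have /andP[h1 h2] := b1 i; have /andP[h3 h4] := b2 i.
  by rewrite gt_max le_min h1 h2 h3 h4.
by split=> i; have := b i; rewrite gt_max le_min => /andP[/andP[h1 h2] /andP[h3 h4]];
  rewrite ?h1 ?h2 ?h3 ?h4.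
Qed.

Lemma norm_lt_truncn (I : finType) (x : I -> R) :
  \forall N \near \oo, forall i, `|x i| < N%:R.
Proof.
apply: filter_forall => i; exists (Num.truncn `|x i|).+1 => // N /=.
by rewrite -(ler_nat R); apply: lt_le_trans; exact: truncnS_gt.
Qed.

Lemma measurable_boxes n : @measurable _ 'cV[R]_n = <<s @boxes n >>.
Proof.
apply/seteqP; split; last first.
  apply: smallest_sub; first exact: sigma_algebra_measurable.
  by move=> _ [l [u ->]]; exact: measurable_box.
apply: smallest_sub; first exact: smallest_sigma_algebra.
move=> _ [i [j [B [mB ->]]]]; rewrite (ord1 j) {j}.
pose S := [set B : set R | <<s @boxes n >> [set x : 'cV[R]_n | B (x i ord0)]].
suff: S B by [].
apply: mB; split.
  split; rewrite /S /=.
  - exact: sigma_algebra0.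
  - move=> A SA; rewrite (_ : mkset _ = ~` [set x : 'cV[R]_n | A (x i ord0)]).
      exact: sigma_algebraC.
    by apply/seteqP; split=> x /=; tauto.
  - by move=> F SF; exact: sigma_algebra_bigcup.
move=> _ [[a b] _ <-] /=; rewrite /S /=.
(* The slab over []a, b]] is the union over N of the boxes whose other sides are []-N, N]]. *)
pose l N (j : 'I_n) : R := if j == i then a else - N%:R.
pose u N (j : 'I_n) : R := if j == i then b else N%:R.
rewrite (_ : [set x : 'cV[R]_n | _] = \bigcup_N box (l N) (u N)).
  by apply: sigma_algebra_bigcup => N; apply: sub_sigma_algebra; exists (l N), (u N).
apply/seteqP; split => x /=; rewrite in_itv/=.
  move=> xi; have [N _ xN] := norm_lt_truncn (fun j => x j ord0).
  exists N => // j; rewrite /l /u; have [->//|_] := eqVneq j i.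
  have := xN N (leqnn N) j; rewrite ltr_norml => /andP[-> /ltW ->//].
by move=> [N _ /(_ i)]; rewrite /l /u eqxx.
Qed.

Variables (n : nat) (s : R) (f : 'cV[R]_n -> R).
Hypothesis s0 : 0 <= s.
Hypothesis mf : measurable_fun setT f.
Hypothesis fi : (vol n).-integrable setT (fun x => (f x * weight s (euclid_norm x))%:E).
Hypothesis f0 : forall l u, (forall i, l i <= u i) ->
  (\int[vol n]_x (f x * \1_(box l u) x)%:E = 0)%E.

Let D N : set 'cV[R]_n := box (fun=> - N%:R) (fun=> N%:R).

Lemma integrable_on_box N : (vol n).-integrable (D N) (EFin \o f).
Proof.
have mD : measurable (D N) by exact: measurable_box.
pose r : R := N%:R *+ n.
have iC := integrableZl mD (weight s r)^-1 (integrableS measurableT mD (@subsetT _ _) fi).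
apply: le_integrable iC => //; first exact/measurable_EFinP/measurable_funTS.
move=> x Dx; rewrite -EFinM lee_fin mulrCA [leRHS]normrM ler_peMr//.
rewrite ger0_norm ?mulr_ge0 ?invr_ge0 ?weight_ge0// ler_pdivlMl ?weight_gt0// mulr1.
apply: weight_anti => //; rewrite !ger0_norm ?euclid_norm_ge0 ?mulrn_wge0//.
apply: le_trans (norm_le_sum x) _.
rewrite /r -[n in leRHS]card_ord -sumr_const; apply: ler_sum => i _.
by have /andP[h1 h2] := Dx i; rewrite ler_norml (ltW h1).
Qed.

(** Intersections of boxes may have [u i < l i], which [f0] does not cover; such boxes are empty. *)
Lemma box_integral_set l u : (\int[vol n]_(x in box l u) (f x)%:E = 0)%E.
Proof.
have [lu|] := pselect (forall i, l i <= u i).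
  rewrite -(f0 lu) integral_mkcond; apply: eq_integral => x _.
  by rewrite epatch_indic EFinM.
move=> /existsNP[i /negP]; rewrite -ltNge => ul.
rewrite (_ : box l u = set0) ?integral_set0// -subset0 => x /(_ i) /andP[h1 h2].
by have := lt_le_trans (lt_trans ul h1) h2; rewrite ltxx.
Qed.

(** Dynkin's theorem on the generating pi-system of boxes. Working inside [D N] makes [f]
    integrable, so that integrals over complements can be split off. *)
Lemma integral_measurable_box N A : measurable A ->
  (\int[vol n]_(x in A `&` D N) (f x)%:E = 0)%E.
Proof.
have mD : measurable (D N) by exact: measurable_box.
have iD := integrable_on_box N.
rewrite measurable_boxes.
pose P (A : set 'cV[R]_n) := (\int[vol n]_(x in A `&` D N) (f x)%:E = 0)%E.
apply: (@dynkin_induction _ 'cV[R]_n (@boxes n) P); rewrite /P.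
- exact: measurable_boxes.
- by move=> _ _ [l [u ->]] [l' [u' ->]]; rewrite boxI; eexists; eexists.
- by rewrite setTI; exact: box_integral_set.
- by move=> _ [l [u ->]]; rewrite boxI; exact: box_integral_set.
- move=> B mB B0.
  have := @integral_setU _ _ _ (vol n) (B `&` D N) (~` B `&` D N) (EFin \o f).
  rewrite -setIUl setUCr setTI B0 add0e box_integral_set => <- //.
  + exact: measurableI.
  + by apply: measurableI => //; exact: measurableC.
  + exact: measurable_int iD.
  + by rewrite disj_set2E setIACA setICr set0I.
- move=> F mF tF F0; rewrite setI_bigcupl integral_bigcup.
  + by apply: eseries0 => i _ _; exact: F0.
  + by apply: trivIset_setIr.
  + by move=> k; exact: measurableI.
  + by apply: integrableS iD => //; [apply: bigcup_measurable => k _; exact: measurableI|move=> x [k _ []]].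
Qed.

Lemma ae_zero_of_boxes : {ae vol n, forall x, f x = 0}.
Proof.
have h N : {ae vol n, forall x, D N x -> f x = 0}.
  have mD : measurable (D N) by exact: measurable_box.
  have : ae_eq (vol n) (D N) (EFin \o f) (cst 0%E).
    apply: integral_ae_eq (integrable_on_box N) _ _ => // E ED mE.
    rewrite integral0 -(integral_measurable_box N mE).
    by rewrite (_ : E `&` D N = E)//; exact/setIidl.
  by apply: (@filterS _ _ (ae_filter_ringOfSetsType (vol n))) => x /= H Dx; case: (H Dx).
have := ae_foralln h.
apply: (@filterS _ _ (ae_filter_ringOfSetsType (vol n))) => x H.
have [N _ xN] := norm_lt_truncn (fun j => x j ord0).
apply: (H N) => i; have := xN N (leqnn N) i.
by rewrite ltr_norml => /andP[-> /ltW ->].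
Qed.

End box_uniqueness.

Theorem theorem2p3 (R : realType) (n : nat) (alpha rho p : R)
    (f : 'cV[R]_n -> R)
    (halpha : 0 <= alpha) (hn : (2 <= n)%N) (hrho : 0 < rho)
    (hp1 : 1 <= p) (hpn : p < n%:R / (n.-1)%:R)
    (hf : f \in Lfun (lebesgue_cV n) p%:E)
    (h0 : {ae (sphere_measure n \x lebesgue_cV 1)%E,
       forall vt : 'M[R]_(n, 1) * 'cV[R]_1,
         stiefel n 1 vt.1 -> mean_transform alpha rho f vt.1 vt.2 = 0%E}) :
  {ae lebesgue_cV n, forall x, f x = 0}.
Proof.
case: n => [|[|k]]// in f hn hpn hf h0 *.
have p0 : 0 < p by lra.
move: hpn; rewrite /= ltr_pdivlMr// => hpn.
(* Midpoint of the admissible range: p < n/(n-1) says exactly that n(p-1)/p < 1, here with n =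
   k+2. *)
pose s : R := (k.+2%:R * (p - 1) / p + 1) / 2.
have q0 : 0 <= k.+2%:R * (p - 1) / p by rewrite divr_ge0 ?mulr_ge0 ?subr_ge0 ?(ltW p0).
have q1 : k.+2%:R * (p - 1) / p < 1.
  by rewrite ltr_pdivrMr// mul1r -natr1; lra.
have s01 : 0 < s < 1 by rewrite /s; apply/andP; split; lra.
have /andP[s0 s1] := s01.
have sp : k.+2%:R * (p - 1) < s * p by rewrite -ltr_pdivrMr// /s; lra.
have mf : measurable_fun setT f.
  by move: (hf); rewrite inE => /andP[/[!inE]].
have fi := Lfun_weight hp1 (ltW s0) sp hf.
have mean0 : {ae lebesgue_cV k.+2, forall w, unit_ball k.+2 w ->
    stiefel k.+2 1 (direction w) ->
    {ae lebesgue_cV 1, forall t, mean_transform alpha rho f (direction w) t = 0%E}}.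
  have := ae_direction (ae_product h0).
  apply: (@filterS _ _ (ae_filter_ringOfSetsType _)) => w H wb sw.
  by apply: (@filterS _ _ (ae_filter_ringOfSetsType _)) (H wb) => t; exact.
apply: (ae_zero_of_boxes (ltW s0) mf fi) => l u lu.
apply: (box_integral0 (ltW s1) mf fi lu) => beta beta0 a.
exact: tent_transform_annihilates halpha hrho s01 beta0 mf fi mean0 a.
Qed.
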